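(* Let $d\ge 2$, let $(H,\mathbb{Y},\mathbf 1)$ be a $d$-CC system, and let $Y(-,x):H\otimes H\to H((x_1,\dots,x_d,|x|^{\mathbb R}))$ be its associated vertex operator. Then $(H,Y(-,x),\mathbf 1)$ is a conformal $d$-vertex algebra.
   Context: **Lie algebra.** Fix an integer $d\ge2$. $\mathfrak{so}(d+1,1)$ is the real Lie algebra with basis $D$, $P_\mu,K_\mu$ ($1\le\mu\le d$), $J_{\mu,\nu}$ ($1\le\mu<\nu\le d$), with $J_{\nu,\mu}=-J_{\mu,\nu}$ and brackets $[P_\mu,P_\nu]=[K_\mu,K_\nu]=0$, $[D,K_\mu]=-K_\mu$, $[D,P_\mu]=P_\mu$, $[D,J_{\mu,\nu}]=0$, $[P_\mu,K_\nu]=-2(\delta_{\mu,\nu}D+J_{\mu,\nu})$, $[J_{\mu,\nu},P_\rho]=-\delta_{\mu,\rho}P_\nu+\delta_{\nu,\rho}P_\mu$, $[J_{\mu,\nu},K_\rho]=-\delta_{\mu,\rho}K_\nu+\delta_{\nu,\rho}K_\mu$, $[J_{\mu,\nu},J_{\rho,\sigma}]=\delta_{\nu,\rho}J_{\mu,\sigma}-\delta_{\mu,\rho}J_{\nu,\sigma}-\delta_{\nu,\sigma}J_{\mu,\rho}+\delta_{\mu,\sigma}J_{\nu,\rho}$. For $X\in\mathfrak{so}(d+1,1)$ put $\tau_x(X)=\exp(-\sum_\rho x_\rho\,\mathrm{ad}P_\rho)X$ (a finite sum, polynomial in $x$ with coefficients in $\mathfrak{so}(d+1,1)$). **Compact modules.**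 A (complex) $\mathfrak{so}(d+1,1)$-module $H$ is compact if (C1) $H=\bigoplus_{\Delta\in\mathbb R}H_\Delta$ with $H_\Delta=\{a: Da=\Delta a\}$; (C2) $\sum_{\Delta\le M}\dim H_\Delta<\infty$ for all $M\in\mathbb R$; (C3) the action of $\mathfrak{so}(d)=\langle J_{\mu,\nu}\rangle$ on each $H_\Delta$ exponentiates to $\mathrm{SO}(d)$. Put $\overline H=\prod_\Delta H_\Delta$ (on which $\mathfrak{so}(d+1,1)$ acts componentwise), $H^\vee=\bigoplus_\Delta H_\Delta^*$, $\langle-,-\rangle:H^\vee\otimes\overline H\to\mathbb C$ the pairing, $\mathrm{pr}_\Delta:\overline H\to H_\Delta$ the projection. **$d$-CC systems.** $\mathrm{Conf}_n(\mathbb R^d)=\{(x^{(1)},\dots,x^{(n)})\in(\mathbb R^d)^n: x^{(i)}\ne x^{(j)}\text{ for }i\neq j\}$. For $n,m\ge1$, $U_{n,m}$ is the set of $((x^{(1)},\dots,x^{(n)},w),(y^{(1)},\dots,y^{(m)}))\in\mathrm{Conf}_{n+1}(\mathbb R^d)\times\mathrm{Conf}_m(\mathbb R^d)$ with $\min_k|x^{(k)}-w|>\max_l|y^{(l)}|$; $U_{0,m}=\mathrm{Conf}_1(\mathbb R^d)\times\mathrm{Conf}_m(\mathbb R^d)$. A $d$-CC system $(H,\mathbb Y,\mathbf 1)$ is a compact $\mathfrak{so}(d+1,1)$-module $H$, maps $\mathbb Y:\mathrm{Conf}_n(\mathbb R^d)\to\mathrm{Hom}_{\mathbb C}(H^{\otimes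 n},\overline H)$, $x_{[n]}\mapsto\mathbb Y_{x_{[n]}}$ ($n\ge1$), and $\mathbf 1\in H_0$ such that: (unit) $\mathbb Y_{(0)}(a)=a$; (analyticity) $x_{[n]}\mapsto\langle u,\mathbb Y_{x_{[n]}}(a_1,\dots,a_n)\rangle$ is real analytic on $\mathrm{Conf}_n(\mathbb R^d)$ for all $u\in H^\vee$, $a_i\in H$; (permutation invariance) $\mathbb Y_{(x^{(1)},\dots,x^{(n)})}(a_1,\dots,a_n)=\mathbb Y_{(x^{(\sigma1)},\dots,x^{(\sigma n)})}(a_{\sigma1},\dots,a_{\sigma n})$ for $\sigma\in S_n$; (vacuum) $\mathbb Y_{(x^{(1)},\dots,x^{(n+1)})}(a_1,\dots,a_n,\mathbf 1)=\mathbb Y_{(x^{(1)},\dots,x^{(n)})}(a_1,\dots,a_n)$ for $n\ge1$; (invariance of vacuum) $X\mathbf 1=0$ for all $X\in\mathfrak{so}(d+1,1)$; (translation invariance) $\mathbb Y_{x_{[n]}}(a_1,\dots,P_\mu a_p,\dots,a_n)=\frac{d}{dx^{(p)}_\mu}\mathbb Y_{x_{[n]}}(a_1,\dots,a_n)$ for all $p,\mu$; (conformal covariance) $X\,\mathbb Y_{x_{[n]}}(a_1,\dots,a_n)=\sum_{q=1}^n\mathbb Y_{x_{[n]}}(a_1,\dots,\tau_{x^{(q)}}(X)a_q,\dots,a_n)$ for all $X\in\mathfrak{so}(d+1,1)$; (strong cluster decomposition) for $n\ge0,m\ge1$, $a_i\in H$, $u\in H^\vee$, the series $\sum_{\Delta}\langle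 u,\mathbb Y_{(x^{(1)},\dots,x^{(n)},w)}(a_1,\dots,a_n,\mathrm{pr}_\Delta\mathbb Y_{(y^{(1)},\dots,y^{(m)})}(a_{n+1},\dots,a_{n+m}))\rangle$ converges absolutely on $U_{n,m}$, and its partial sums over $\Delta<M$ converge as $M\to\infty$, uniformly on compact subsets of $U_{n,m}$, to $\langle u,\mathbb Y_{(x^{(1)},\dots,x^{(n)},w+y^{(1)},\dots,w+y^{(m)})}(a_1,\dots,a_{n+m})\rangle$. **Spherical Laurent series.** $\mathbb R[x_1,\dots,x_d,|x|^{\mathbb R}]$ is the quotient of $\mathbb R[x_1,\dots,x_d]\otimes\mathbb R[t^{\mathbb R}]$ (group algebra of $(\mathbb R,+)$, $t^rt^s=t^{r+s}$) by $x_1^2+\dots+x_d^2-t^2$, with $t=|x|$, graded by $\deg x_\mu=1$, $\deg|x|^r=r$; $\partial_\mu$ acts by $\partial_\mu(P|x|^r)=(\partial_\mu P)|x|^r+rx_\mu P|x|^{r-2}$. $H[x_1,\dots,x_d,|x|^{\mathbb R}]_\lambda=H\otimes\mathbb R[x_1,\dots,x_d,|x|^{\mathbb R}]_\lambda$, $H[[x_1,\dots,x_d,|x|^{\mathbb R}]]=\prod_{\lambda}H[x_1,\dots,x_d,|x|^{\mathbb R}]_\lambda$, and $H((x_1,\dots,x_d,|x|^{\mathbb R}))$ consists of those $(f_\lambda)$ with $\{\lambda<M: f_\lambda\ne0\}$ finite for every $M\in\mathbb R$. Elements $P(x)|x|^r$ are also regarded as real analytic functions on $\mathbb R^d\setminus\{0\}$.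 **Associated vertex operator.** It is the unique linear map $Y(-,x):H\otimes H\to H((x_1,\dots,x_d,|x|^{\mathbb R}))$, $a\otimes b\mapsto Y(a,x)b$, such that for $u\in H_{\Delta_0}^*$, $a\in H_{\Delta_1}$, $b\in H_{\Delta_2}$ one has $\langle u,Y(a,x)b\rangle\in|x|^{\Delta_0-\Delta_1-\Delta_2}\mathbb C[\frac{x_1}{|x|},\dots,\frac{x_d}{|x|}]$ and $\langle u,Y(a,x)b\rangle=\langle u,\mathbb Y_{(x,0)}(a,b)\rangle$ as real analytic functions on $\mathbb R^d\setminus\{0\}$ (such a map exists). **Conformal $d$-vertex algebras.** A linear map $Y(-,x):H\otimes H\to H((x_1,\dots,x_d,|x|^{\mathbb R}))$ on a compact module $H$ is conformally covariant if $Y(P_\mu a,x)b=\frac{d}{dx_\mu}Y(a,x)b$ and $A\,Y(a,x)b=Y(a,x)Ab+Y(\tau_x(A)a,x)b$ for all $A\in\mathfrak{so}(d+1,1)$, $a,b\in H$ ($A$ acting on coefficients). A conformal $d$-vertex algebra is a compact module $H$ with a conformally covariant $Y(-,x)$ and $\mathbf 1\in H_0$ such that: (V1) $\mathbb C\mathbf 1$ is a trivial $\mathfrak{so}(d+1,1)$-module, $Y(\mathbf 1,x)=\mathrm{id}_H$, and for $a\in H$, $Y(a,x)\mathbf 1\in H[[x_1,\dots,x_d]]$ with $\lim_{x\to0}Y(a,x)\mathbf 1=a$; (V2) for all $u\in H^\vee$, $a_1,a_2,a_3\in H$, the sums $\sum_\Delta\langle u,Y(a_1,x^{(1)})\mathrm{pr}_\Delta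 Y(a_2,x^{(2)})a_3\rangle$ and $\sum_\Delta\langle u,Y(\mathrm{pr}_\Delta Y(a_1,x^{(0)})a_2,x^{(2)})a_3\rangle$ converge absolutely for $|x^{(1)}|>|x^{(2)}|>0$ and $|x^{(2)}|>|x^{(0)}|>0$ respectively, and there is a real analytic function $\phi:Y_2(\mathbb R^d)\to\mathbb C$, $Y_2(\mathbb R^d)=\{(x^{(1)},x^{(2)}): x^{(1)}\ne0,x^{(2)}\ne0,x^{(1)}\ne x^{(2)}\}$, such that $\sum_\Delta\langle u,Y(a_1,x^{(1)})\mathrm{pr}_\Delta Y(a_2,x^{(2)})a_3\rangle$ converges locally uniformly to $\phi(x^{(1)},x^{(2)})$ in $|x^{(1)}|>|x^{(2)}|>0$, $\sum_\Delta\langle u,Y(a_2,x^{(2)})\mathrm{pr}_\Delta Y(a_1,x^{(1)})a_3\rangle$ converges locally uniformly to $\phi(x^{(1)},x^{(2)})$ in $|x^{(2)}|>|x^{(1)}|>0$, and $\sum_\Delta\langle u,Y(\mathrm{pr}_\Delta Y(a_1,x^{(0)})a_2,x^{(2)})a_3\rangle$, with $x^{(0)}=x^{(1)}-x^{(2)}$, converges locally uniformly to $\phi(x^{(1)},x^{(2)})$ in $|x^{(2)}|>|x^{(1)}-x^{(2)}|>0$. *)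

(* Defs.v *)
From HB Require Import structures.
From mathcomp Require Import all_boot all_order all_algebra.
From mathcomp Require Import generic_quotient ring_quotient perm.
From mathcomp.real_closed Require Import complex.
From mathcomp Require Import all_classical all_reals all_analysis.
Set Implicit Arguments.
Unset Strict Implicit.
Unset Printing Implicit Defensive.
Import Order.TTheory GRing.Theory Num.Theory numFieldNormedType.Exports.
Import ComplexField.Normc.
Local Open Scope classical_set_scope.
Local Open Scope ring_scope.
Local Open Scope quotient_scope.
Local Open Scope complex_scope.

Definition mindex (d : nat) := {ffun 'I_d -> nat}.

Definition mdeg d (al : mindex d) : nat := (\sum_mu al mu)%N.

Definition mone d : mindex d := [ffun=> 0%N].

Definition mincr d (mu : 'I_d) (al : mindex d) : mindex d :=
  [ffun i => (al i + (i == mu))%N].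

Definition mdecr d (mu : 'I_d) (al : mindex d) : mindex d :=
  [ffun i => (al i - (i == mu))%N].

Section SphericalPolynomials.
Variables (R : realType) (d : nat) (H : lmodType R[i]).

(* (al, r) stands for the monomial x^al t^r of R[x_1, ..., x_d] (x) R[t^R]. *)
Definition smonom := (mindex d * R)%type.

Definition finsupp : {pred (smonom -> H)} :=
  [pred f | `[< finite_set [set k | f k != 0] >]].

Lemma finsuppP f : reflect (finite_set [set k | f k != 0]) (f \in finsupp).
Proof. exact: asboolP. Qed.

Lemma finsupp_submod : submod_closed finsupp.
Proof.
split=> [|c f g].
  by apply/finsuppP; apply: (sub_finite_set (B := set0)) => // k /=; rewrite eqxx.
move=> /finsuppP Hf /finsuppP Hg; apply/finsuppP.
apply: (sub_finite_set (B := [set k | f k != 0] `|` [set k | g k != 0])).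
  move=> k /= Hk; have [f0|] := eqVneq (f k) 0; last by left.
  right; apply: contraNneq Hk => g0.
  by rewrite fctE scalrfctE f0 g0 scaler0 addr0.
by rewrite finite_setU.
Qed.

HB.instance Definition _ :=
  GRing.isSubmodClosed.Build R[i] (smonom -> H) finsupp finsupp_submod.

(* H (x) R[x_1, ..., x_d] (x) R[t^R], as finitely supported families of
   coefficients in H. *)
Record fpoly := FPoly { fcoef :> smonom -> H; _ : fcoef \in finsupp }.

HB.instance Definition _ := [isSub for fcoef].
HB.instance Definition _ := [Choice of fpoly by <:].
HB.instance Definition _ := [SubChoice_isSubLmodule of fpoly by <:].

Lemma fmono_subproof (h : H) (k : smonom) :
  (fun j => if j == k then h else 0) \in finsupp.
Proof.
apply/finsuppP; apply: (sub_finite_set (B := [set k])) => // j /=.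
by case: (eqVneq j k) => [-> //|_]; rewrite eqxx.
Qed.

Definition fmono (al : mindex d) (r : R) (h : H) : fpoly :=
  FPoly (fmono_subproof h (al, r)).

Definition sphere_rel (al : mindex d) (r : R) (h : H) : fpoly :=
  \sum_mu fmono (mincr mu (mincr mu al)) r h - fmono al (r + 2) h.

(* H (x) (x_1^2 + ... + x_d^2 - t^2) *)
Definition sphere_ideal : {pred fpoly} :=
  [pred f : fpoly | `[< exists s : seq (smonom * H),
                f = \sum_(q <- s) sphere_rel q.1.1 q.1.2 q.2 >]].

Lemma sphere_idealP f :
  reflect (exists s : seq (smonom * H),
             f = \sum_(q <- s) sphere_rel q.1.1 q.1.2 q.2)
          (f \in sphere_ideal).
Proof. exact: asboolP. Qed.

Lemma fmonoZ al r c h : fmono al r (c *: h) = c *: fmono al r h.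
Proof.
apply/val_inj/funext => k /=; rewrite scalrfctE.
by case: ifP; rewrite ?scaler0.
Qed.

Lemma sphere_relZ al r c h : sphere_rel al r (c *: h) = c *: sphere_rel al r h.
Proof.
by rewrite /sphere_rel scalerBr scaler_sumr -fmonoZ; under eq_bigr do rewrite fmonoZ.
Qed.

Lemma sphere_ideal_submod : submod_closed sphere_ideal.
Proof.
split=> [|c f g].
  by apply/sphere_idealP; exists [::]; rewrite big_nil.
move=> /sphere_idealP[s ->] /sphere_idealP[t ->]; apply/sphere_idealP.
exists ([seq (q.1, c *: q.2) | q <- s] ++ t).
rewrite big_cat big_map scaler_sumr /=; congr (_ + _).
by apply: eq_bigr => q _; rewrite sphere_relZ.
Qed.

HB.instance Definition _ :=
  GRing.isSubmodClosed.Build R[i] fpoly sphere_ideal sphere_ideal_submod.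

Definition spoly := Quotient.quot sphere_ideal.

HB.instance Definition _ := GRing.Zmodule.on spoly.
HB.instance Definition _ := EqQuotient.on spoly.

Definition spoly_scale (c : R[i]) := lift_op1 spoly ( *:%R c).

Lemma pi_spoly_scale c : {morph \pi_spoly : x / c *: x >-> spoly_scale c x}.
Proof.
move=> x; unlock spoly_scale; apply/eqP.
rewrite -Quotient.idealrBE -scalerBr rpredZ //.
by rewrite Quotient.idealrBE reprK.
Qed.
Canonical pi_spoly_scale_morph c := PiMorph1 (pi_spoly_scale c).

Lemma spoly_scaleA a b (x : spoly) :
  spoly_scale a (spoly_scale b x) = spoly_scale (a * b) x.
Proof. by rewrite -[x]reprK !piE scalerA. Qed.

Lemma spoly_scale1 : left_id 1 spoly_scale.
Proof. by move=> x; rewrite -[x]reprK !piE scale1r. Qed.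

Lemma spoly_scaleDr : right_distributive spoly_scale +%R.
Proof.
by move=> c x y; rewrite -[x]reprK -[y]reprK !piE scalerDr.
Qed.

Lemma spoly_scaleDl (x : spoly) : {morph spoly_scale^~ x : a b / a + b}.
Proof. by move=> a b; rewrite -[x]reprK !piE scalerDl. Qed.

HB.instance Definition _ := GRing.Zmodule_isLmodule.Build R[i] spoly
  spoly_scaleA spoly_scale1 spoly_scaleDr spoly_scaleDl.

(* The class of h x^al |x|^r *)
Definition smono (al : mindex d) (r : R) (h : H) : spoly :=
  \pi_spoly (fmono al r h).

(* Extension by additivity of a map given on the elements h x^al |x|^r. It is
   only used for maps that are additive in h and compatible with
   x_1^2 + ... + x_d^2 = |x|^2, so the choice of representative is irrelevant:
   see slift_smono. *)
Definition slift (V : zmodType) (op : mindex d -> R -> H -> V) (p : spoly) : V :=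
  \sum_(k \in [set k | repr p k != 0]) op k.1 k.2 (repr p k).

End SphericalPolynomials.

Section SliftTheory.
Variables (R : realType) (d : nat) (H : lmodType R[i]) (V : zmodType).
Variable op : mindex d -> R -> H -> V.
Definition flift (f : fpoly d H) : V :=
  \sum_(k \in [set k | f k != 0]) op k.1 k.2 (f k).
Hypothesis opD : forall al r, {morph op al r : h h' / h + h'}.
Let op0 al r : op al r 0 = 0.
Proof. by apply: (addrI (op al r 0)); rewrite -opD !addr0. Qed.
Let opN al r h : op al r (- h) = - op al r h.
Proof. by apply: (addrI (op al r h)); rewrite -opD !subrr op0. Qed.
Lemma fpoly_fin (f : fpoly d H) : finite_set [set k | f k != 0].
Proof. by case: f => f /= /finsuppP. Qed.
Lemma fliftE (f : fpoly d H) (A : set (smonom R d)) : finite_set A ->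
  [set k | f k != 0] `<=` A -> flift f = \sum_(k \in A) op k.1 k.2 (f k).
Proof.
move=> Af sA; apply: fsbig_widen => // k /= [_ /negP]; rewrite negbK => /eqP ->.
by rewrite op0.
Qed.
Lemma fliftB f g : flift (f - g) = flift f - flift g.
Proof.
pose A := [set k | f k != 0] `|` [set k | g k != 0].
have Af : finite_set A by rewrite finite_setU; split; apply: fpoly_fin.
have E k : (f - g : fpoly d H) k = f k - g k by [].
have -> : flift f = \sum_(k \in A) op k.1 k.2 (f k).
  by apply: fliftE => //; exact: subsetUl.
have -> : flift g = \sum_(k \in A) op k.1 k.2 (g k).
  by apply: fliftE => //; exact: subsetUr.
rewrite (@fliftE _ A) //; last first.
  move=> k Hk0; have {Hk0}Hk : f k - g k != 0 by exact: Hk0.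
  have [f0|?] := eqVneq (f k) 0; last by left.
  by right; apply: contraNneq Hk => g0; rewrite f0 g0 subrr.
rewrite !fsbig_finite //= -sumrB; apply: eq_bigr => k _.
by rewrite -opN -opD -E.
Qed.
Lemma flift_mono al r h : flift (fmono al r h) = op al r h.
Proof.
rewrite (@fliftE _ [set (al, r)]) // ?fsbig_set1 /= ?eqxx //.
by move=> k /=; case: (eqVneq k (al, r)) => //; rewrite eqxx.
Qed.
Lemma flift0 : flift 0 = 0.
Proof. by have := fliftB 0 0; rewrite !subrr. Qed.
Lemma fliftD f g : flift (f + g) = flift f + flift g.
Proof.
have := fliftB f (- g); have := fliftB 0 g.
by rewrite sub0r flift0 opprK => -> ->; rewrite sub0r opprK.
Qed.
Hypothesis op_sphere : forall al r h,
  \sum_mu op (mincr mu (mincr mu al)) r h = op al (r + 2) h.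
Lemma slift_pi f : slift op (\pi f) = flift f.
Proof.
apply/eqP; rewrite -subr_eq0 -[slift _ _]/(flift _) -fliftB; apply/eqP.
have : repr (\pi_(spoly d H) f) - f \in sphere_ideal (H:=H).
  by rewrite Quotient.idealrBE reprK.
case/sphere_idealP => s ->.
rewrite (big_morph flift fliftD flift0) big1 // => q _.
rewrite /sphere_rel fliftB (big_morph flift fliftD flift0) flift_mono.
by under eq_bigr do rewrite flift_mono; rewrite op_sphere subrr.
Qed.
Lemma slift_smono al r h : slift op (smono al r h) = op al r h.
Proof. by rewrite slift_pi flift_mono. Qed.
End SliftTheory.

Section SmonoTheory.
Variables (R : realType) (d : nat).

Lemma mincrC mu nu (al : mindex d) : mincr mu (mincr nu al) = mincr nu (mincr mu al).
Proof. by apply/ffunP => i; rewrite !ffunE addnAC. Qed.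

Lemma fmonoD (H : lmodType R[i]) (al : mindex d) (r : R) (h h' : H) :
  fmono al r (h + h') = fmono al r h + fmono al r h'.
Proof.
apply/val_inj/funext => k; change ((if k == (al, r) then h + h' else 0) =
  (if k == (al, r) then h else 0) + (if k == (al, r) then h' else 0)).
by case: ifP; rewrite ?addr0.
Qed.

Lemma smonoD (H : lmodType R[i]) (al : mindex d) (r : R) :
  {morph @smono R d H al r : h h' / h + h'}.
Proof. by move=> h h'; rewrite /smono fmonoD !piE. Qed.

Lemma smono_sphere (H : lmodType R[i]) (al : mindex d) (r : R) (h : H) :
  \sum_mu smono (mincr mu (mincr mu al)) r h = smono al (r + 2) h.
Proof.
have pi0 : 0 = \pi_(spoly d H) 0 by rewrite piE.
have piD : {morph \pi_(spoly d H) : x y / x + y} by move=> x y; rewrite !piE.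
rewrite /smono -(big_morph _ piD (esym pi0)); apply/eqP.
rewrite -Quotient.idealrBE; apply/sphere_idealP; exists [:: ((al, r), h)].
by rewrite big_seq1.
Qed.

Lemma smono0 (H : lmodType R[i]) (al : mindex d) (r : R) : smono al r (0 : H) = 0.
Proof. by apply: (addrI (smono al r 0)); rewrite -smonoD !addr0. Qed.

Lemma smonoN (H : lmodType R[i]) (al : mindex d) (r : R) (h : H) :
  smono al r (- h) = - smono al r h.
Proof. by apply: (addrI (smono al r h)); rewrite -smonoD !subrr smono0. Qed.
End SmonoTheory.

Section SphericalSeries.
Variables (R : realType) (d : nat).

Definition enorm (x : 'rV[R]_d) : R := Num.sqrt (\sum_mu x 0 mu ^+ 2).

Definition spoly_mulX (H : lmodType R[i]) (mu : 'I_d) : spoly d H -> spoly d H :=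
  slift (fun al r h => smono (mincr mu al) r h).

Definition spoly_deriv (H : lmodType R[i]) (mu : 'I_d) : spoly d H -> spoly d H :=
  slift (fun al r h => smono (mdecr mu al) r ((al mu)%:R *: h)
                       + smono (mincr mu al) (r - 2) (r%:C *: h)).

Definition spoly_map (H H' : lmodType R[i]) (f : H -> H') :
    spoly d H -> spoly d H' :=
  slift (fun al r h => smono al r (f h)).

Definition spoly_eval (H : lmodType R[i]) (p : spoly d H) (x : 'rV[R]_d) : H :=
  slift (fun al r h => ((\prod_mu x 0 mu ^+ al mu) * enorm x `^ r)%:C *: h) p.

Lemma spoly_mulX_smono (H : lmodType R[i]) mu (al : mindex d) (r : R) (h : H) :
  spoly_mulX mu (smono al r h) = smono (mincr mu al) r h.
Proof.
apply: slift_smono => [al' r'|al' r' h']; first exact: smonoD.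
by rewrite -smono_sphere; apply: eq_bigr => nu _; rewrite !(mincrC mu).
Qed.

Lemma spoly_map_smono (H H' : lmodType R[i]) (f : {additive H -> H'})
    (al : mindex d) (r : R) (h : H) :
  spoly_map f (smono al r h) = smono al r (f h).
Proof.
apply: (slift_smono (op := fun al r h => smono al r (f h))) => [al' r' x y|al' r' h'].
  by rewrite raddfD smonoD.
by rewrite smono_sphere.
Qed.

Lemma spoly_deriv_smono (H : lmodType R[i]) mu (al : mindex d) (r : R) (h : H) :
  spoly_deriv mu (smono al r h) =
  smono (mdecr mu al) r ((al mu)%:R *: h) + smono (mincr mu al) (r - 2) (r%:C *: h).
Proof.
apply: (slift_smono (op := fun al r h => smono (mdecr mu al) r ((al mu)%:R *: h)
   + smono (mincr mu al) (r - 2) (r%:C *: h))) => {al r h} [al r x y|al r h].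
  by rewrite !scalerDr !smonoD addrACA.
rewrite big_split /= addrK.
under [X in _ + X = _]eq_bigr => nu _ do rewrite !(mincrC mu).
rewrite smono_sphere subrK.
rewrite (bigD1 mu) //=.
have -> : mdecr mu (mincr mu (mincr mu al)) = mincr mu al.
  by apply/ffunP => i; rewrite !ffunE addnK.
have -> : mincr mu (mincr mu al) mu = (al mu + 2)%N.
  by rewrite !ffunE eqxx -addnA.
have E (nu : 'I_d) : nu != mu -> smono (mdecr mu (mincr nu (mincr nu al))) r
     ((mincr nu (mincr nu al) mu)%:R *: h) =
   smono (mincr nu (mincr nu (mdecr mu al))) r ((al mu)%:R *: h).
  move=> nm.
  have -> : mincr nu (mincr nu al) mu = al mu.
    by rewrite !ffunE eq_sym (negPf nm) !addn0.
  have [a0|a0] := eqVneq (al mu) 0%N.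
    by rewrite a0 scale0r !smono0.
  congr smono; apply/ffunP => i; rewrite !ffunE.
  have [->|] := eqVneq i mu; first by rewrite eq_sym (negPf nm) !addn0.
  by rewrite !subn0.
rewrite (eq_bigr _ E).
have -> : \sum_(nu < d | nu != mu)
    smono (mincr nu (mincr nu (mdecr mu al))) r ((al mu)%:R *: h) =
  smono (mdecr mu al) (r + 2) ((al mu)%:R *: h)
  - smono (mincr mu al) r ((al mu)%:R *: h).
  rewrite -smono_sphere (bigD1 mu (P := xpredT)) //= addrAC.
  have [a0|a0] := eqVneq (al mu) 0%N.
    by rewrite a0 scale0r !smono0 subrr add0r.
  suff -> : mincr mu (mincr mu (mdecr mu al)) = mincr mu al by rewrite subrr add0r.
  apply/ffunP => i; rewrite !ffunE.
  have [->|] := eqVneq i mu; last by rewrite subn0 !addn0.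
  by rewrite subnK // lt0n.
rewrite addrA addrAC -!smonoN -!smonoD addrC -addrA -!smonoD.
congr (_ + smono _ _ _).
rewrite -scaleNr -!scalerDl; congr (_ *: _).
by rewrite natrD rmorphD rmorph_nat [(al mu)%:R + 2]addrC addrK addrC.
Qed.

Lemma enorm_sqr (x : 'rV[R]_d) : enorm x ^+ 2 = \sum_mu x 0 mu ^+ 2.
Proof. by rewrite sqr_sqrtr // sumr_ge0 // => mu _; rewrite sqr_ge0. Qed.

Lemma enorm_gt0 (x : 'rV[R]_d) : x != 0 -> 0 < enorm x.
Proof.
move=> x0; rewrite sqrtr_gt0 lt_def sumr_ge0 ?andbT => [|mu _]; last exact: sqr_ge0.
apply: contra x0; rewrite psumr_eq0 => [|mu _]; last exact: sqr_ge0.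
move=> /allP x0; apply/eqP/rowP => mu; rewrite mxE.
by apply/eqP; rewrite -sqrf_eq0; apply: x0; rewrite mem_index_enum.
Qed.

Lemma spoly_eval_smono (H : lmodType R[i]) (al : mindex d) (r : R) (h : H)
    (x : 'rV[R]_d) : x != 0 ->
  spoly_eval (smono al r h) x =
  ((\prod_mu x 0 mu ^+ al mu) * enorm x `^ r)%:C *: h.
Proof.
move=> x0; apply: (slift_smono (op := fun al r h =>
  ((\prod_mu x 0 mu ^+ al mu) * enorm x `^ r)%:C *: h)) => {al r h} [al r h h'|al r h].
  exact: scalerDr.
rewrite -scaler_suml -rmorph_sum; congr (_%:C *: _).
have e0 : enorm x != 0 by rewrite gt_eqF // enorm_gt0.
rewrite powRD ?e0 ?implybT // powR_mulrn ?sqrtr_ge0 // enorm_sqr.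
rewrite [_ `^ r * _]mulrC mulrA mulr_sumr mulr_suml; apply: eq_bigr => mu _.
congr (_ * _); rewrite (bigD1 mu) //= [in RHS](bigD1 mu) //= !ffunE eqxx.
rewrite mulrAC -exprD -addnA; congr (_ * _); apply: eq_bigr => nu /negPf nm.
by rewrite !ffunE nm !addn0.
Qed.

Definition homogeneous (H : lmodType R[i]) (la : R) (p : spoly d H) : Prop :=
  exists2 f : fpoly d H, p = \pi f
    & forall k, f k != 0 -> (mdeg k.1)%:R + k.2 = la.

(* An element (f_la) of H[[x_1, ..., x_d, |x|^R]] is the function la |-> f_la. *)
Definition sseries (H : lmodType R[i]) := R -> spoly d H.

Definition is_sseries (H : lmodType R[i]) (F : sseries H) : Prop :=
  forall la, homogeneous la (F la).

(* H((x_1, ..., x_d, |x|^R)) *)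
Definition is_laurent (H : lmodType R[i]) (F : sseries H) : Prop :=
  is_sseries F /\ forall M : R, finite_set [set la | la < M /\ F la != 0].

Definition sseries_mulX (H : lmodType R[i]) mu (F : sseries H) : sseries H :=
  fun la => spoly_mulX mu (F (la - 1)).

Definition sseries_deriv (H : lmodType R[i]) mu (F : sseries H) : sseries H :=
  fun la => spoly_deriv mu (F (la + 1)).

Definition sseries_map (H H' : lmodType R[i]) (f : H -> H') (F : sseries H) :
  sseries H' := fun la => spoly_map f (F la).

Definition sseries_const (H : lmodType R[i]) (h : H) : sseries H :=
  fun la => if la == 0 then smono (mone d) 0 h else 0.

(* The image in H[[x_1, ..., x_d, |x|^R]] of the power series
   sum_al x^al (p al) of H[[x_1, ..., x_d]] *)
Definition sseries_of_power (H : lmodType R[i]) (p : mindex d -> H) : sseries H :=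
  fun la => \sum_(al \in [set al | (mdeg al)%:R = la]) smono al 0 (p al).

(* Value at x <> 0 of a series with finitely many nonzero components. This
   finiteness holds wherever it is used below: by covariance under D, both
   <u, Y(a, x) b> for u in the restricted dual and pr_Delta Y(a, x) b have only
   finitely many nonzero components. *)
Definition sseries_eval (H : lmodType R[i]) (F : sseries H) (x : 'rV[R]_d) : H :=
  \sum_(la \in [set: R]) spoly_eval (F la) x.

(* F belongs to |x|^la C[x_1/|x|, ..., x_d/|x|] *)
Definition in_scaled_sphere (la : R) (F : sseries R[i]^o) : Prop :=
  exists s : seq (mindex d * R[i]^o),
    F = fun la' => if la' == la
      then \sum_(q <- s) smono q.1 (la - (mdeg q.1)%:R) q.2 else 0.

End SphericalSeries.

Section LieAlgebra.
Variables (R : realType) (d : nat).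

(* Index set of the basis D, P_mu, K_mu, J_mu,nu (mu < nu), in this order *)
Definition so_idx :=
  (unit + 'I_d + 'I_d + {p : 'I_d * 'I_d | (p.1 < p.2)%N})%type.

Definition so := {ffun so_idx -> R^o}.

Definition so_basis (g : so_idx) : so := [ffun h => (h == g)%:R].

Definition soD : so := so_basis (inl (inl (inl tt))).
Definition soP (mu : 'I_d) : so := so_basis (inl (inl (inr mu))).
Definition soK (mu : 'I_d) : so := so_basis (inl (inr mu)).
Definition soJ (mu nu : 'I_d) : so :=
  if insub (mu, nu) is Some p then so_basis (inr p)
  else if insub (nu, mu) is Some p then - so_basis (inr p) else 0.

Definition kd (mu nu : 'I_d) : R := (mu == nu)%:R.

Definition so_br_basis (g h : so_idx) : so :=
  match g, h with
  | inl (inl (inl _)), inl (inl (inl _)) => 0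
  | inl (inl (inl _)), inl (inl (inr mu)) => soP mu
  | inl (inl (inr mu)), inl (inl (inl _)) => - soP mu
  | inl (inl (inl _)), inl (inr mu) => - soK mu
  | inl (inr mu), inl (inl (inl _)) => soK mu
  | inl (inl (inl _)), inr _ => 0
  | inr _, inl (inl (inl _)) => 0
  | inl (inl (inr _)), inl (inl (inr _)) => 0
  | inl (inr _), inl (inr _) => 0
  | inl (inl (inr mu)), inl (inr nu) => - (2 *: (kd mu nu *: soD + soJ mu nu))
  | inl (inr nu), inl (inl (inr mu)) => 2 *: (kd mu nu *: soD + soJ mu nu)
  | inr p, inl (inl (inr rho)) => let: (mu, nu) := val p in
      - (kd mu rho *: soP nu) + kd nu rho *: soP mu
  | inl (inl (inr rho)), inr p => let: (mu, nu) := val p in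
      kd mu rho *: soP nu - kd nu rho *: soP mu
  | inr p, inl (inr rho) => let: (mu, nu) := val p in
      - (kd mu rho *: soK nu) + kd nu rho *: soK mu
  | inl (inr rho), inr p => let: (mu, nu) := val p in
      kd mu rho *: soK nu - kd nu rho *: soK mu
  | inr p, inr q => let: (mu, nu) := val p in let: (rho, sigma) := val q in
      kd nu rho *: soJ mu sigma - kd mu rho *: soJ nu sigma
      - kd nu sigma *: soJ mu rho + kd mu sigma *: soJ nu rho
  end.

Definition so_br (X Z : so) : so :=
  \sum_g \sum_h (X g * Z h) *: so_br_basis g h.

(* - sum_rho x_rho ad P_rho *)
Definition minus_adP (x : 'rV[R]_d) (X : so) : so :=
  - \sum_rho x 0 rho *: so_br (soP rho) X.

(* The exponential series stops at the quadratic term: see minus_adP_nilp. *)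
Definition tau (x : 'rV[R]_d) (X : so) : so :=
  \sum_(k < 3) k`!%:R^-1 *: iter k (minus_adP x) X.

(* For G real-linear, G (tau_x X) as a formal series in x: the term
   of degree k in tau_x X is expanded and each x_rho multiplies the series. *)
Definition sseries_tau (H : lmodType R[i]) (G : so -> sseries d H) (X : so) :
    sseries d H :=
  \sum_(k < 3) k`!%:R^-1 *:
    iter k (fun (G' : so -> sseries d H) Z =>
              - \sum_rho sseries_mulX rho (G' (so_br (soP rho) Z))) G X.

End LieAlgebra.

Section LieTheory.
Variables (R : realType) (d : nat).

Lemma so_br_basisE (g : so_idx d) (X : so R d) :
  so_br (so_basis R g) X = \sum_h X h *: so_br_basis R g h.
Proof.
rewrite /so_br (bigD1 g) //= [X in _ + X]big1 ?addr0 => [|i /negPf ig].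
  by apply: eq_bigr => h _; rewrite ffunE eqxx mul1r.
by apply: big1 => h _; rewrite ffunE ig mul0r scale0r.
Qed.

Lemma soP_coef (mu : 'I_d) g : (forall nu, g <> inl (inl (inr nu))) -> soP R mu g = 0.
Proof. by move=> Hg; rewrite ffunE; case: eqP => // /Hg. Qed.

Lemma soJ_coef (mu nu : 'I_d) g : (forall p, g <> inr p) -> soJ R mu nu g = 0.
Proof.
move=> Hg; rewrite /soJ; case: insubP => [p _ _|_].
  by rewrite ffunE; case: eqP => // /Hg.
case: insubP => [p _ _|_]; last by rewrite ffunE.
by rewrite !ffunE; case: eqP => [/Hg //|_]; rewrite oppr0.
Qed.

Lemma soD_coef g : g <> inl (inl (inl tt)) -> soD R d g = 0.
Proof. by move=> Hg; rewrite ffunE; case: eqP. Qed.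

Lemma minus_adP_coef (x : 'rV[R]_d) (X : so R d) (g : so_idx d) :
  minus_adP x X g =
  - \sum_rho x 0 rho * \sum_h X h * so_br_basis R (inl (inl (inr rho))) h g.
Proof.
rewrite /minus_adP ffunE sum_ffunE; congr (- _); apply: eq_bigr => rho _.
rewrite ffunE so_br_basisE sum_ffunE; congr (_ * _); apply: eq_bigr => h _.
by rewrite ffunE.
Qed.

Lemma minus_adP_nilp (x : 'rV[R]_d) (X : so R d) : iter 3 (minus_adP x) X = 0.
Proof.
have coef0 (Z : so R d) (g : so_idx d) :
    (forall rho h, Z h * so_br_basis R (inl (inl (inr rho))) h g = 0) ->
    minus_adP x Z g = 0.
  move=> Zg; rewrite minus_adP_coef big1 ?oppr0 // => rho _.
  by rewrite big1 ?mulr0.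
have oppE (Z : so R d) g : (- Z) g = - Z g by rewrite ffunE.
have addE (Z Z' : so R d) g : (Z + Z') g = Z g + Z' g by rewrite ffunE.
have scaleE c (Z : so R d) g : (c *: Z) g = c * Z g by rewrite ffunE.
have zeroE g : (0 : so R d) g = 0 by rewrite ffunE.
pose E := (oppE, addE, scaleE, zeroE).
set X1 := minus_adP x X.
have X1K nu : X1 (inl (inr nu)) = 0.
  apply: coef0 => rho [[[[]|h]|h]|[[h h'] hh]] /=;
    by rewrite !E ?soP_coef ?soD_coef ?soJ_coef // ?(mulr0, addr0, oppr0).
set X2 := minus_adP x X1.
have X2P g : (forall nu, g <> inl (inl (inr nu))) -> X2 g = 0.
  move=> Hg; apply: coef0 => rho [[[[]|h]|h]|[[h h'] hh]] /=;
    by rewrite ?X1K ?mul0r // !E ?soP_coef // ?(mulr0, addr0, oppr0).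
apply/ffunP => g; rewrite [RHS]ffunE /= -/X1 -/X2.
apply: coef0 => rho [[[[]|h]|h]|p]; by rewrite /= ?zeroE ?mulr0 ?X2P ?mul0r //.
Qed.

End LieTheory.

Section CompactModules.
Variables (R : realType) (d : nat) (H : lmodType R[i]).
Variable act : so R d -> H -> H.

Record so_module : Prop := {
  so_module_linl : forall (r : R) X Z a,
    act (r *: X + Z) a = r%:C *: act X a + act Z a;
  so_module_linr : forall X (c : R[i]) a b,
    act X (c *: a + b) = c *: act X a + act X b;
  so_module_br : forall X Z a,
    act (so_br X Z) a = act X (act Z a) - act Z (act X a) }.

(* H_Delta *)
Definition wt (De : R) : set H := [set a | act (soD R d) a = De%:C *: a].

Definition is_decomp (a : H) (c : R -> H) : Prop :=
  [/\ forall De, wt De (c De), finite_set [set De | c De != 0]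
    & a = \sum_(De \in [set: R]) c De].

(* The components of a in the direct sum of the H_Delta; also the embedding of
   the direct sum into the product *)
Definition decomp (a : H) : R -> H := xget (fun=> 0) (is_decomp a).

Definition pr (De : R) (a : H) : H := decomp a De.

Definition vdim (V : set H) : \bar R :=
  ereal_sup [set n%:R%:E | n in [set n : nat | exists v : 'I_n -> H,
    (forall i, V (v i)) /\
    (forall c : 'I_n -> R[i], \sum_i c i *: v i = 0 -> forall i, c i = 0)]].

Definition mexp (X : 'M[R]_d) : 'M[R]_d :=
  \matrix_(i, j) limn (fun N => (\sum_(k < N) k`!%:R^-1 *: X ^+ k) i j).

Definition SO : set 'M[R]_d := [set A | A *m A^T = 1%:M /\ \det A = 1].

(* Skew-symmetric matrices as combinations of the J_mu,nu; J_mu,nu corresponds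
   to the matrix E_mu,nu - E_nu,mu, by its action on the P_rho. *)
Definition so_skew (X : 'M[R]_d) : so R d :=
  \sum_(mu < d) \sum_(nu < d | (mu < nu)%N) X mu nu *: soJ R mu nu.

(* There is a homomorphism rho : SO(d) -> GL(V) with rho(exp X) = exp(X|_V)
   for all X in so(d), the limit being taken weakly in V, which is
   finite-dimensional when this is used. Such a rho is automatically smooth
   with differential the given action. *)
Definition exponentiates (V : set H) : Prop :=
  exists rho : 'M[R]_d -> H -> H,
    [/\ forall A a, SO A -> V a -> V (rho A a),
        forall A (c : R[i]) a b, SO A -> V a -> V b ->
          rho A (c *: a + b) = c *: rho A a + rho A b,
        forall a, V a -> rho 1%:M a = a,
        forall A B a, SO A -> SO B -> V a -> rho (A *m B) a = rho A (rho B a)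
      & forall X a (u : {linear H -> R[i]^o}), X^T = - X -> V a ->
          (fun N : nat => \sum_(k < N) k`!%:R^-1 * u (iter k (act (so_skew X)) a)
             : R[i]^o) @ \oo --> (u (rho (mexp X) a) : R[i]^o)].

Record compact_module : Prop := {
  compact_so_module :> so_module;
  compact_C1 : forall a, exists! c, is_decomp a c;
  compact_C2 : forall M : R,
    (\esum_(De in [set De : R | (De <= M)%R]) vdim (wt De) < +oo)%E;
  compact_C3 : forall De, exponentiates (wt De) }.

(* The completion of H is the set of families f : R -> H with f(Delta) in
   H_Delta. *)
Definition in_Hbar (f : R -> H) : Prop := forall De, wt De (f De).

(* The componentwise action on the completion; X f(De') has components in
   finitely many H_Delta only, and conversely. *)
Definition act_Hbar (X : so R d) (f : R -> H) : R -> H :=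
  fun De => \sum_(De' \in [set: R]) pr De (act X (f De')).

(* The restricted dual is the set of functionals on H that vanish on all but
   finitely many H_Delta. *)
Definition in_Hvee (u : H -> R[i]) : Prop :=
  finite_set [set De | exists2 a, wt De a & u a != 0].

(* u in H_Delta^*, extended by 0 to the other summands *)
Definition in_dual_wt (De : R) (u : H -> R[i]) : Prop :=
  forall De' a, De' != De -> wt De' a -> u a = 0.

Definition pairing (u : H -> R[i]) (f : R -> H) : R[i] :=
  \sum_(De \in [set: R]) u (f De).

End CompactModules.

Section Analysis.
Variables (R : realType).

(* Points (x^(1), ..., x^(n)) of (R^d)^n are n x d matrices, row by row. *)
Definition Conf (n d : nat) : set 'M[R]_(n, d) :=
  [set x | forall i j, i != j -> row i x != row j x].

Definition real_analytic_on (n d : nat) (Om : set 'M[R]_(n, d))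
    (f : 'M[R]_(n, d) -> R[i]) : Prop :=
  forall p, Om p ->
  exists (c : {ffun 'I_n * 'I_d -> nat} -> R[i]) (e : R), 0 < e /\
  forall x : 'M[R]_(n, d), (forall i j, `|x i j - p i j| < e) ->
    let term al := c al * (\prod_k (x k.1 k.2 - p k.1 k.2) ^+ al k)%:C in
    (\esum_(al in setT) (normc (term al))%:E < +oo)%E /\
    (fun N : nat => \sum_(al : {ffun 'I_n * 'I_d -> 'I_N})
       term [ffun k => al k : nat] : R[i]^o) @ \oo --> (f x : R[i]^o).

Definition has_cderiv (f : R -> R[i]) (t : R) (v : R[i]) : Prop :=
  is_derive t (1 : R) (fun s => complex.Re (f s)) (complex.Re v) /\
  is_derive t (1 : R) (fun s => complex.Im (f s)) (complex.Im v).

Definition abs_summable (f : R -> R[i]) : Prop :=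
  (\esum_(De in [set: R]) (normc (f De))%:E < +oo)%E.

(* Used for families f with finitely many nonzero terms below M. *)
Definition partial_sum (f : R -> R[i]) (M : R) : R[i] :=
  \sum_(De \in [set De | De < M]) f De.

Definition sum_unif_on (T : Type) (K : set T) (f : R -> T -> R[i])
    (g : T -> R[i]) : Prop :=
  forall e : R, 0 < e -> \forall M \near +oo, forall z, K z ->
    normc (partial_sum (f^~ z) M - g z) < e.

Definition sum_locally_unif_on (T : topologicalType) (Om : set T)
    (f : R -> T -> R[i]) (g : T -> R[i]) : Prop :=
  forall z, Om z -> exists2 N, nbhs z N & sum_unif_on (Om `&` N) f g.

End Analysis.

Definition fcat (T : Type) (n m : nat) (a : 'I_n -> T) (b : 'I_m -> T)
    (i : 'I_(n + m)) : T :=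
  match fintype.split i with inl k => a k | inr l => b l end.

Section CCSystems.
Variables (R : realType) (d : nat) (H : lmodType R[i]).
Variable act : so R d -> H -> H.

(* U_{n,m}, as pairs of (x^(1), ..., x^(n), w) and (y^(1), ..., y^(m)) *)
Definition CC_dom (n m : nat) : set ('M[R]_(n + 1, d) * 'M[R]_(m, d)) :=
  [set z | [/\ Conf z.1, Conf z.2
    & forall k l, enorm (row l z.2) < enorm (row k (usubmx z.1) - dsubmx z.1)]].

(* (x^(1), ..., x^(n), w + y^(1), ..., w + y^(m)) *)
Definition CC_merge (n m : nat) (z : 'M[R]_(n + 1, d) * 'M[R]_(m, d)) :
    'M[R]_(n + m, d) :=
  col_mx (usubmx z.1) (\matrix_(l < m) (dsubmx z.1 + row l z.2)).

Variable YY : forall n, 'M[R]_(n, d) -> ('I_n -> H) -> (R -> H).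
Variable vac : H.

Definition CC_cluster_term (n m : nat) (u : H -> R[i]) (a : 'I_n -> H)
    (b : 'I_m -> H) (De : R) (z : 'M[R]_(n + 1, d) * 'M[R]_(m, d)) : R[i] :=
  pairing u (YY z.1 (fcat a (fun _ : 'I_1 => YY z.2 b De))).

(* Linear maps on the n-th tensor power of H are multilinear maps on H^n. The
   value of YY for n = 0 is unconstrained. *)
Record CC_system : Prop := {
  CC_compact : compact_module act;
  CC_Hbar : forall n (x : 'M[R]_(n, d)) a, (0 < n)%N -> Conf x ->
    in_Hbar act (YY x a);
  CC_multilinear : forall n (x : 'M[R]_(n, d)) a p (c : R[i]) b b', Conf x ->
    YY x [eta a with p |-> c *: b + b'] =
    c *: YY x [eta a with p |-> b] + YY x [eta a with p |-> b'];
  CC_vac_wt : wt act 0 vac;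
  CC_unit : forall a, YY (0 : 'M[R]_(1, d)) (fun=> a) = decomp act a;
  CC_analytic : forall n (u : {linear H -> R[i]^o}) (a : 'I_n -> H),
    (0 < n)%N -> in_Hvee act u ->
    real_analytic_on (@Conf R n d) (fun x => pairing u (YY x a));
  CC_perm : forall n (x : 'M[R]_(n, d)) a (s : 'S_n), (0 < n)%N -> Conf x ->
    YY x a = YY (row_perm s x) (a \o s);
  CC_vacuum : forall n (x : 'M[R]_(n + 1, d)) a, (0 < n)%N -> Conf x ->
    YY x (fcat a (fun=> vac)) = YY (usubmx x) a;
  CC_vac_inv : forall X, act X vac = 0;
  CC_translation : forall n (x : 'M[R]_(n, d)) a p mu (u : {linear H -> R[i]^o}),
    Conf x -> in_Hvee act u ->
    has_cderiv (fun t => pairing u (YY (x + t *: delta_mx p mu) a)) 0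
      (pairing u (YY x [eta a with p |-> act (soP R mu) (a p)]));
  CC_covariant : forall n (x : 'M[R]_(n, d)) a X, (0 < n)%N -> Conf x ->
    act_Hbar act X (YY x a) =
    \sum_q YY x [eta a with q |-> act (tau (row q x) X) (a q)];
  CC_cluster_summable : forall n m (u : {linear H -> R[i]^o})
      (a : 'I_n -> H) (b : 'I_m -> H) z,
    (0 < m)%N -> in_Hvee act u -> CC_dom z ->
    abs_summable (fun De => CC_cluster_term u a b De z);
  CC_cluster : forall n m (u : {linear H -> R[i]^o})
      (a : 'I_n -> H) (b : 'I_m -> H) K,
    (0 < m)%N -> in_Hvee act u -> compact K -> K `<=` @CC_dom n m ->
    sum_unif_on K (CC_cluster_term u a b)
      (fun z => pairing u (YY (CC_merge z) (fcat a b))) }.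

End CCSystems.

Section VertexAlgebras.
Variables (R : realType) (d : nat) (H : lmodType R[i]).
Variable act : so R d -> H -> H.

(* A linear map from H (x) H to H((x_1, ..., x_d, |x|^R)) *)
Record vertex_map (Y : H -> H -> sseries d H) : Prop := {
  vertex_laurent : forall a b, is_laurent (Y a b);
  vertex_linl : forall (c : R[i]) a a' b, Y (c *: a + a') b = c *: Y a b + Y a' b;
  vertex_linr : forall (c : R[i]) a b b', Y a (c *: b + b') = c *: Y a b + Y a b' }.

(* Y is the vertex operator associated with YY. *)
Record associated_vertex_operator
    (YY : forall n, 'M[R]_(n, d) -> ('I_n -> H) -> (R -> H))
    (Y : H -> H -> sseries d H) : Prop := {
  assoc_vertex_map : vertex_map Y;
  assoc_scaled : forall De0 De1 De2 (u : {linear H -> R[i]^o}) a b,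
    in_dual_wt act De0 u -> wt act De1 a -> wt act De2 b ->
    in_scaled_sphere (De0 - De1 - De2) (sseries_map (u : H -> R[i]^o) (Y a b));
  assoc_eval : forall De0 De1 De2 (u : {linear H -> R[i]^o}) a b x,
    in_dual_wt act De0 u -> wt act De1 a -> wt act De2 b -> x != 0 ->
    sseries_eval (sseries_map (u : H -> R[i]^o) (Y a b)) x =
    pairing u (YY (1 + 1)%N (col_mx x 0)
              (fcat (fun _ : 'I_1 => a) (fun _ : 'I_1 => b))) }.

Record conformally_covariant (Y : H -> H -> sseries d H) : Prop := {
  covariant_P : forall mu a b, Y (act (soP R mu) a) b = sseries_deriv mu (Y a b);
  covariant_so : forall A a b, sseries_map (act A) (Y a b) =
    Y a (act A b) + sseries_tau (fun X => Y (act X a) b) A }.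

Section Products.
Variable Y : H -> H -> sseries d H.

(* <u, Y(a1, x1) pr_Delta Y(a2, x2) a3> *)
Definition product_term (u : H -> R[i]^o) (a1 a2 a3 : H) (De : R)
    (x1 x2 : 'rV[R]_d) : R[i] :=
  sseries_eval (sseries_map u
    (Y a1 (sseries_eval (sseries_map (pr act De) (Y a2 a3)) x2))) x1.

(* <u, Y(pr_Delta Y(a1, x0) a2, x2) a3> *)
Definition iterate_term (u : H -> R[i]^o) (a1 a2 a3 : H) (De : R)
    (x0 x2 : 'rV[R]_d) : R[i] :=
  sseries_eval (sseries_map u
    (Y (sseries_eval (sseries_map (pr act De) (Y a1 a2)) x0) a3)) x2.

(* Pairs (x^(1), x^(2)) are 2 x d matrices. *)
Definition fst_pt (x : 'M[R]_(2, d)) : 'rV[R]_d := row 0 x.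
Definition snd_pt (x : 'M[R]_(2, d)) : 'rV[R]_d := row 1 x.

Definition Y2 : set 'M[R]_(2, d) :=
  [set x | [/\ fst_pt x != 0, snd_pt x != 0 & fst_pt x != snd_pt x]].

Definition vertex_convergence : Prop :=
  forall (u : {linear H -> R[i]^o}) (a1 a2 a3 : H), in_Hvee act u ->
  [/\ forall x1 x2, 0 < enorm x2 < enorm x1 ->
        abs_summable (fun De => product_term u a1 a2 a3 De x1 x2),
      forall x0 x2, 0 < enorm x0 < enorm x2 ->
        abs_summable (fun De => iterate_term u a1 a2 a3 De x0 x2)
    & exists phi : 'M[R]_(2, d) -> R[i],
      [/\ real_analytic_on Y2 phi,
          sum_locally_unif_on
            [set x | 0 < enorm (snd_pt x) < enorm (fst_pt x)]
            (fun De x => product_term u a1 a2 a3 De (fst_pt x) (snd_pt x)) phi,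
          sum_locally_unif_on
            [set x | 0 < enorm (fst_pt x) < enorm (snd_pt x)]
            (fun De x => product_term u a2 a1 a3 De (snd_pt x) (fst_pt x)) phi
        & sum_locally_unif_on
            [set x | 0 < enorm (fst_pt x - snd_pt x) < enorm (snd_pt x)]
            (fun De x => iterate_term u a1 a2 a3 De (fst_pt x - snd_pt x)
                           (snd_pt x)) phi]].

End Products.

Record conformal_vertex_algebra (Y : H -> H -> sseries d H) (vac : H) : Prop := {
  cva_compact : compact_module act;
  cva_vertex_map : vertex_map Y;
  cva_covariant : conformally_covariant Y;
  cva_vac_wt : wt act 0 vac;
  cva_vac_trivial : forall X, act X vac = 0;
  cva_vac_left : forall b, Y vac b = sseries_const d b;
  cva_vac_right : forall a, exists2 p : mindex d -> H,
    Y a vac = sseries_of_power p & p (mone d) = a;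
  cva_convergence : vertex_convergence Y }.

End VertexAlgebras.

(* Main.v *)
Require Import Defs.
From HB Require Import structures.
From mathcomp Require Import all_boot all_order all_algebra.
From mathcomp Require Import generic_quotient perm finmap ring lra.
From mathcomp.real_closed Require Import complex.
From mathcomp Require Import all_classical all_reals all_analysis.
Set Implicit Arguments.
Unset Strict Implicit.
Unset Printing Implicit Defensive.
Import Order.TTheory GRing.Theory Num.Theory numFieldNormedType.Exports.
Import ComplexField.Normc.
Local Open Scope classical_set_scope.
Local Open Scope ring_scope.
Local Open Scope quotient_scope.
Local Open Scope complex_scope.

(** A matrix element of [Y a b] is a matrix element of the two-point operator with
    the second point at the origin, so that the axioms of a conformal vertex
    algebra are statements about correlation functions. Two things have to be
    supplied: the passage between formal series and functions, and the
    behaviour of correlation functions with a vacuum or with three points.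

    Formal series. A spherical polynomial that vanishes at all nonzero points is
    zero ([spoly_eval_inj]): in normal form, with one coordinate occurring at
    most once, its monomials become distinct characters of a semigroup once that
    coordinate is traded for the norm. Weight spaces are finite-dimensional, so
    functionals of pure weight separate vectors ([separates]), and a functional
    of pure weight sees finitely many degrees of [Y a b], which scaling
    separates. Hence an identity of series may be verified on matrix elements
    ([sseries_ext], [sseries_value_ext]), where the matrix elements of [Y a b]
    are given by [Y_value].

    Covariance. On matrix elements, the derivative rule for [Y] is the
    translation axiom, the formal derivative being the derivative of the value,
    and covariance under the Lie algebra is the covariance axiom for two points:
    multiplying a series by coordinates multiplies its value, so the formal
    [tau] has the expected value ([has_value_tau]), and the action on the
    completion is moved to the functional, which stays in the restricted dual
    because the Lie algebra shifts weights by at most one ([pairing_act]).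

    Vacuum. A vacuum at the first point is listed last by permutation
    invariance and dropped, which gives the left unit. For the right
    unit one has to show that [Y a vac] is a power series. Its matrix elements
    are those of the one-point operator at [x]; between weights [De1] and [De0]
    such a function is homogeneous of degree [De0 - De1] and analytic at the
    origin, so that it is constant in degree 0 and zero in negative degree
    ([one_point_degree_le0]). Covariance under [D] reads as the Euler identity
    ([one_point_euler]), which expresses it through the one-point functions of
    the vectors [P_mu a], of degree one less. Descending, the function is a
    matrix element of [exp(x . P) a], a power series with constant term [a].

    Convergence. Projecting [Y a b] to a weight space gives a component of the
    two-point operator ([Y_pr_value]); therefore the terms of the products and of
    the iterate are literally the terms of cluster expansions of three-point
    functions, in which the last two points, or the first two, are fused. By
    permutation invariance the sums are values of one function of the two points,
    the third one being the origin, and uniformity on compact sets gives locally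
    uniform convergence because configurations have compact neighbourhoods. *)

(** * Independence of characters *)

Lemma fsumT_widen (I : choiceType) (V : zmodType) (f : I -> V) (A : set I) :
  finite_set A -> (forall k, ~ A k -> f k = 0) ->
  \sum_(k \in [set: I]) f k = \sum_(k <- fset_set A) f k.
Proof.
move=> Af f0; rewrite -fsbig_finite //=; symmetry.
by apply: fsbig_widen => // k [_ /f0 /= ->].
Qed.

Section Dedekind.
Variables (F : fieldType) (V : lmodType F) (T : Type) (M : set T).
Variables (mul : T -> T -> T) (I : eqType) (chi : I -> T -> F).
Hypothesis M_neq0 : M !=set0.
Hypothesis M_mul : forall x y, M x -> M y -> M (mul x y).
Hypothesis chiM : forall i x y, M x -> M y -> chi i (mul x y) = chi i x * chi i y.
Hypothesis chi_neq0 : forall i x, M x -> chi i x != 0.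

(** Dedekind's argument, with coefficients in a module: translating the relation by
    an element that separates two characters and subtracting shortens it. *)
Lemma characters_free (s : seq I) (h : I -> V) : uniq s ->
  (forall i j, i \in s -> j \in s -> i != j -> exists2 x, M x & chi i x != chi j x) ->
  (forall x, M x -> \sum_(i <- s) chi i x *: h i = 0) ->
  forall i, i \in s -> h i = 0.
Proof.
elim: s h => [//|k s IHs] h /= /andP[ks us] sep sum0.
have s_sep i j : i \in s -> j \in s -> i != j -> exists2 x, M x & chi i x != chi j x.
  by move=> si sj; apply: sep; rewrite inE ?si ?sj orbT.
have hs i : i \in s -> h i = 0.
  move=> si; have ki : k != i by apply: contraNneq ks => ->.
  have [|||y My chiy] := sep k i; rewrite ?inE ?eqxx ?si ?orbT //.
  suff /eqP : (chi i y - chi k y) *: h i = 0.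
    by rewrite scaler_eq0 subr_eq0 eq_sym (negPf chiy) => /eqP.
  apply: (IHs (fun i => (chi i y - chi k y) *: h i)) => // x Mx.
  have := sum0 _ (M_mul Mx My); rewrite big_cons chiM // => sxy.
  have /(congr1 (fun v => chi k y *: v)) := sum0 _ Mx.
  rewrite big_cons scaler0 scalerDr scalerA mulrC => sx.
  have : chi k x * chi k y *: h k + \sum_(j <- s) chi j (mul x y) *: h j -
    (chi k x * chi k y *: h k + chi k y *: \sum_(j <- s) chi j x *: h j) = 0.
    by rewrite sxy sx subrr.
  rewrite opprD addrACA subrr add0r scaler_sumr -sumrB => E0.
  rewrite -[RHS]E0; apply: eq_bigr => j _.
  by rewrite chiM // !scalerA -scalerBl mulrBr [chi j x * chi k y]mulrC.
move=> i; rewrite inE => /predU1P[->|/hs //].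
have [x Mx] := M_neq0.
have /eqP := sum0 _ Mx; rewrite big_cons big_seq big1 ?addr0 => [|j /hs -> //].
  by rewrite scaler_eq0 (negPf (chi_neq0 _ Mx)) => /eqP.
by rewrite scaler0.
Qed.
End Dedekind.

(** * Spherical polynomials and their values *)

Section SphericalPolynomials.
Variables (R : realType) (d : nat) (H : lmodType R[i]).
Implicit Types (p q : spoly d H) (f g : fpoly d H) (x : 'rV[R]_d).

Lemma fpolyDE f g k : (f + g) k = f k + g k.
Proof. by []. Qed.

Lemma fpoly_sumE (I : Type) (s : seq I) (P : pred I) (g : I -> fpoly d H) k :
  (\sum_(i <- s | P i) g i) k = \sum_(i <- s | P i) g i k.
Proof. by elim/big_rec2: _ => // i y z _ <-. Qed.

Lemma fmonoE (al : mindex d) (r : R) (h : H) k :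
  fmono al r h k = if k == (al, r) then h else 0.
Proof. by []. Qed.

Lemma eq_fpoly f g : (forall k, f k = g k) -> f = g.
Proof. by move=> fg; apply/val_inj/funext. Qed.

Lemma fpoly_sum_mono f :
  f = \sum_(k <- fset_set [set k | f k != 0]) fmono k.1 k.2 (f k).
Proof.
apply: eq_fpoly => j; rewrite fpoly_sumE.
under eq_bigr do rewrite fmonoE -surjective_pairing.
have [fj|fj] := eqVneq (f j) 0.
  by rewrite fj big1 // => k _; case: eqP => // <-.
rewrite (bigD1_seq j) ?fset_uniq //=; last first.
  by rewrite in_fset_set ?inE //; exact: fpoly_fin.
by rewrite eqxx big1 ?addr0 // => k; rewrite eq_sym => /negPf ->.
Qed.

Lemma pi_spolyD : {morph \pi_(spoly d H) : f g / f + g}.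
Proof. by move=> f g; rewrite !piE. Qed.

Lemma pi_spoly0 : \pi_(spoly d H) 0 = 0.
Proof. by rewrite piE. Qed.

Lemma spoly_ind (P : spoly d H -> Prop) : P 0 ->
  (forall al r h, P (smono al r h)) -> (forall p q, P p -> P q -> P (p + q)) ->
  forall p, P p.
Proof.
move=> P0 Pm PD p; rewrite -[p]reprK (fpoly_sum_mono (repr p)).
rewrite (big_morph _ pi_spolyD pi_spoly0).
by elim/big_ind: _ => // i _; apply: Pm.
Qed.

Lemma spoly_pi_smono f : \pi_(spoly d H) f =
  \sum_(k <- fset_set [set k | f k != 0]) smono k.1 k.2 (f k).
Proof.
by rewrite {1}(fpoly_sum_mono f) (big_morph _ pi_spolyD pi_spoly0).
Qed.

Lemma homogeneous_ind (P : spoly d H -> Prop) (la : R) : P 0 ->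
  (forall al h, P (smono al (la - (mdeg al)%:R) h)) ->
  (forall p q, P p -> P q -> P (p + q)) ->
  forall p, homogeneous la p -> P p.
Proof.
move=> P0 Pm PD p [f -> fla]; rewrite spoly_pi_smono.
rewrite big_seq; elim/big_ind: _ => // k; rewrite in_fset_set; last exact: fpoly_fin.
rewrite inE /= => /fla kla.
by have -> : k.2 = la - (mdeg k.1)%:R by rewrite -kla addrAC subrr add0r.
Qed.

Section SliftAdditive.
Variables (V : zmodType) (op : mindex d -> R -> H -> V).
Hypothesis opD : forall al r, {morph op al r : h h' / h + h'}.
Hypothesis op_sphere : forall al r h,
  \sum_mu op (mincr mu (mincr mu al)) r h = op al (r + 2) h.

Lemma sliftD p q : slift op (p + q) = slift op p + slift op q.
Proof.
by rewrite -[p]reprK -[q]reprK -pi_spolyD !(slift_pi opD op_sphere) fliftD.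
Qed.

Lemma slift0 : slift op 0 = 0.
Proof. by apply: (addrI (slift op 0)); rewrite -sliftD !addr0. Qed.
End SliftAdditive.

Lemma spoly_evalD x p q : x != 0 ->
  spoly_eval (p + q) x = spoly_eval p x + spoly_eval q x.
Proof.
move=> x0.
pose op (al : mindex d) (r : R) (h : H) :=
  ((\prod_mu x 0 mu ^+ al mu) * enorm x `^ r)%:C *: h.
have opD al r : {morph op al r : h h' / h + h'} by move=> h h'; exact: scalerDr.
have opS al r h : \sum_mu op (mincr mu (mincr mu al)) r h = op al (r + 2) h.
  rewrite /op -scaler_suml -rmorph_sum; congr (_%:C *: _).
  have e0 : enorm x != 0 by rewrite gt_eqF // enorm_gt0.
  rewrite powRD ?e0 ?implybT // powR_mulrn ?sqrtr_ge0 // enorm_sqr.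
  rewrite [_ `^ r * _]mulrC mulrA mulr_sumr mulr_suml; apply: eq_bigr => mu _.
  congr (_ * _); rewrite (bigD1 mu) //= [in RHS](bigD1 mu) //= !ffunE eqxx.
  rewrite mulrAC -exprD -addnA; congr (_ * _); apply: eq_bigr => nu /negPf nm.
  by rewrite !ffunE nm !addn0.
exact: (sliftD opD opS).
Qed.

Lemma spoly_eval0 x : x != 0 -> spoly_eval (0 : spoly d H) x = 0.
Proof.
by move=> x0; apply: (addrI (spoly_eval 0 x)); rewrite -spoly_evalD // !addr0.
Qed.

Lemma spoly_eval_sum x (I : Type) (s : seq I) (P : pred I) (g : I -> spoly d H) :
  x != 0 -> spoly_eval (\sum_(i <- s | P i) g i) x =
            \sum_(i <- s | P i) spoly_eval (g i) x.
Proof.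
move=> x0; elim/big_rec2: _ => [|i y z _ <-]; first by rewrite spoly_eval0.
by rewrite spoly_evalD.
Qed.

Lemma smonoZ (al : mindex d) (r : R) c (h : H) :
  smono al r (c *: h) = c *: smono al r h.
Proof. by rewrite /smono fmonoZ; exact: pi_spoly_scale. Qed.

Lemma spoly_evalZ x c p : x != 0 -> spoly_eval (c *: p) x = c *: spoly_eval p x.
Proof.
move=> x0; elim/spoly_ind: p => [|al r h|p q IHp IHq].
- by rewrite scaler0 spoly_eval0 // scaler0.
- by rewrite -smonoZ !spoly_eval_smono // !scalerA mulrC.
- by rewrite scalerDr !spoly_evalD // IHp IHq scalerDr.
Qed.

Lemma spoly_evalN x p : x != 0 -> spoly_eval (- p) x = - spoly_eval p x.
Proof. by move=> x0; rewrite -(scaleN1r p) spoly_evalZ // scaleN1r. Qed.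

(* normal form *)
(** The relation trades the square of [x_i0] for the norm and the other
    coordinates, until [x_i0] occurs at most once in each monomial. *)
Lemma spoly_normal_form (i0 : 'I_d) p :
  exists2 f, p = \pi f & forall k, f k != 0 -> (k.1 i0 <= 1)%N.
Proof.
elim/spoly_ind: p => [|al r h|_ _ [f -> nf] [g -> ng]].
- by exists 0 => [|k]; rewrite ?pi_spoly0 //; rewrite eqxx.
- have [n] := ubnP (al i0); elim: n al r => // n IHn al r.
  rewrite ltnS => aln.
  have [al1|al2] := leqP (al i0) 1.
    exists (fmono al r h) => // k; rewrite fmonoE.
    by have [-> //|] := eqVneq k (al, r); rewrite eqxx.
  pose be := mdecr i0 (mdecr i0 al).
  have bei0 : be i0 = (al i0 - 2)%N by rewrite !ffunE eqxx -subnDA.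
  have alE : al = mincr i0 (mincr i0 be).
    apply/ffunP => i; rewrite !ffunE; case: eqP => [->|_]; last by rewrite !subn0 !addn0.
    by rewrite -addnA -subnDA addn1 subnK.
  have -> : smono al r h = smono be (r + 2) h -
      \sum_(mu < d | mu != i0) smono (mincr mu (mincr mu be)) r h.
    by rewrite -smono_sphere (bigD1 i0) //= -alE addrK.
  have [|f0 -> nf0] := IHn be (r + 2).
    by rewrite bei0 (leq_trans _ aln) // ltn_subrL (ltn_trans _ al2).
  have Hmu mu : mu != i0 -> exists2 f, smono (mincr mu (mincr mu be)) r h = \pi f
      & forall k, f k != 0 -> (k.1 i0 <= 1)%N.
    move=> mui; apply: IHn; rewrite !ffunE eq_sym (negPf mui) !addn0 !eqxx -subnDA.
    by rewrite (leq_trans _ aln) // ltn_subrL (ltn_trans _ al2).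
  have [f1 -> nf1] : exists2 f,
      \sum_(mu < d | mu != i0) smono (mincr mu (mincr mu be)) r h = \pi f
      & forall k, f k != 0 -> (k.1 i0 <= 1)%N.
    elim/big_ind: _ => [|_ _ [f -> nf] [g -> ng]|//].
      by exists 0; rewrite ?pi_spoly0 // => k; rewrite eqxx.
    exists (f + g); first by rewrite pi_spolyD.
    move=> k; rewrite fpolyDE; have [f0k|/nf //] := eqVneq (f k) 0.
    by rewrite f0k add0r => /ng.
  exists (f0 - f1); first by rewrite !piE.
  move=> k; rewrite fpolyDE; have [f0k|/nf0 //] := eqVneq (f0 k) 0.
  rewrite f0k add0r => f1k; apply: nf1; apply: contraNneq f1k => E.
  by have -> : (- f1) k = - f1 k by []; rewrite E oppr0.
exists (f + g); first by rewrite pi_spolyD.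
move=> k; rewrite fpolyDE; have [f0k|/nf //] := eqVneq (f k) 0.
by rewrite f0k add0r => /ng.
Qed.
End SphericalPolynomials.
(** * Spherical polynomials are determined by their values *)

Section Injectivity.
Variables (R : realType) (d : nat) (H : lmodType R[i]) (i0 : 'I_d).
Implicit Types (p q : spoly d H) (x y z : 'rV[R]_d) (k : smonom R d).

(** In the coordinates where [y_i0] stands for the norm of the point, this is a set
    of points off the hyperplane [x_i0 = 0]; [cone_lift] returns to the point. *)
Definition cone : set 'rV[R]_d :=
  [set y | (forall i, 0 < y 0 i) /\ \sum_(i < d | i != i0) y 0 i ^+ 2 < y 0 i0 ^+ 2].

Definition hadamard y z : 'rV[R]_d := \row_i (y 0 i * z 0 i).

Definition cone_char k y : R[i] :=
  ((\prod_(i < d | i != i0) y 0 i ^+ k.1 i) * y 0 i0 `^ k.2)%:C.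

Definition cone_lift (w : R) y : 'rV[R]_d :=
  \row_i (if i == i0 then w else y 0 i).

(** The restricted norm is submultiplicative for the entrywise product. *)
Lemma cone_hadamard y z : cone y -> cone z -> cone (hadamard y z).
Proof.
move=> [y0 yc] [z0 zc]; split=> [i|]; rewrite !mxE; first exact: mulr_gt0.
under eq_bigr do rewrite mxE exprMn.
rewrite exprMn; apply: (@le_lt_trans _ _ ((\sum_(i < d | i != i0) y 0 i ^+ 2) * z 0 i0 ^+ 2)).
  rewrite mulr_suml; apply: ler_sum => i ii0; rewrite ler_wpM2l ?sqr_ge0 //.
  apply: le_trans (ltW zc); rewrite (bigD1 i) //= lerDl.
  by apply: sumr_ge0 => j _; exact: sqr_ge0.
by rewrite ltr_pM2r // exprn_gt0.
Qed.

Lemma cone_charM k y z : cone y -> cone z ->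
  cone_char k (hadamard y z) = cone_char k y * cone_char k z.
Proof.
move=> [y0 _] [z0 _]; rewrite /cone_char -rmorphM; congr (_%:C).
under eq_bigr do rewrite mxE exprMn.
by rewrite big_split /= mxE powRM ?ltW // mulrACA.
Qed.

Lemma cone_char_neq0 k y : cone y -> cone_char k y != 0.
Proof.
move=> [y0 _]; rewrite fmorph_eq0 mulf_neq0 //; last by rewrite gt_eqF ?powR_gt0.
by apply/prodf_neq0 => i _; rewrite expf_neq0 // gt_eqF.
Qed.

(** A large norm coordinate leaves room for any bounded values of the others. *)
Lemma cone_separates (j0 : 'I_d) : exists s : R, 1 < s /\
  cone (\row_i (if i == i0 then s else if i == j0 then 2 else 1)) /\
  cone (\row_i (if i == i0 then s else 1)).
Proof.
have d0 : 0 <= d%:R :> R by [].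
(* The other coordinates are at most 2, so their squares add up to at most 4 d. *)
exists (d%:R *+ 4 + 2); split; first by lra.
have le4 (c : 'I_d -> R) : (forall i, 0 <= c i <= 2) ->
    \sum_(i < d | i != i0) c i ^+ 2 < (d%:R *+ 4 + 2) ^+ 2.
  move=> c2; apply: (@le_lt_trans _ _ (\sum_(i < d) 4)); last first.
    by rewrite sumr_const card_ord -mulr_natl; nra.
  rewrite [leRHS](bigID (fun i => i != i0)) /= -[leLHS]addr0 lerD //; last exact: sumr_ge0.
  by apply: ler_sum => i _; have /andP[] := c2 i; nra.
split; split=> [i|].
- by rewrite mxE; case: ifP => _; [lra|case: ifP].
- rewrite mxE eqxx.
  rewrite (eq_bigr (fun i => (if i == j0 then 2 else 1) ^+ 2)); first last.
    by move=> i /negPf ii0; rewrite mxE ii0.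
  by apply: le4 => i; case: ifP => _; lra.
- by rewrite mxE; case: ifP => _; lra.
- rewrite mxE eqxx.
  rewrite (eq_bigr (fun i => 1 ^+ 2)); last by move=> i /negPf ii0; rewrite mxE ii0.
  by apply: le4 => i; lra.
Qed.

Lemma cone_char_inj k k' : k.1 i0 = k'.1 i0 -> k != k' ->
  exists2 y, cone y & cone_char k y != cone_char k' y.
Proof.
case: k k' => [al r] [be t] /= alb kk'.
have inj := @complexI R.
have [rt|rt] := eqVneq r t; last first.
  have [s [s1 [_ Cs]]] := cone_separates i0; exists (\row_i (if i == i0 then s else 1)) => //.
  rewrite (inj_eq inj) !mxE eqxx /=.
  rewrite big1 ?mul1r => [|i /negPf ii0]; last by rewrite mxE ii0 expr1n.
  rewrite big1 ?mul1r => [|i /negPf ii0]; last by rewrite mxE ii0 expr1n.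
  apply: contra_neq rt => /(congr1 (@ln R)); rewrite !ln_powR.
  by apply: mulIf; rewrite gt_eqF // ln_gt0.
have [j alj] : exists j, al j != be j.
  apply/existsP; rewrite -negb_forall; apply: contra kk' => /forallP ab.
  by rewrite xpair_eqE rt eqxx andbT; apply/eqP/ffunP => i; apply/eqP.
have ji0 : j != i0 by apply: contraNneq alj => ->; rewrite alb.
have [s [s1 [Cs _]]] := cone_separates j.
exists (\row_i (if i == i0 then s else if i == j then 2 else 1)) => //.
rewrite (inj_eq inj) !mxE eqxx /= rt.
have prodE (c : mindex d) : \prod_(i < d | i != i0)
    (\row_i1 (if i1 == i0 then s else if i1 == j then 2 else 1) : 'rV[R]_d) 0 i ^+ c i
    = 2 ^+ c j :> R.
  rewrite (bigD1 j) //= mxE (negPf ji0) eqxx big1 ?mulr1 // => i /andP[/negPf ii0 /negPf ij].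
  by rewrite mxE ii0 ij expr1n.
have s0 : s `^ t != 0 by rewrite gt_eqF ?powR_gt0 //; lra.
rewrite !prodE (inj_eq (mulIf s0)).
apply: contra_neq alj => /ieexprIn; apply; rewrite ?ltr0n //.
by rewrite gt_eqF // ltr1n.
Qed.

Lemma enorm_cone_lift w y : cone y ->
  w ^+ 2 = y 0 i0 ^+ 2 - \sum_(i < d | i != i0) y 0 i ^+ 2 ->
  enorm (cone_lift w y) = y 0 i0.
Proof.
move=> [y0 _] wE; rewrite /enorm (bigD1 i0) //= mxE eqxx.
rewrite (eq_bigr (fun i => y 0 i ^+ 2)); last by move=> i /negPf ii0; rewrite mxE ii0.
by rewrite wE subrK sqrtr_sqr gtr0_norm.
Qed.

(** The coordinate [i0] is traded for the norm: on [cone], with the norm as the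
    coordinate [i0], the monomials of a normal form are distinct characters of
    a semigroup, once those of even and odd degree in [x_i0] are separated by
    the reflection of [x_i0]. *)
Lemma spoly_eval_inj p : (forall x, x != 0 -> spoly_eval p x = 0) -> p = 0.
Proof.
have [f -> nf] := spoly_normal_form i0 p => p0.
set S := fset_set [set k | f k != 0].
have lift_eval w y : cone y ->
    w ^+ 2 = y 0 i0 ^+ 2 - \sum_(i < d | i != i0) y 0 i ^+ 2 ->
    \sum_(k <- S | k.1 i0 == 0%N) cone_char k y *: f k
    + w%:C *: \sum_(k <- S | k.1 i0 != 0%N) cone_char k y *: f k = 0.
  move=> Cy wE; have x0 : cone_lift w y != 0.
    apply: contraTneq (Cy.1 i0) => E; rewrite -(enorm_cone_lift Cy wE) E /enorm.
    by rewrite big1 ?sqrtr0 ?ltxx // => i _; rewrite mxE expr0n.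
  have := p0 _ x0; rewrite spoly_pi_smono spoly_eval_sum // -/S => E.
  rewrite -[RHS]E [RHS](bigID (fun k => k.1 i0 == 0%N)) /= scaler_sumr.
  have prodE k : \prod_mu cone_lift w y 0 mu ^+ k.1 mu
      = w ^+ k.1 i0 * \prod_(i < d | i != i0) y 0 i ^+ k.1 i.
    rewrite (bigD1 i0) //= mxE eqxx; congr (_ * _).
    by apply: eq_bigr => i /negPf ii0; rewrite mxE ii0.
  congr (_ + _); rewrite big_seq_cond [RHS]big_seq_cond; apply: eq_bigr => k /andP[kS k0].
    by rewrite spoly_eval_smono // prodE (eqP k0) mul1r (enorm_cone_lift Cy wE).
  rewrite spoly_eval_smono // prodE (enorm_cone_lift Cy wE).
  have -> : k.1 i0 = 1%N.
    apply/eqP; rewrite eqn_leq lt0n k0 andbT nf //.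
    by move: kS; rewrite in_fset_set ?inE //; exact: fpoly_fin.
  by rewrite -mulrA rmorphM scalerA.
(* The two lifts of [y] are mirror images in [x_i0 = 0]. *)
have parts y : cone y ->
    \sum_(k <- S | k.1 i0 == 0%N) cone_char k y *: f k = 0 /\
    \sum_(k <- S | k.1 i0 != 0%N) cone_char k y *: f k = 0.
  move=> Cy; pose w := Num.sqrt (y 0 i0 ^+ 2 - \sum_(i < d | i != i0) y 0 i ^+ 2).
  have w2 : w ^+ 2 = y 0 i0 ^+ 2 - \sum_(i < d | i != i0) y 0 i ^+ 2.
    by rewrite sqr_sqrtr // subr_ge0 ltW //; case: Cy.
  have w0 : w != 0 by rewrite gt_eqF // sqrtr_gt0 subr_gt0; case: Cy.
  have E1 := lift_eval w y Cy w2; have := lift_eval (- w) y Cy.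
  rewrite sqrrN => /(_ w2) E2.
  have /eqP B0 : (w + w)%:C *: \sum_(k <- S | k.1 i0 != 0%N) cone_char k y *: f k = 0.
    move/eqP: (etrans E1 (esym E2)); rewrite -subr_eq0 opprD addrACA subrr add0r.
    by rewrite -scalerBl -rmorphB opprK => /eqP.
  move: B0; rewrite scaler_eq0 fmorph_eq0 -mulr2n mulrn_eq0 /= (negPf w0) /= => /eqP B0.
  by move: E1; rewrite B0 scaler0 addr0.
have cone0 : cone !=set0 by have [s [_ [_ Cs]]] := cone_separates i0; 
  exists (\row_i (if i == i0 then s else 1)).
have f0 : forall k, k \in S -> f k = 0.
  move=> k kS.
  (* In a normal form [k.1 i0] is 0 or 1, and [b] says which. *)
  have Hfree b : forall k,
      k \in [seq k : smonom R d <- S | (k.1 i0 == 0%N) == b] -> f k = 0.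
    apply: (characters_free cone0 cone_hadamard cone_charM cone_char_neq0).
    - by rewrite filter_uniq // fset_uniq.
    - move=> i j; rewrite !mem_filter => /andP[/eqP ib iS] /andP[/eqP jb jS].
      have ki_le1 j' : j' \in S -> (j'.1 i0 <= 1)%N.
        by rewrite in_fset_set ?inE; [exact: nf|exact: fpoly_fin].
      apply: cone_char_inj; have := ki_le1 _ iS; have := ki_le1 _ jS.
      by move: ib jb; case: (i.1 i0) (j.1 i0) => [|[|]] [|[|]] // <-.
    - move=> x /parts[P1 P2]; rewrite big_filter.
      by case: b; [rewrite -[RHS]P1|rewrite -[RHS]P2]; apply: eq_bigl => j;
        rewrite ?eqb_id // eqbF_neg.
  by apply: (Hfree (k.1 i0 == 0%N)); rewrite mem_filter eqxx.
rewrite spoly_pi_smono -/S big_seq big1 // => k /f0 ->.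
by rewrite smono0.
Qed.
End Injectivity.
(** * Operations on spherical polynomials, seen on values *)

Section Evaluation.
Variables (R : realType) (d : nat).
Implicit Types (H : lmodType R[i]) (x : 'rV[R]_d).

Lemma spoly_eval_mulX H mu (p : spoly d H) x : x != 0 ->
  spoly_eval (spoly_mulX mu p) x = (x 0 mu)%:C *: spoly_eval p x.
Proof.
move=> x0; pose op (al : mindex d) (r : R) (h : H) := smono (mincr mu al) r h.
have opD al r : {morph op al r : h h' / h + h'} by exact: smonoD.
have opS al r h : \sum_nu op (mincr nu (mincr nu al)) r h = op al (r + 2) h.
  by rewrite /op -smono_sphere; apply: eq_bigr => nu _; rewrite !(mincrC mu).
elim/spoly_ind: p => [|al r h|p q IHp IHq].
- by rewrite /spoly_mulX (slift0 opD opS) spoly_eval0 // scaler0.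
- rewrite spoly_mulX_smono !spoly_eval_smono // scalerA -rmorphM mulrA.
  congr ((_ * _)%:C *: _); rewrite (bigD1 mu) //= [in RHS](bigD1 mu) //= !ffunE eqxx.
  rewrite mulrA -exprS addn1; congr (_ * _); apply: eq_bigr => nu /negPf nm.
  by rewrite !ffunE nm addn0.
- by rewrite /spoly_mulX (sliftD opD opS) !spoly_evalD // IHp IHq scalerDr.
Qed.

(** Linearity as a property of a bare function: the action and the projections to
    the weight spaces are not bundled. *)
Definition is_clinear (H H' : lmodType R[i]) (f : H -> H') :=
  forall (c : R[i]) a b, f (c *: a + b) = c *: f a + f b.

Section ClinearTheory.
Variables (H H' : lmodType R[i]) (f : H -> H').
Hypothesis fl : is_clinear f.

Lemma clinearD a b : f (a + b) = f a + f b.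
Proof. by have := fl 1 a b; rewrite !scale1r. Qed.

Lemma clinear0 : f 0 = 0.
Proof. by apply: (addrI (f 0)); rewrite -clinearD !addr0. Qed.

Lemma clinearZ c a : f (c *: a) = c *: f a.
Proof. by have := fl c a 0; rewrite clinear0 !addr0. Qed.

Lemma clinear_sum (I : Type) (s : seq I) (P : pred I) (g : I -> H) :
  f (\sum_(i <- s | P i) g i) = \sum_(i <- s | P i) f (g i).
Proof. by apply: (big_morph f clinearD clinear0). Qed.

Lemma spoly_eval_map (p : spoly d H) x : x != 0 ->
  spoly_eval (spoly_map f p) x = f (spoly_eval p x).
Proof.
move=> x0; pose op (al : mindex d) (r : R) (h : H) := smono al r (f h).
have opD al r : {morph op al r : h h' / h + h'}.
  by move=> h h'; rewrite /op clinearD smonoD.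
have opS al r h : \sum_nu op (mincr nu (mincr nu al)) r h = op al (r + 2) h.
  exact: smono_sphere.
elim/spoly_ind: p => [|al r h|p q IHp IHq].
- by rewrite /spoly_map (slift0 opD opS) !spoly_eval0 // clinear0.
- by rewrite /spoly_map (slift_smono opD opS) !spoly_eval_smono // clinearZ.
- by rewrite /spoly_map (sliftD opD opS) !spoly_evalD // IHp IHq clinearD.
Qed.
End ClinearTheory.

Lemma linear_clinear H (u : {linear H -> R[i]^o}) : is_clinear u.
Proof. by move=> c a b; rewrite linearP. Qed.

(** Homogeneity read off the values, so that it passes through the operations
    without a choice of representatives *)
Definition scales H (la : R) (p : spoly d H) : Prop :=
  forall t x, 0 < t -> x != 0 ->
    spoly_eval p (t *: x) = (t `^ la)%:C *: spoly_eval p x.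

Lemma scale_neq0 t x : 0 < t -> x != 0 -> t *: x != 0.
Proof. by move=> t0 x0; rewrite scaler_eq0 negb_or gt_eqF. Qed.

Lemma enormZ t x : 0 < t -> enorm (t *: x) = t * enorm x.
Proof.
move=> t0; rewrite /enorm.
under eq_bigr do rewrite mxE exprMn.
by rewrite -mulr_sumr sqrtrM ?sqr_ge0 // sqrtr_sqr gtr0_norm.
Qed.

Lemma scales0 H la : scales la (0 : spoly d H).
Proof.
by move=> t x t0 x0; rewrite !spoly_eval0 ?scale_neq0 // scaler0.
Qed.

Lemma scalesD H la (p q : spoly d H) : scales la p -> scales la q -> scales la (p + q).
Proof.
move=> ph qh t x t0 x0; rewrite !spoly_evalD ?scale_neq0 // ph // qh //.
by rewrite scalerDr.
Qed.

Lemma scalesZ H la c (p : spoly d H) : scales la p -> scales la (c *: p).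
Proof.
move=> ph t x t0 x0; rewrite !spoly_evalZ ?scale_neq0 // ph //.
by rewrite !scalerA mulrC.
Qed.

Lemma scalesN H la (p : spoly d H) : scales la p -> scales la (- p).
Proof. by move=> ph; rewrite -scaleN1r; exact: scalesZ. Qed.

Lemma scales_sum H la (I : Type) (s : seq I) (P : pred I) (g : I -> spoly d H) :
  (forall i, P i -> scales la (g i)) -> scales la (\sum_(i <- s | P i) g i).
Proof.
by move=> gh; elim/big_ind: _ => //; [exact: scales0|exact: scalesD].
Qed.

Lemma scales_smono H (al : mindex d) r la (h : H) :
  (mdeg al)%:R + r = la -> scales la (smono al r h).
Proof.
move=> <- t x t0 x0; rewrite !spoly_eval_smono ?scale_neq0 // scalerA -rmorphM.
congr (_%:C *: _); rewrite enormZ // powRM ?ltW //; last exact: enorm_gt0.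
under eq_bigr do rewrite mxE exprMn.
rewrite big_split /= prodrXr powRD ?(lt0r_neq0 t0) ?implybT // powR_mulrn ?ltW //.
by rewrite mulrACA.
Qed.

Lemma homogeneous_scales H la (p : spoly d H) : homogeneous la p -> scales la p.
Proof.
apply: homogeneous_ind => [|al h|q q']; first exact: scales0.
- by apply: scales_smono; rewrite addrC subrK.
- exact: scalesD.
Qed.

Lemma scales_mulX H mu la (p : spoly d H) : scales (la - 1) p -> scales la (spoly_mulX mu p).
Proof.
move=> ph t x t0 x0; rewrite !spoly_eval_mulX ?scale_neq0 // ph // mxE !scalerA.
congr (_ *: _); rewrite -!rmorphM; congr (_%:C).
have -> : t `^ la = t `^ (la - 1) * t.
  by rewrite -{1}[la](subrK 1) (@powRD _ _ (la - 1)) ?(lt0r_neq0 t0) ?implybT // powRr1 ?ltW.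
by ring.
Qed.

Lemma scales_map H H' (f : H -> H') la (p : spoly d H) : is_clinear f ->
  scales la p -> scales la (spoly_map f p).
Proof.
by move=> fl ph t x t0 x0; rewrite !spoly_eval_map ?scale_neq0 // ph // clinearZ.
Qed.
End Evaluation.
(** * The formal derivative is the derivative of the values *)

Section Derivatives.
Variables (R : realType).

Lemma has_cderiv_near (f g : R -> R[i]) t v :
  (\forall s \near t, f s = g s) -> has_cderiv f t v -> has_cderiv g t v.
Proof.
move=> fg [fr fi]; split; [move: fr|move: fi]; apply: near_eq_is_derive.
  by apply: filterS fg => s ->.
by apply: filterS fg => s ->.
Qed.

Lemma has_cderivD (f g : R -> R[i]) t v w :
  has_cderiv f t v -> has_cderiv g t w -> has_cderiv (fun s => f s + g s) t (v + w).
Proof.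
move=> [fr fi] [gr gi]; split.
  have -> : (fun s => complex.Re (f s + g s)) =
    (fun s => complex.Re (f s)) + (fun s => complex.Re (g s)).
    by apply/funext => s; rewrite raddfD.
  by rewrite raddfD; exact: is_deriveD.
have -> : (fun s => complex.Im (f s + g s)) =
  (fun s => complex.Im (f s)) + (fun s => complex.Im (g s)).
  by apply/funext => s; rewrite raddfD.
by rewrite raddfD; exact: is_deriveD.
Qed.

Lemma has_cderiv0 t : has_cderiv (fun _ : R => 0) t 0.
Proof. by split; rewrite raddf0; exact: is_derive_cst. Qed.

Lemma has_cderiv_sum (I : Type) (s : seq I) (f : I -> R -> R[i]) (v : I -> R[i]) t :
  (forall i, has_cderiv (f i) t (v i)) ->
  has_cderiv (fun z => \sum_(i <- s) f i z) t (\sum_(i <- s) v i).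
Proof.
move=> fv; elim: s => [|i s IHs].
  by rewrite big_nil; under eq_fun do rewrite big_nil; exact: has_cderiv0.
by rewrite big_cons; under eq_fun do rewrite big_cons; exact: has_cderivD.
Qed.

Lemma has_cderivZ (f : R -> R) (c : R[i]) t v :
  is_derive t (1 : R) f v -> has_cderiv (fun s => (f s)%:C * c) t (v%:C * c).
Proof.
move=> fv; split.
  have -> : (fun s => complex.Re ((f s)%:C * c)) = complex.Re c \*: f.
    by apply/funext => s; case: c => a b; rewrite /= mul0r subr0 mulrC.
  have -> : complex.Re (v%:C * c) = complex.Re c *: v.
    by case: c => a b; rewrite /= mul0r subr0 mulrC.
  exact: is_deriveZ.
have -> : (fun s => complex.Im ((f s)%:C * c)) = complex.Im c \*: f.
  by apply/funext => s; case: c => a b; rewrite /= mul0r addr0 mulrC.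
have -> : complex.Im (v%:C * c) = complex.Im c *: v.
  by case: c => a b; rewrite /= mul0r addr0 mulrC.
exact: is_deriveZ.
Qed.

Lemma has_cderiv_unique (f : R -> R[i]) t v w :
  has_cderiv f t v -> has_cderiv f t w -> v = w.
Proof.
move=> [fr fi] [gr gi]; apply/eqP; rewrite eq_complex.
have [_ <-] := fr; have [_ <-] := fi; have [_ <-] := gr; have [_ <-] := gi.
by rewrite !eqxx.
Qed.

Variable d : nat.
Implicit Types (x : 'rV[R]_d).

Lemma shift_neq0 mu x : x != 0 ->
  \forall s \near (0 : R), x + s *: delta_mx 0 mu != 0.
Proof.
move=> x0; have [j xj] : exists j, x 0 j != 0.
  apply/existsP; rewrite -negb_forall; apply: contra x0 => /forallP x0.
  by apply/eqP/rowP => j; rewrite mxE; apply/eqP.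
near=> s; apply/eqP => /rowP/(_ j); rewrite !mxE eqxx /=.
case: (j == mu); rewrite ?mulr0 ?mulr1 ?addr0; last by apply/eqP.
move=> /eqP; rewrite addr_eq0 => /eqP xs.
have : `|s| < `|x 0 j| by near: s; apply: (@nbhs0_lt _ R^o); rewrite normr_gt0.
by rewrite xs normrN ltxx.
Unshelve. all: by end_near. Qed.

(** The derivative of the value of a monomial in the direction [mu], in the form
    that [spoly_deriv] produces *)
Definition dmono mu (al : mindex d) (r : R) x : R :=
  (al mu)%:R * ((\prod_nu x 0 nu ^+ mdecr mu al nu) * enorm x `^ r)
  + r * ((\prod_nu x 0 nu ^+ mincr mu al nu) * enorm x `^ (r - 2)).

Lemma is_derive_dmono mu (al : mindex d) (r : R) x : x != 0 ->
  is_derive (0 : R) (1 : R)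
    (fun s => (\prod_nu (x + s *: delta_mx 0 mu) 0 nu ^+ al nu)
              * enorm (x + s *: delta_mx 0 mu) `^ r)
    (dmono mu al r x).
Proof.
move=> x0.
pose C := \prod_(nu < d | nu != mu) x 0 nu ^+ al nu.
pose Q := \sum_(nu < d | nu != mu) x 0 nu ^+ 2.
have coordE s nu : nu != mu -> (x + s *: delta_mx 0 mu) 0 nu = x 0 nu.
  by move=> /negPf nm; rewrite !mxE nm andbF mulr0 addr0.
have coordmu s : (x + s *: delta_mx 0 mu) 0 mu = x 0 mu + s.
  by rewrite !mxE !eqxx mulr1.
have Q0 : 0 <= Q by apply: sumr_ge0 => nu _; exact: sqr_ge0.
have normE s : enorm (x + s *: delta_mx 0 mu) `^ r = ((x 0 mu + s) ^+ 2 + Q) `^ (2^-1 * r).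
  rewrite powRrM powR12_sqrt ?addr_ge0 ?sqr_ge0 //; congr (Num.sqrt _ `^ _).
  rewrite (bigD1 mu) //= coordmu; congr (_ + _).
  by apply: eq_bigr => nu nm; rewrite coordE.
have xQ : x 0 mu ^+ 2 + Q = enorm x ^+ 2 by rewrite enorm_sqr (bigD1 mu).
have -> : (fun s => (\prod_nu (x + s *: delta_mx 0 mu) 0 nu ^+ al nu)
              * enorm (x + s *: delta_mx 0 mu) `^ r)
   = (fun s : R => (x 0 mu + s) ^+ al mu * C * ((x 0 mu + s) ^+ 2 + Q) `^ (2^-1 * r)).
  apply/funext => s; rewrite normE (bigD1 mu) //= coordmu; congr (_ * _ * _).
  by apply: eq_bigr => nu nm; rewrite coordE.
have e0 := enorm_gt0 x0.
have q0 : 0 < (x 0 mu + 0) ^+ 2 + Q by rewrite addr0 xQ exprn_gt0.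
have Dx : is_derive (0 : R) (1 : R) (fun s : R => x 0 mu + s) 1.
  have := is_deriveD (is_derive_cst (x 0 mu) (0 : R) (1 : R)) (is_derive_id (0 : R) (1 : R)).
  by rewrite add0r.
have DX n : is_derive (0 : R) (1 : R) (fun s : R => (x 0 mu + s) ^+ n)
    (n%:R * x 0 mu ^+ n.-1).
  have -> : (fun s : R => (x 0 mu + s) ^+ n) = (fun s : R => x 0 mu + s) ^+ n.
    by apply/funext => s; rewrite fctE.
  have := is_deriveX n Dx; rewrite addr0 => DXn.
  by apply: (is_derive_eq DXn); rewrite /GRing.scale /= mulr1.
have Dq : is_derive (0 : R) (1 : R) (fun s : R => (x 0 mu + s) ^+ 2 + Q) (2 * x 0 mu).
  have := is_deriveD (DX 2%N) (is_derive_cst Q (0 : R) (1 : R)).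
  by rewrite addr0 /= expr1.
have Dp := @is_derive1_comp R (fun y : R => y `^ (2^-1 * r)) (fun s : R => (x 0 mu + s) ^+ 2 + Q)
  0 _ _ (is_derive1_powR (2^-1 * r) q0) Dq.
have DC := is_deriveM (DX (al mu)) (is_derive_cst C (0 : R) (1 : R)).
apply: (is_derive_eq (is_deriveM DC Dp)).
rewrite /dmono /GRing.scale /= mulrfctE /cst !addr0 xQ.
have sqE t : (enorm x ^+ 2) `^ t = enorm x `^ (2 * t).
  by rewrite -powR_mulrn ?ltW // -powRrM.
rewrite !sqE.
have -> : 2 * (2^-1 * r - 1) = r - 2 by field.
have -> : 2 * (2^-1 * r) = r by field.
rewrite (bigD1 mu) //= [X in _ = _ + _ * (X * _)](bigD1 mu) //= !ffunE eqxx.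
rewrite subn1 addn1 exprS.
rewrite (eq_bigr (fun nu => x 0 nu ^+ al nu)); last first.
  by move=> nu /negPf nm; rewrite ffunE nm subn0.
rewrite [X in _ = _ + _ * (_ * X * _)](eq_bigr (fun nu => x 0 nu ^+ al nu)); last first.
  by move=> nu /negPf nm; rewrite ffunE nm addn0.
rewrite -/C; have two0 : 2 != 0 :> R by rewrite pnatr_eq0.
by field.
Qed.

Lemma mono_sphere (al : mindex d) (r : R) x : x != 0 ->
  \sum_nu (\prod_i x 0 i ^+ mincr nu (mincr nu al) i) * enorm x `^ r
  = (\prod_i x 0 i ^+ al i) * enorm x `^ (r + 2).
Proof.
move=> x0; apply: (@complexI R); rewrite rmorph_sum /=.
have := smono_sphere al r (1 : R[i]^o) => /(congr1 (fun p => spoly_eval p x)).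
rewrite spoly_eval_sum // spoly_eval_smono //.
rewrite {1}/GRing.scale /= mulr1 => <-; apply: eq_bigr => nu _.
by rewrite spoly_eval_smono // /GRing.scale /= mulr1.
Qed.

(** Both sides differentiate the same function, by [mono_sphere]. *)
Lemma dmono_sphere mu (al : mindex d) (r : R) x : x != 0 ->
  \sum_nu dmono mu (mincr nu (mincr nu al)) r x = dmono mu al (r + 2) x.
Proof.
move=> x0; have D1 := is_derive_dmono mu al (r + 2) x0.
have D2 : is_derive (0 : R) (1 : R) (\sum_nu (fun s =>
     (\prod_i (x + s *: delta_mx 0 mu) 0 i ^+ mincr nu (mincr nu al) i)
     * enorm (x + s *: delta_mx 0 mu) `^ r))
   (\sum_nu dmono mu (mincr nu (mincr nu al)) r x).
  by apply: is_derive_sum => nu; exact: is_derive_dmono.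
have [_ <-] := D1; have [_ <-] := D2; apply: near_eq_derive.
apply: filterS (shift_neq0 mu x0) => s xs.
by rewrite -mono_sphere // fct_sumE.
Qed.

Section DerivAdditive.
Variables (H : lmodType R[i]) (mu : 'I_d).

Lemma spoly_eval_deriv_smono (al : mindex d) (r : R) (h : H) x : x != 0 ->
  spoly_eval (spoly_deriv mu (smono al r h)) x = (dmono mu al r x)%:C *: h.
Proof.
move=> x0; rewrite spoly_deriv_smono spoly_evalD // !spoly_eval_smono // !scalerA.
rewrite -scalerDl -(rmorph_nat (real_complex R)) -!rmorphM -rmorphD /dmono.
by congr (_%:C *: _); ring.
Qed.

Let op (al : mindex d) (r : R) (h : H) : spoly d H :=
  smono (mdecr mu al) r ((al mu)%:R *: h) + smono (mincr mu al) (r - 2) (r%:C *: h).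

Let opD al r : {morph op al r : h h' / h + h'}.
Proof. by move=> h h'; rewrite /op !scalerDr !smonoD addrACA. Qed.

(* The formal derivative respects the relation because the derivatives of the
   values do and values determine polynomials. *)
Let op_sphere al r h : \sum_nu op (mincr nu (mincr nu al)) r h = op al (r + 2) h.
Proof.
apply/eqP; rewrite -subr_eq0; apply/eqP/(spoly_eval_inj mu) => y y0.
rewrite spoly_evalD // spoly_evalN // spoly_eval_sum //.
under eq_bigr do rewrite /op -spoly_deriv_smono spoly_eval_deriv_smono //.
rewrite /op -spoly_deriv_smono spoly_eval_deriv_smono //.
by rewrite -scaler_suml -rmorph_sum dmono_sphere // subrr.
Qed.

Lemma spoly_derivD (p q : spoly d H) :
  spoly_deriv mu (p + q) = spoly_deriv mu p + spoly_deriv mu q.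
Proof. exact: (sliftD opD op_sphere). Qed.

Lemma spoly_deriv0 : spoly_deriv mu (0 : spoly d H) = 0.
Proof. exact: (slift0 opD op_sphere). Qed.

Lemma mdeg_mincr (al : mindex d) : mdeg (mincr mu al) = (mdeg al).+1.
Proof.
rewrite /mdeg (bigD1 mu) //= ffunE eqxx addn1 [in RHS](bigD1 mu) //=.
by congr (_ + _).+1%N; apply: eq_bigr => nu /negPf nm; rewrite ffunE nm addn0.
Qed.

Lemma mincr_mdecr (al : mindex d) : (0 < al mu)%N -> mincr mu (mdecr mu al) = al.
Proof.
move=> al0; apply/ffunP => nu; rewrite !ffunE.
by case: eqP => [->|_]; [rewrite subnK|rewrite subn0 addn0].
Qed.

Lemma mdecr_mincr (al : mindex d) : mdecr mu (mincr mu al) = al.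
Proof. by apply/ffunP => nu; rewrite !ffunE addnK. Qed.

Lemma scales_deriv la (p : spoly d H) : homogeneous (la + 1) p ->
  scales la (spoly_deriv mu p).
Proof.
move: p; apply: homogeneous_ind => [|al h|p q].
- by rewrite spoly_deriv0; exact: scales0.
- rewrite spoly_deriv_smono; apply: scalesD; last first.
    by apply: scales_smono; rewrite mdeg_mincr -natr1; ring.
  have [->|al0] := posnP (al mu); first by rewrite scale0r smono0; exact: scales0.
  by apply: scales_smono; rewrite -[in X in la + 1 - X](mincr_mdecr al0) mdeg_mincr -natr1; ring.
- by rewrite spoly_derivD; exact: scalesD.
Qed.

(** By [spoly_derivD] it is enough to compute on monomials. *)
Lemma spoly_eval_deriv (u : H -> R[i]^o) (p : spoly d H) x :
  is_clinear u -> x != 0 ->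
  has_cderiv (fun s => u (spoly_eval p (x + s *: delta_mx 0 mu))) 0
    (u (spoly_eval (spoly_deriv mu p) x)).
Proof.
move=> ul x0; elim/spoly_ind: p => [|al r h|p q IHp IHq].
- rewrite spoly_deriv0 spoly_eval0 // (clinear0 ul).
  apply: (has_cderiv_near (f := fun=> 0) _ (has_cderiv0 _)).
  apply: filterS (shift_neq0 mu x0) => s xs.
  by rewrite spoly_eval0 // (clinear0 ul).
- rewrite spoly_eval_deriv_smono // (clinearZ ul).
  apply: (has_cderiv_near (f := fun s => ((\prod_nu (x + s *: delta_mx 0 mu) 0 nu ^+ al nu)
              * enorm (x + s *: delta_mx 0 mu) `^ r)%:C * u h)).
    by apply: filterS (shift_neq0 mu x0) => s xs; rewrite spoly_eval_smono // (clinearZ ul).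
  exact: has_cderivZ (is_derive_dmono mu al r x0).
- rewrite spoly_derivD spoly_evalD // (clinearD ul).
  apply: (has_cderiv_near _ (has_cderivD IHp IHq)).
  by apply: filterS (shift_neq0 mu x0) => s xs; rewrite spoly_evalD // (clinearD ul).
Qed.
End DerivAdditive.
End Derivatives.
(** * Compact modules: weights, functionals, the completion *)

Section CompactModule.
Variables (R : realType) (d : nat) (H : lmodType R[i]).
Variable act : so R d -> H -> H.
Hypothesis cm : compact_module act.
Implicit Types (a b h : H) (De : R).

Lemma act_clinear X : is_clinear (act X).
Proof. by move=> c a b; exact: (so_module_linr cm). Qed.

Lemma actD X Z a : act (X + Z) a = act X a + act Z a.
Proof. by have := so_module_linl cm 1 X Z a; rewrite !scale1r. Qed.

Lemma act0 a : act 0 a = 0.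
Proof. by apply: (addrI (act 0 a)); rewrite -actD !addr0. Qed.

Lemma actZ r X a : act (r *: X) a = r%:C *: act X a.
Proof. by have := so_module_linl cm r X 0 a; rewrite act0 !addr0. Qed.

Lemma act_sum (I : Type) (s : seq I) (P : pred I) (g : I -> so R d) a :
  act (\sum_(i <- s | P i) g i) a = \sum_(i <- s | P i) act (g i) a.
Proof. by apply: (big_morph (act^~ a)) => [X Z|]; [exact: actD|exact: act0]. Qed.

Lemma wt0 De : wt act De 0.
Proof. by rewrite /wt /= scaler0 (clinear0 (act_clinear _)). Qed.

Lemma wtP De c a b : wt act De a -> wt act De b -> wt act De (c *: a + b).
Proof.
by rewrite /wt /= act_clinear => -> ->; rewrite scalerDr !scalerA mulrC.
Qed.

Lemma wtD De a b : wt act De a -> wt act De b -> wt act De (a + b).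
Proof. by move=> wa wb; have := wtP 1 wa wb; rewrite scale1r. Qed.

Lemma wtZ De c a : wt act De a -> wt act De (c *: a).
Proof. by move=> wa; have := wtP c wa (wt0 De); rewrite addr0. Qed.

Lemma decompP a : is_decomp act a (decomp act a).
Proof. by have [c [ca _]] := compact_C1 cm a; exact: (xgetPex _ (ex_intro _ c ca)). Qed.

Lemma decomp_uniq a c : is_decomp act a c -> decomp act a = c.
Proof.
have [c0 [_ c0u]] := compact_C1 cm a.
by move=> /c0u <-; rewrite -(c0u _ (decompP a)).
Qed.

Lemma pr_wt De a : wt act De (pr act De a).
Proof. by have [] := decompP a. Qed.

Lemma pr_fin a : finite_set [set De | pr act De a != 0].
Proof. by have [] := decompP a. Qed.

Lemma pr_sum a : a = \sum_(De \in [set: R]) pr act De a.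
Proof. by have [] := decompP a. Qed.

Lemma pr_clinear De : is_clinear (pr act De).
Proof.
move=> c a b; pose f De' := c *: pr act De' a + pr act De' b.
suff dec : is_decomp act (c *: a + b) f by rewrite /pr (decomp_uniq dec).
split=> [De'||].
- by apply: wtP; exact: pr_wt.
- apply: (sub_finite_set (B := [set De | pr act De a != 0] `|` [set De | pr act De b != 0])).
    move=> De' /= fn; have [E|] := eqVneq (pr act De' a) 0; last by left.
    by right; apply: contraNneq fn => E'; rewrite /f E E' scaler0 addr0.
  by rewrite finite_setU; split; exact: pr_fin.
pose A := [set De | pr act De a != 0] `|` [set De | pr act De b != 0].
have Af : finite_set A by rewrite finite_setU; split; exact: pr_fin.
have out De' : ~ A De' -> pr act De' a = 0 /\ pr act De' b = 0.
  by move=> nA; split; apply/eqP; apply: contra_notT nA => nz; [left|right].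
rewrite [in LHS](pr_sum a) [in LHS](pr_sum b).
rewrite !(fsumT_widen Af) => [|k /out[ka kb]|k /out[] //|k /out[] //].
  by rewrite scaler_sumr -big_split.
by rewrite /f ka kb scaler0 addr0.
Qed.

Lemma pr_of_wt De De' a : wt act De a -> pr act De' a = if De' == De then a else 0.
Proof.
move=> wa; pose f De' := if De' == De then a else 0.
suff dec : is_decomp act a f by rewrite /pr (decomp_uniq dec).
split=> [De1||].
- by rewrite /f; case: eqP => [->|_] //; exact: wt0.
- apply: (sub_finite_set (B := [set De])) => // De1 /=; rewrite /f.
  by case: (eqVneq De1 De) => // _; rewrite eqxx.
rewrite (@fsumT_widen _ _ _ [set De]) ?fset_set1 ?big_seq_fset1 /f ?eqxx //.
by move=> k; case: eqP => // ->.
Qed.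

Lemma pr_id De a : wt act De a -> pr act De a = a.
Proof. by move=> /pr_of_wt ->; rewrite eqxx. Qed.

Lemma wt_ind (P : H -> Prop) : P 0 -> (forall De a, wt act De a -> P a) ->
  (forall a b, P a -> P b -> P (a + b)) -> forall a, P a.
Proof.
move=> P0 Pw PD a; rewrite (pr_sum a) (fsumT_widen (pr_fin a)); last first.
  by move=> k /negP/negPn/eqP.
by elim/big_ind: _ => // De _; apply: Pw (pr_wt _ _).
Qed.

Definition independent n (v : 'I_n -> H) :=
  forall c : 'I_n -> R[i], \sum_i c i *: v i = 0 -> forall i, c i = 0.

(** Finiteness of the sum of the dimensions up to [De] bounds each of them. *)
Lemma wt_dim_bound De : exists N, forall n (v : 'I_n -> H),
  (forall i, wt act De (v i)) -> independent v -> (n <= N)%N.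
Proof.
have le : (vdim (wt act De) <= \esum_(D in [set D : R | (D <= De)%R]) vdim (wt act D))%E.
  apply: esum_ge; exists [set De]; last by rewrite fsbig_set1.
  by split=> [|D /= ->].
have := le_lt_trans le (compact_C2 cm De).
have ub n (v : 'I_n -> H) : (forall i, wt act De (v i)) -> independent v ->
    (n%:R%:E <= vdim (wt act De))%E.
  by move=> vw vi; apply: ereal_sup_ubound => /=; exists n => //; exists v.
case: (vdim _) ub => [r|//|] ub _; last first.
  exists 0%N => n v vw vi; have := ub n v vw vi.
  by rewrite leeNy_eq.
exists (Num.truncn r).+1 => n v vw vi; have := ub n v vw vi; rewrite lee_fin => nr.
by rewrite -(ler_nat R) (le_trans nr) // ltW // truncnS_gt.
Qed.

(** The functional is the coordinate along [h] in a maximal independent family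
    of the finite-dimensional space [wt De] that begins with [h]. *)
Lemma wt_functional De h : wt act De h -> h != 0 ->
  exists2 l : H -> R[i]^o, is_clinear l & in_dual_wt act De l /\ l h != 0.
Proof.
move=> wh h0.
pose Q n := exists v : 'I_n -> H, (forall i, wt act De (v i)) /\
  (forall (c0 : R[i]) (c : 'I_n -> R[i]), c0 *: h + \sum_i c i *: v i = 0 ->
     c0 = 0 /\ forall i, c i = 0).
have Q0 : Q 0%N.
  exists (fun=> 0); split=> [i|c0 c]; first exact: wt0.
  rewrite big_ord0 addr0 => /eqP; rewrite scaler_eq0 (negPf h0) orbF => /eqP.
  by split=> // -[].
have [N boundN] := wt_dim_bound De.
have [n [[v [vw vi]] nmax]] : exists n, Q n /\ ~ Q n.+1.
  apply: contrapT => noQ; have Qall n : Q n.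
    elim: n => // n Qn; apply: contrapT => nQ; apply: noQ; by exists n.
  have [v [vw vi]] := Qall N.+1.
  suff : (N.+1 <= N)%N by rewrite ltnn.
  apply: (boundN _ v) => // c c0; apply: (vi 0 c _).2.
  by rewrite scale0r add0r.
have spans a : wt act De a -> exists c0 (c : 'I_n -> R[i]), a = c0 *: h + \sum_i c i *: v i.
  move=> wa; apply: contrapT => nspan; apply: nmax.
  exists (fun i => if unlift ord0 i is Some j then v j else a); split=> [i|c0 c].
    by case: (unlift ord0 i).
  rewrite big_ord_recl /= unlift_none.
  under eq_bigr do rewrite liftK.
  have [c00|cz] := eqVneq (c ord0) 0.
    rewrite c00 scale0r add0r => /vi[-> ci]; split=> // i.
    by case: (unliftP ord0 i) => [j ->|->].
  move=> E; exfalso; apply: nspan.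
  exists (- (c ord0)^-1 * c0), (fun i => - (c ord0)^-1 * c (lift ord0 i)).
  under eq_bigr do rewrite -scalerA.
  rewrite -scaler_sumr -scalerA -scalerDr.
  have -> : c0 *: h + \sum_(i < n) c (lift ord0 i) *: v i = - (c ord0 *: a).
    by apply/eqP; rewrite -addr_eq0 addrAC -addrA; apply/eqP.
  by rewrite scalerN scaleNr opprK scalerA mulVf // scale1r.
pose coords a (c0 : R[i]) := exists c : 'I_n -> R[i], pr act De a = c0 *: h + \sum_i c i *: v i.
have ex a : exists c0, coords a c0 by have [c0 [c E]] := spans _ (pr_wt De a); exists c0, c.
have uniq_coords a c0 c0' : coords a c0 -> coords a c0' -> c0 = c0'.
  move=> [c E0] [c' E]; apply/eqP; rewrite -subr_eq0; apply/eqP.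
  apply: (vi (c0 - c0') (fun i => c i - c' i) _).1.
  rewrite scalerBl; under eq_bigr do rewrite scalerBl.
  by rewrite sumrB addrACA -opprD -E -E0 subrr.
pose l a := xget 0 (coords a).
have lP a : coords a (l a) by have [c0 Hc] := ex a; exact: (xgetPex _ (ex_intro _ c0 Hc)).
exists (l : H -> R[i]^o); [move=> c a b|split].
- apply: uniq_coords (lP _) _; have [ca Ea] := lP a; have [cb Eb] := lP b.
  exists (fun i => c * ca i + cb i); rewrite pr_clinear Ea Eb.
  under [in RHS]eq_bigr do rewrite scalerDl -scalerA.
  by rewrite big_split /= -scaler_sumr scalerDl -scalerA addrACA scalerDr.
- move=> De' a De'De wa; apply: uniq_coords (lP _) _.
  exists (fun=> 0); rewrite (pr_of_wt _ wa) eq_sym (negPf De'De) scale0r add0r.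
  by rewrite big1 // => i _; rewrite scale0r.
- suff -> : l h = 1 by rewrite oner_neq0.
  apply: uniq_coords (lP _) _; exists (fun=> 0); rewrite pr_id // scale1r.
  by rewrite big1 ?addr0 // => i _; rewrite scale0r.
Qed.

Lemma dual_wt_pr De (u : H -> R[i]^o) a : is_clinear u -> in_dual_wt act De u ->
  u a = u (pr act De a).
Proof.
move=> ul ud; rewrite {1}(pr_sum a).
rewrite (@fsumT_widen _ _ _ ([set De' | pr act De' a != 0] `|` [set De])); first last.
- by move=> k nk; apply/eqP; apply: contra_notT nk => ?; left.
- by rewrite finite_setU; split; [exact: pr_fin|exact: finite_set1].
rewrite (clinear_sum ul) (bigD1_seq De) ?fset_uniq //=; last first.
  rewrite in_fset_set ?inE; first by right.
  by rewrite finite_setU; split; [exact: pr_fin|exact: finite_set1].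
by rewrite big1 ?addr0 // => De' De'De; apply: (ud De') => //; exact: pr_wt.
Qed.

Definition functional_of (l : H -> R[i]^o) (ll : is_clinear l) : {linear H -> R[i]^o} :=
  HB.pack l (GRing.isLinear.Build _ _ _ _ l ll).

Lemma separates h :
  (forall De (u : {linear H -> R[i]^o}), in_dual_wt act De u -> u h = 0) -> h = 0.
Proof.
move=> uh0; rewrite (pr_sum h) fsbig1 // => De _; apply/eqP; apply: contrapT => /negP hDe.
have [l ll [ld lh]] := wt_functional (pr_wt De h) hDe.
by move/eqP : lh; apply; rewrite -(dual_wt_pr _ ll ld); exact: (uh0 De (functional_of ll)).
Qed.

Definition weights (u : H -> R[i]) : set R := [set De | exists2 a, wt act De a & u a != 0].

Lemma dual_wt_Hvee De (u : H -> R[i]) : in_dual_wt act De u -> in_Hvee act u.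
Proof.
move=> ud; apply: (sub_finite_set (B := [set De])) => // De' /= [a wa].
by apply: contraNeq => De'De; rewrite (ud De') //; apply/eqP.
Qed.

Lemma weights_out u De a : ~ weights u De -> wt act De a -> u a = 0.
Proof. by move=> nw wa; apply/eqP; apply: contra_notT nw => ua; exists a. Qed.

Lemma pr_dual (u : H -> R[i]^o) De : is_clinear u -> in_dual_wt act De (u \o pr act De).
Proof.
move=> ul De' a De'De wa; rewrite /= (pr_of_wt _ wa) eq_sym (negPf De'De).
exact: (clinear0 ul).
Qed.

Lemma comp_clinear (f : H -> H) (u : H -> R[i]^o) : is_clinear f -> is_clinear u ->
  is_clinear (u \o f).
Proof. by move=> fl ul c a b; rewrite /= fl ul. Qed.

(** This turns statements about the restricted dual into statements about
    functionals of a single weight. *)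
Lemma Hvee_pr (u : H -> R[i]^o) a : is_clinear u -> in_Hvee act u ->
  u a = \sum_(De <- fset_set (weights u)) u (pr act De a).
Proof.
move=> ul uv; pose A := [set De | pr act De a != 0] `|` weights u.
have Af : finite_set A by rewrite finite_setU; split; [exact: pr_fin|exact: uv].
rewrite {1}(pr_sum a) (fsumT_widen Af); last first.
  by move=> k nk; apply/eqP; apply: contra_notT nk => ?; left.
rewrite (clinear_sum ul) -(@fsumT_widen _ _ (fun De => u (pr act De a))) //; last first.
  by move=> De nA; apply: (weights_out _ (pr_wt _ _)) => wD; apply: nA; right.
rewrite -(@fsumT_widen _ _ (fun De => u (pr act De a))) // => De nw.
exact: (weights_out nw (pr_wt _ _)).
Qed.

Lemma pairing_Hvee (u : H -> R[i]) (f : R -> H) : in_Hvee act u -> in_Hbar act f ->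
  pairing u f = \sum_(De <- fset_set (weights u)) u (f De).
Proof.
by move=> uv fb; apply: fsumT_widen => // De nw; exact: weights_out (fb De).
Qed.

Lemma in_HbarP c (f g : R -> H) : in_Hbar act f -> in_Hbar act g -> in_Hbar act (c *: f + g).
Proof. by move=> fb gb De; exact: wtP. Qed.

Lemma pairing_clinear c (u : H -> R[i]^o) (f g : R -> H) : is_clinear u -> in_Hvee act u ->
  in_Hbar act f -> in_Hbar act g ->
  pairing u (c *: f + g) = c * pairing u f + pairing u g.
Proof.
move=> ul uv fb gb; rewrite !pairing_Hvee //; last exact: in_HbarP.
rewrite mulr_sumr -big_split; apply: eq_bigr => De _.
by rewrite !fctE ul.
Qed.

Lemma pairing_dual De (u : H -> R[i]^o) (f : R -> H) : is_clinear u ->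
  in_dual_wt act De u -> in_Hbar act f -> pairing u f = u (f De).
Proof.
move=> ul ud fb; rewrite /pairing (@fsumT_widen _ _ _ [set De]) //.
  by rewrite fset_set1 big_seq_fset1.
by move=> De' De'De; apply: (ud De'); [apply/eqP|exact: fb].
Qed.

Lemma pairing_decomp (u : H -> R[i]^o) a : is_clinear u -> in_Hvee act u ->
  pairing u (decomp act a) = u a.
Proof.
move=> ul uv; rewrite pairing_Hvee //; last by move=> De; exact: pr_wt.
by rewrite [RHS]Hvee_pr.
Qed.

(** The eigenvalue of [ad D], by which a basis vector shifts weights *)
Definition ad_weight (g : so_idx d) : R :=
  match g with
  | inl (inl (inr _)) => 1
  | inl (inr _) => - 1
  | _ => 0
  end.

Lemma so_br_D_basis g : so_br (soD R d) (so_basis R g) = ad_weight g *: so_basis R g.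
Proof.
rewrite so_br_basisE (bigD1 g) //= big1 => [|h /negPf hg]; last by rewrite ffunE hg scale0r.
rewrite ffunE eqxx scale1r addr0.
by case: g => [[[[]|mu]|mu]|p]; rewrite /= ?scale0r ?scale1r ?scaleN1r.
Qed.

Lemma act_basis_wt De g a : wt act De a -> wt act (De + ad_weight g) (act (so_basis R g) a).
Proof.
move=> wa; have := so_module_br cm (soD R d) (so_basis R g) a.
rewrite so_br_D_basis actZ wa clinearZ; last exact: act_clinear.
move=> /eqP; rewrite eq_sym subr_eq addrC -scalerDl -rmorphD => /eqP.
by rewrite /wt /= => ->; rewrite addrC.
Qed.

Lemma act_basis_sum X a : act X a = \sum_g (X g)%:C *: act (so_basis R g) a.
Proof.
under eq_bigr do rewrite -actZ.
rewrite -act_sum; congr act; apply/ffunP => h; rewrite sum_ffunE (bigD1 h) //= !ffunE eqxx.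
rewrite big1 ?addr0 => [|g gh]; first by rewrite /GRing.scale /= mulr1.
by rewrite !ffunE eq_sym (negPf gh) scaler0.
Qed.

(** The weights from which some basis vector of the Lie algebra leads to a weight
    of [u]. The set is finite, which makes the completed action and its transpose
    finite sums below. *)
Definition weights_reaching (u : H -> R[i]) : set R :=
  \bigcup_(g in [set: so_idx d]) ((fun De => De - ad_weight g) @` weights u).

Lemma weights_reaching_fin u : in_Hvee act u -> finite_set (weights_reaching u).
Proof.
move=> uv; apply: bigcup_finite => [|g _]; first exact: finite_finset.
exact: finite_image.
Qed.

Lemma pr_act_out u De De' X a : weights u De -> ~ weights_reaching u De' ->
  wt act De' a -> pr act De (act X a) = 0.
Proof.
move=> wD nD' wa; rewrite act_basis_sum (clinear_sum (pr_clinear _)) big1 // => g _.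
rewrite (clinearZ (pr_clinear _)) (pr_of_wt _ (act_basis_wt g wa)).
case: eqP => [E|_]; last by rewrite scaler0.
by case: nD'; exists g => //=; exists De => //; rewrite E addrK.
Qed.

Lemma act_weights_out (u : H -> R[i]^o) De X a : is_clinear u -> in_Hvee act u ->
  ~ weights_reaching u De -> wt act De a -> u (act X a) = 0.
Proof.
move=> ul uv nD wa; rewrite (Hvee_pr _ ul uv) big_seq big1 // => De'.
rewrite in_fset_set // inE => wD'.
by rewrite (pr_act_out _ wD' nD wa) (clinear0 ul).
Qed.

Lemma Hvee_act (u : H -> R[i]^o) X : is_clinear u -> in_Hvee act u ->
  in_Hvee act (u \o act X).
Proof.
move=> ul uv; apply: (sub_finite_set _ (weights_reaching_fin uv)) => De /= [a wa ua].
apply: contrapT => nD; move/eqP: ua; apply.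
exact: act_weights_out ul uv nD wa.
Qed.

(** Both sides are finite sums over the weights of [u] and the weights reaching
    them, taken in the two orders. *)
Lemma pairing_act (u : H -> R[i]^o) X (f : R -> H) : is_clinear u -> in_Hvee act u ->
  in_Hbar act f -> pairing u (act_Hbar act X f) = pairing (u \o act X) f.
Proof.
move=> ul uv fb; rewrite pairing_Hvee //; last first.
  move=> De; rewrite /act_Hbar; elim/big_ind: _ => [|v w|De' _].
  - exact: wt0.
  - exact: wtD.
  - exact: pr_wt.
rewrite /pairing (fsumT_widen (weights_reaching_fin uv)); last first.
  by move=> De nD; exact: act_weights_out ul uv nD (fb De).
under [RHS]eq_bigr do rewrite /= (Hvee_pr _ ul uv).
rewrite [RHS]exchange_big /= big_seq [RHS]big_seq; apply: eq_bigr => De.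
rewrite in_fset_set // inE => wD; rewrite -(clinear_sum ul); congr u.
by apply: fsumT_widen (weights_reaching_fin uv) _ => De' nD'; exact: pr_act_out wD nD' (fb De').
Qed.
End CompactModule.
(** * Spherical series seen through functionals *)

Section SeriesValues.
Variables (R : realType) (d : nat) (H : lmodType R[i]).
Implicit Types (F G : sseries d H) (x : 'rV[R]_d).

Lemma sseries_eval_map (H' : lmodType R[i]) (f : H -> H') F x : is_clinear f -> x != 0 ->
  sseries_eval (sseries_map f F) x = \sum_(la \in [set: R]) f (spoly_eval (F la) x).
Proof.
by move=> fl x0; apply: eq_fsbigr => la _; rewrite /sseries_map spoly_eval_map.
Qed.

(** A finite bound, uniform in the point, for the degrees that contribute to
    the values of [f o F]. *)
Definition degrees_in (H' : lmodType R[i]) (f : H -> H') F (A : set R) :=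
  finite_set A /\ forall la x, ~ A la -> x != 0 -> f (spoly_eval (F la) x) = 0.

Lemma degrees_inU (H' : lmodType R[i]) (f : H -> H') F A B :
  degrees_in f F A -> finite_set B -> degrees_in f F (A `|` B).
Proof.
move=> [Af out] Bf; split; first by rewrite finite_setU.
by move=> la x nAB; apply: out => Ala; apply: nAB; left.
Qed.

Lemma value_degrees (H' : lmodType R[i]) (f : H -> H') F A x : is_clinear f ->
  degrees_in f F A -> x != 0 ->
  sseries_eval (sseries_map f F) x = \sum_(la <- fset_set A) f (spoly_eval (F la) x).
Proof.
move=> fl [Af out] x0; rewrite sseries_eval_map //; apply: fsumT_widen => // la nA.
exact: out.
Qed.

(** Real powers are distinct characters of the multiplicative group of positive
    numbers. *)
Lemma real_powers_free (V : lmodType R[i]) (s : seq R) (h : R -> V) : uniq s ->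
  (forall t, 0 < t -> \sum_(la <- s) (t `^ la)%:C *: h la = 0) ->
  forall la, la \in s -> h la = 0.
Proof.
move=> us sum0; apply: (characters_free (M := [set t : R | 0 < t]) (mul := *%R)
  (chi := fun la t => (t `^ la)%:C)) => //.
- by exists 1; exact: ltr01.
- by move=> x y; exact: mulr_gt0.
- by move=> la x y x0 y0; rewrite powRM ?ltW // rmorphM.
- by move=> la x x0; rewrite fmorph_eq0 gt_eqF // powR_gt0.
move=> la mu _ _ lamu; exists 2 => /=; first by [].
rewrite (inj_eq (@complexI R)); apply: contra_neq lamu => /(congr1 (@ln R)).
by rewrite !ln_powR; apply: mulIf; rewrite gt_eqF // ln_gt0 // ltr1n.
Qed.

Variable act : so R d -> H -> H.
Hypothesis cm : compact_module act.
Variable i0 : 'I_d.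

(** Scaling [x] separates the degrees, functionals separate the coefficients
    and points separate the polynomials: identities of series may be checked on
    matrix elements. *)
Lemma sseries_ext F G : (forall la, scales la (F la)) -> (forall la, scales la (G la)) ->
  (forall De (u : {linear H -> R[i]^o}), in_dual_wt act De u ->
     [/\ exists A, degrees_in u F A, exists A, degrees_in u G A
       & forall x, x != 0 ->
           sseries_eval (sseries_map u F) x = sseries_eval (sseries_map u G) x]) ->
  F = G.
Proof.
move=> Fh Gh FG; apply/funext => la; apply/eqP; rewrite -subr_eq0; apply/eqP.
apply: (spoly_eval_inj i0) => x x0; apply: (separates cm) => De u ud.
have ul := linear_clinear u.
have [[A FA] [B GB] FGu] := FG De u ud.
have FAB := degrees_inU FA GB.1; have := degrees_inU GB FA.1; rewrite setUC => GAB.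
pose h la : R[i]^o := u (spoly_eval (F la - G la) x).
have hE la' y : y != 0 ->
    u (spoly_eval (F la' - G la') y) = u (spoly_eval (F la') y) - u (spoly_eval (G la') y).
  by move=> y0; rewrite spoly_evalD // spoly_evalN // linearB.
suff h0 la' : la' \in fset_set (A `|` B) -> h la' = 0.
  have [ABla|nAB] := pselect ((A `|` B) la).
    by apply: h0; rewrite in_fset_set ?inE //; exact: FAB.1.
  by rewrite hE // FAB.2 // GAB.2 // subrr.
apply: (real_powers_free (fset_uniq _)) => {la'} t t0.
have tx0 := scale_neq0 t0 x0.
rewrite -[RHS](subrr (sseries_eval (sseries_map u F) (t *: x))) {2}FGu //.
rewrite (value_degrees ul FAB) // (value_degrees ul GAB) // -sumrB.
apply: eq_bigr => la' _; rewrite -hE //.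
have -> : spoly_eval (F la' - G la') (t *: x) = (t `^ la')%:C *: spoly_eval (F la' - G la') x.
  by apply: scalesD; [exact: Fh|apply: scalesN; exact: Gh|done|done].
by rewrite linearZ.
Qed.
End SeriesValues.

Section HasValue.
Variables (R : realType) (d : nat) (H : lmodType R[i]).
Variable u : {linear H -> R[i]^o}.
Implicit Types (F G : sseries d H) (v w : 'rV[R]_d -> R[i]).
Let ul := linear_clinear u.

Lemma functionalZ c a : u (c *: a) = c * u a.
Proof. exact: linearZ. Qed.

Definition value_in A F v :=
  degrees_in u F A /\
  forall x, x != 0 -> sseries_eval (sseries_map u F) x = v x.

Lemma value_in0 v : (forall x, x != 0 -> v x = 0) -> value_in set0 0 v.
Proof.
move=> v0; have deg : degrees_in u (0 : sseries d H) set0.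
  by split=> [|la x _ x0]; [exact: finite_set0|rewrite spoly_eval0 // (clinear0 ul)].
by split=> // x x0; rewrite (value_degrees ul deg) // fset_set0 big_seq_fset0 v0.
Qed.

Lemma value_inD A B F G v w : value_in A F v -> value_in B G w ->
  value_in (A `|` B) (F + G) (fun x => v x + w x).
Proof.
move=> [dA vF] [dB wG].
have dF := degrees_inU dA dB.1; have := degrees_inU dB dA.1; rewrite setUC => dG.
have dFG : degrees_in u (F + G) (A `|` B).
  split=> [|la x nAB x0]; first exact: dF.1.
  by rewrite fctE spoly_evalD // linearD dF.2 // dG.2 // addr0.
split=> // x x0; rewrite -vF // -wG // (value_degrees ul dFG) // (value_degrees ul dF) //.
rewrite (value_degrees ul dG) // -big_split; apply: eq_bigr => la _.
by rewrite fctE spoly_evalD // linearD.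
Qed.

(** The values of a series, seen through [u], together with the finiteness that
    makes them additive *)
Definition has_value F v := exists A, value_in A F v.

Lemma has_valueE F v w : (forall x, x != 0 -> v x = w x) -> has_value F v -> has_value F w.
Proof. by move=> vw [A [dF vF]]; exists A; split=> // x x0; rewrite vF // vw. Qed.

Lemma has_value0 : has_value 0 (fun=> 0).
Proof. by exists set0; exact: value_in0. Qed.

Lemma has_valueD F G v w : has_value F v -> has_value G w ->
  has_value (F + G) (fun x => v x + w x).
Proof. by move=> [A Fv] [B Gw]; exists (A `|` B); exact: value_inD. Qed.

Lemma has_valueZ c F v : has_value F v -> has_value (c *: F) (fun x => c * v x).
Proof.
move=> [A [dA vF]]; exists A.
have dF : degrees_in u (c *: F) A.
  split=> [|la x nA x0]; first exact: dA.1.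
  by rewrite scalrfctE spoly_evalZ // functionalZ dA.2 // mulr0.
split=> // x x0; rewrite -vF // (value_degrees ul dF) // (value_degrees ul dA) // mulr_sumr.
by apply: eq_bigr => la _; rewrite scalrfctE spoly_evalZ // functionalZ.
Qed.

Lemma has_valueN F v : has_value F v -> has_value (- F) (fun x => - v x).
Proof.
move=> Fv; rewrite -scaleN1r; apply: has_valueE (has_valueZ (-1) Fv) => x _.
by rewrite mulN1r.
Qed.

Lemma has_value_sum (I : Type) (s : seq I) (F : I -> sseries d H)
    (v : I -> 'rV[R]_d -> R[i]) :
  (forall i, has_value (F i) (v i)) ->
  has_value (\sum_(i <- s) F i) (fun x => \sum_(i <- s) v i x).
Proof.
move=> Fv; elim: s => [|i s IHs].
  by rewrite big_nil; apply: has_valueE has_value0 => x _; rewrite big_nil.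
rewrite big_cons; apply: has_valueE (has_valueD (Fv i) IHs) => x _.
by rewrite big_cons.
Qed.

Lemma degrees_shift F G c A : degrees_in u F A ->
  (forall la, (forall x, x != 0 -> u (spoly_eval (F (la + c)) x) = 0) ->
     forall x, x != 0 -> u (spoly_eval (G la) x) = 0) ->
  degrees_in u G ((fun la => la - c) @` A).
Proof.
move=> [Af out] FG; split=> [|la x nA x0]; first exact: finite_image.
apply: FG => // y y0; apply: out => // Alac; apply: nA.
by exists (la + c); rewrite ?addrK.
Qed.

(** Shifting all degrees permutes the terms of the sum. *)
Lemma value_shift F c x : x != 0 ->
  \sum_(la \in [set: R]) u (spoly_eval (F (la + c)) x) =
  \sum_(la \in [set: R]) u (spoly_eval (F la) x).
Proof.
move=> x0; rewrite [RHS](reindex_fsbigT (fun la => la + c)) //.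
by exists (fun la => la - c) => la; rewrite ?addrK ?subrK.
Qed.

Lemma has_value_mulX rho F v : has_value F v ->
  has_value (sseries_mulX rho F) (fun x => (x 0 rho)%:C * v x).
Proof.
move=> [A [dA vF]].
have mulE la x : x != 0 -> u (spoly_eval (sseries_mulX rho F la) x) =
    (x 0 rho)%:C * u (spoly_eval (F (la + -1)) x).
  by move=> x0; rewrite /sseries_mulX spoly_eval_mulX // functionalZ.
have dG : degrees_in u (sseries_mulX rho F) ((fun la => la - -1) @` A).
  apply: (degrees_shift dA) => la F0 x x0.
  by rewrite mulE // F0 // mulr0.
exists ((fun la => la - -1) @` A); split=> // x x0.
rewrite -vF // (value_degrees ul dG) // (sseries_eval_map F ul x0).
have <- := value_shift F (-1) x0; rewrite (fsumT_widen dG.1).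
  by rewrite mulr_sumr; apply: eq_bigr => la _; exact: mulE.
move=> la nA; apply: dA.2 => // Ala; apply: nA; exists (la + -1) => //.
by rewrite addrK.
Qed.

(** Only finitely many degrees contribute, so the derivative of the value is taken
    term by term. *)
Lemma has_value_deriv mu F v w : has_value F v ->
  (forall x, x != 0 -> has_cderiv (fun s => v (x + s *: delta_mx 0 mu)) 0 (w x)) ->
  has_value (sseries_deriv mu F) w.
Proof.
move=> [A [dA vF]] vw.
have dG : degrees_in u (sseries_deriv mu F) ((fun la => la - 1) @` A).
  apply: (degrees_shift dA) => la F0 x x0.
  apply: has_cderiv_unique (spoly_eval_deriv mu _ ul x0) _.
  apply: (has_cderiv_near (f := fun=> 0) _ (has_cderiv0 _)).
  by apply: filterS (shift_neq0 mu x0) => s xs; rewrite F0.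
exists ((fun la => la - 1) @` A); split=> // x x0.
apply: has_cderiv_unique _ (vw x x0).
rewrite (sseries_eval_map _ ul) //.
have := value_shift (fun la => spoly_deriv mu (F la)) 1 x0; rewrite /= => ->.
rewrite (fsumT_widen dA.1); last first.
  move=> la nA; apply: has_cderiv_unique (spoly_eval_deriv mu _ ul x0) _.
  apply: (has_cderiv_near (f := fun=> 0) _ (has_cderiv0 _)).
  by apply: filterS (shift_neq0 mu x0) => s xs; rewrite dA.2.
apply: (has_cderiv_near _ (has_cderiv_sum _ (fun la => spoly_eval_deriv mu (F la) ul x0))).
apply: filterS (shift_neq0 mu x0) => s xs.
by rewrite -vF // (value_degrees ul dA).
Qed.

Lemma has_value_map (f : H -> H) (uf : {linear H -> R[i]^o}) F v :
  is_clinear f -> (forall a, uf a = u (f a)) ->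
  (exists A, degrees_in uf F A /\
     forall x, x != 0 -> sseries_eval (sseries_map uf F) x = v x) ->
  has_value (sseries_map f F) v.
Proof.
move=> fl ufE [A [[Af out] vF]]; exists A; split=> [|x x0].
  by split=> // la x nA x0; rewrite spoly_eval_map // -ufE; exact: out.
rewrite -(vF x x0) (sseries_eval_map (sseries_map f F) ul x0).
rewrite (sseries_eval_map F (linear_clinear uf) x0).
by apply: eq_fsbigr => la _; rewrite spoly_eval_map // ufE.
Qed.
End HasValue.

(** * The vertex operator as a two-point function *)

Section Associated.
Variables (R : realType) (d : nat) (H : lmodType R[i]).
Variable act : so R d -> H -> H.
Variable YY : forall n, 'M[R]_(n, d) -> ('I_n -> H) -> (R -> H).
Variables (vac : H) (Y : H -> H -> sseries d H).
Hypothesis CC : CC_system act YY vac.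
Hypothesis av : associated_vertex_operator act YY Y.
Let cm := CC_compact CC.
Implicit Types (a b : H) (x y : 'rV[R]_d) (De : R).

Definition YY2 x a b : R -> H :=
  @YY (1 + 1)%N (col_mx x 0) (fcat (fun _ : 'I_1 => a) (fun _ : 'I_1 => b)).

Lemma ord2P (P : 'I_(1 + 1) -> Prop) :
  P (lshift 1 ord0) -> P (rshift 1 ord0) -> forall i, P i.
Proof.
move=> P0 P1 i; rewrite -(splitK i).
by case: (fintype.split i) => j; rewrite (ord1 j).
Qed.

Lemma Conf_pair x y : x != y -> Conf (col_mx x y : 'M[R]_(1 + 1, d)).
Proof.
move=> xy; apply: ord2P; apply: ord2P; rewrite ?eqxx // => _;
  by rewrite ?rowKu ?rowKd !row_id // eq_sym.
Qed.

Lemma fcat11E (T : Type) (s t : T) :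
  fcat (fun _ : 'I_1 => s) (fun _ : 'I_1 => t) =
  (fun i : 'I_(1 + 1) => if i == lshift 1 ord0 then s else t).
Proof.
apply/funext; apply: ord2P; rewrite /fcat.
  by rewrite -[lshift 1 _]/(unsplit (inl _)) unsplitK eqxx.
by rewrite -[rshift 1 _]/(unsplit (inr _)) unsplitK.
Qed.

Lemma YY2_linl x c a a' b : x != 0 ->
  YY2 x (c *: a + a') b = c *: YY2 x a b + YY2 x a' b.
Proof.
move=> x0; have := CC_multilinear CC (fcat (fun _ : 'I_1 => a) (fun _ : 'I_1 => b))
  (lshift 1 ord0) c a a' (Conf_pair x0).
have E z : ([eta fcat (fun _ : 'I_1 => a) (fun _ : 'I_1 => b) with lshift 1 ord0 |-> z]
      : 'I_(1 + 1) -> H) =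
    fcat (fun _ : 'I_1 => z) (fun _ : 'I_1 => b).
  by apply/funext => i /=; rewrite !fcat11E; case: eqP.
by rewrite !E.
Qed.

Lemma YY2_linr x c a b b' : x != 0 ->
  YY2 x a (c *: b + b') = c *: YY2 x a b + YY2 x a b'.
Proof.
move=> x0; have := CC_multilinear CC (fcat (fun _ : 'I_1 => a) (fun _ : 'I_1 => b))
  (rshift 1 ord0) c b b' (Conf_pair x0).
have E z : ([eta fcat (fun _ : 'I_1 => a) (fun _ : 'I_1 => b) with rshift 1 ord0 |-> z]
      : 'I_(1 + 1) -> H) =
    fcat (fun _ : 'I_1 => a) (fun _ : 'I_1 => z).
  by apply/funext; apply: ord2P; rewrite !fcat11E.
by rewrite !E.
Qed.

Lemma YY2_Hbar x a b : x != 0 -> in_Hbar act (YY2 x a b).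
Proof. by move=> x0; apply: (CC_Hbar CC) => //; exact: Conf_pair. Qed.

Lemma YY2Dl x a a' b : x != 0 -> YY2 x (a + a') b = YY2 x a b + YY2 x a' b.
Proof. by move=> x0; have := YY2_linl 1 a a' b x0; rewrite !scale1r. Qed.

Lemma YY2Dr x a b b' : x != 0 -> YY2 x a (b + b') = YY2 x a b + YY2 x a b'.
Proof. by move=> x0; have := YY2_linr 1 a b b' x0; rewrite !scale1r. Qed.

Lemma YY20l x b : x != 0 -> YY2 x 0 b = 0.
Proof. by move=> x0; apply: (addrI (YY2 x 0 b)); rewrite -YY2Dl // !addr0. Qed.

Lemma YY20r x a : x != 0 -> YY2 x a 0 = 0.
Proof. by move=> x0; apply: (addrI (YY2 x a 0)); rewrite -YY2Dr // !addr0. Qed.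

Let vm := assoc_vertex_map av.

Lemma YDl a a' b : Y (a + a') b = Y a b + Y a' b.
Proof. by have := vertex_linl vm 1 a a' b; rewrite !scale1r. Qed.

Lemma YDr a b b' : Y a (b + b') = Y a b + Y a b'.
Proof. by have := vertex_linr vm 1 a b b'; rewrite !scale1r. Qed.

Lemma Y0l b : Y 0 b = 0.
Proof. by apply: (addrI (Y 0 b)); rewrite -YDl !addr0. Qed.

Lemma Y0r a : Y a 0 = 0.
Proof. by apply: (addrI (Y a 0)); rewrite -YDr !addr0. Qed.

Lemma Y_scales a b la : scales la (Y a b la).
Proof. by apply: homogeneous_scales; have [] := vertex_laurent vm a b. Qed.

(** The bound [A] on the degrees is the same for all functionals of weight [De]:
    the projection to [wt De], which no single functional determines, has to be
    a finite sum as well. *)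
Definition represents De a b (A : set R) :=
  forall u : {linear H -> R[i]^o}, in_dual_wt act De u ->
    value_in u A (Y a b) (fun x => u (YY2 x a b De)).

Lemma represents0 De a b : Y a b = 0 -> (forall x, x != 0 -> YY2 x a b = 0) ->
  represents De a b set0.
Proof.
move=> YE YY0 u ud; rewrite YE; apply: value_in0 => x x0.
by rewrite YY0 // (clinear0 (linear_clinear u)).
Qed.

Lemma representsD De a b a' b' a'' b'' A B :
  Y a b = Y a' b' + Y a'' b'' ->
  (forall x, x != 0 -> YY2 x a b = YY2 x a' b' + YY2 x a'' b'') ->
  represents De a' b' A -> represents De a'' b'' B -> represents De a b (A `|` B).
Proof.
move=> YE YYE r' r'' u ud; have [deg val] := value_inD (r' u ud) (r'' u ud).
by rewrite YE; split=> // x x0; rewrite val // YYE // fctE linearD.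
Qed.

Lemma represents_wt De De1 De2 a b : wt act De1 a -> wt act De2 b ->
  represents De a b [set De - De1 - De2].
Proof.
move=> wa wb u ud; have ul := linear_clinear u; split; last first.
  move=> x x0; rewrite (assoc_eval av ud wa wb x0) -/(YY2 x a b).
  by rewrite (pairing_dual ul ud) //; exact: YY2_Hbar.
split=> [|la x la' x0]; first exact: finite_set1.
rewrite -spoly_eval_map //; have [s E] := assoc_scaled av ud wa wb.
have : sseries_map (u : H -> R[i]^o) (Y a b) la = 0 by rewrite E; case: eqP.
by rewrite /sseries_map => ->; rewrite spoly_eval0.
Qed.

Lemma representsP De a b : exists A, represents De a b A.
Proof.
elim/(wt_ind cm): a => [|De1 a wa|a a' [A rA] [B rB]].
- exists set0; apply: represents0; [exact: Y0l|by move=> x; exact: YY20l].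
- elim/(wt_ind cm): b => [|De2 b wb|b b' [A rA] [B rB]].
  + exists set0; apply: represents0; first exact: Y0r.
    by move=> x; exact: YY20r.
  + by exists [set De - De1 - De2]; exact: represents_wt.
  + by exists (A `|` B); apply: representsD rA rB; [exact: YDr|move=> x; exact: YY2Dr].
- by exists (A `|` B); apply: representsD rA rB; [exact: YDl|move=> x; exact: YY2Dl].
Qed.

(** Only the finitely many weights of [u] impose a condition. *)
Lemma Y_degrees_pr (u : {linear H -> R[i]^o}) a b : in_Hvee act u ->
  exists A, forall De, degrees_in (u \o pr act De) (Y a b) A.
Proof.
move=> uv; have ul := linear_clinear u.
have [A rA] : exists A : R -> set R, forall De, represents De a b (A De).
  by exists (fun De => projT1 (cid (representsP De a b))) => De; case: cid.
have deg De := (rA De (functional_of (comp_clinear (pr_clinear cm De) ul)) (pr_dual cm ul)).1.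
exists (\bigcup_(De in weights act u) A De) => De; split=> [|la x nA x0].
  by apply: bigcup_finite => // De' _; exact: (deg De').1.
have [wD|nwD] := pselect (weights act u De).
  by apply: (deg De).2 => // AD; apply: nA; exists De.
exact: weights_out nwD (pr_wt cm _ _).
Qed.

Lemma Y_degrees (u : {linear H -> R[i]^o}) a b : in_Hvee act u ->
  exists A, degrees_in u (Y a b) A.
Proof.
move=> uv; have [A dA] := Y_degrees_pr a b uv; exists A.
split=> [|la x nA x0]; first exact: (dA 0).1.
rewrite (Hvee_pr cm _ (linear_clinear u) uv) big1 // => De _.
exact: (dA De).2.
Qed.

(** The defining property of [Y] for homogeneous vectors extends by linearity to
    all vectors, and by decomposition of [u] to the restricted dual. *)
Lemma Y_value (u : {linear H -> R[i]^o}) a b x : in_Hvee act u -> x != 0 ->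
  sseries_eval (sseries_map u (Y a b)) x = pairing u (YY2 x a b).
Proof.
move=> uv x0; have ul := linear_clinear u; have [A dA] := Y_degrees_pr a b uv.
rewrite (pairing_Hvee uv (YY2_Hbar _ _ x0)) sseries_eval_map //.
rewrite (@fsumT_widen _ _ _ A); [|exact: (dA 0).1|]; last first.
  move=> la nA; rewrite (Hvee_pr cm _ ul uv) big1 // => De _; exact: (dA De).2.
under eq_bigr do rewrite (Hvee_pr cm _ ul uv).
rewrite exchange_big /=; apply: eq_bigr => De _.
pose uD := functional_of (comp_clinear (pr_clinear cm De) ul).
have uDd : in_dual_wt act De uD by exact: pr_dual.
have [B rB] := representsP De a b; have [_ vB] := rB uD uDd.
have := vB x x0; rewrite /= (pr_id cm (YY2_Hbar _ _ x0 De)) => <-.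
by rewrite (value_degrees (linear_clinear uD) (dA De)).
Qed.

Lemma Y_has_value (u : {linear H -> R[i]^o}) a b : in_Hvee act u ->
  has_value u (Y a b) (fun x => pairing u (YY2 x a b)).
Proof.
move=> uv; have [A dA] := Y_degrees a b uv; exists A; split=> // x x0.
exact: Y_value.
Qed.

(** Both sides lie in [wt De] and have the same image under every functional. *)
Lemma Y_pr_value De a b x : x != 0 ->
  sseries_eval (sseries_map (pr act De) (Y a b)) x = YY2 x a b De.
Proof.
move=> x0; have [A rA] := representsP De a b.
have u_pr (u : {linear H -> R[i]^o}) De' v : in_dual_wt act De' u ->
    u (pr act De v) = if De' == De then u v else 0.
  move=> ud; case: (eqVneq De' De) ud => [->|De'De] ud.
    by rewrite -(dual_wt_pr cm _ (linear_clinear u) ud).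
  by apply: (ud De); [rewrite eq_sym|exact: pr_wt].
have deg : degrees_in (pr act De) (Y a b) A.
  have zl : is_clinear (fun _ : H => 0 : R[i]^o).
    by move=> c v w; rewrite scaler0 addr0.
  split=> [|la y nA y0]; first exact: (rA (functional_of zl) (fun _ _ _ _ => erefl)).1.1.
  apply: (separates cm) => De' u ud; rewrite (u_pr _ _ _ ud); case: eqP => // DD.
  by rewrite DD in ud; exact: (rA u ud).1.2.
rewrite (value_degrees (pr_clinear cm De) deg) //.
apply/eqP; rewrite -subr_eq0; apply/eqP; apply: (separates cm) => De' u ud.
rewrite linearB linear_sum /=; have [DD|De'De] := eqVneq De' De; last first.
  rewrite (ud De _ _ (YY2_Hbar _ _ x0 De)) 1?eq_sym // subr0 big1 // => la _.
  by rewrite (u_pr _ _ _ ud) (negPf De'De).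
rewrite DD in ud; have [dA <- //] := rA u ud.
rewrite (value_degrees (linear_clinear u) dA) // -sumrB big1 // => la _.
by rewrite (u_pr _ _ _ ud) eqxx subrr.
Qed.
End Associated.
(** * Conformal covariance *)

Section TauSeries.
Variables (R : realType) (d : nat) (H : lmodType R[i]).
Implicit Types (x : 'rV[R]_d) (Z : so R d).

Definition is_rlinear (V : lmodType R[i]) (f : so R d -> V) :=
  forall (r : R) X Z, f (r *: X + Z) = r%:C *: f X + f Z.

Lemma so_br_linr (g : so_idx d) r X Z :
  so_br (so_basis R g) (r *: X + Z) = r *: so_br (so_basis R g) X + so_br (so_basis R g) Z.
Proof.
rewrite !so_br_basisE scaler_sumr -big_split; apply: eq_bigr => h _.
by rewrite !ffunE scalerDl scalerA.
Qed.

Lemma minus_adP_lin x r X Z :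
  minus_adP x (r *: X + Z) = r *: minus_adP x X + minus_adP x Z.
Proof.
rewrite /minus_adP scalerN -opprD; congr (- _); rewrite scaler_sumr -big_split.
by apply: eq_bigr => rho _; rewrite so_br_linr scalerDr !scalerA mulrC.
Qed.

Lemma iter_minus_adP_lin x k r X Z :
  iter k (minus_adP x) (r *: X + Z) = r *: iter k (minus_adP x) X + iter k (minus_adP x) Z.
Proof. by elim: k => //= k ->; rewrite minus_adP_lin. Qed.

Lemma rlinear_sum (V : lmodType R[i]) (f : so R d -> V) (I : Type) (s : seq I)
    (c : I -> R) (X : I -> so R d) : is_rlinear f ->
  f (\sum_(i <- s) c i *: X i) = \sum_(i <- s) (c i)%:C *: f (X i).
Proof.
move=> fl; have f0 : f 0 = 0.
  by apply: (addrI (f 0)); have := fl 1 0 0; rewrite !scale1r !addr0.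
by elim: s => [|i s IHs]; rewrite ?big_nil // !big_cons fl IHs.
Qed.

Lemma tau0 Z : tau (0 : 'rV[R]_d) Z = Z.
Proof.
rewrite /tau big_ord_recl /= fact0 invr1 scale1r big1 ?addr0 // => k _.
have m0 X : minus_adP (0 : 'rV[R]_d) X = 0.
  by rewrite /minus_adP big1 ?oppr0 // => rho _; rewrite mxE scale0r.
by rewrite /= m0 scaler0.
Qed.

(** Multiplication of the series by the coordinates is multiplication of the
    value, so the value of the formal [tau] is [G] at the actual [tau]. *)
Lemma has_value_tau (u : {linear H -> R[i]^o}) (G : so R d -> sseries d H)
    (V : 'rV[R]_d -> so R d -> R[i]^o) X :
  (forall Z, has_value u (G Z) (V^~ Z)) -> (forall x, x != 0 -> is_rlinear (V x)) ->
  has_value u (sseries_tau G X) (fun x => V x (tau x X)).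
Proof.
move=> GV Vl.
have step k Z : has_value u
   (iter k (fun (G' : so R d -> sseries d H) Z =>
              - \sum_rho sseries_mulX rho (G' (so_br (soP R rho) Z))) G Z)
   (fun x => V x (iter k (minus_adP x) Z)).
  elim: k Z => [|k IHk] Z; first exact: GV.
  have := has_valueN (has_value_sum (index_enum 'I_d)
    (fun rho => has_value_mulX rho (IHk (so_br (soP R rho) Z)))).
  apply: has_valueE => x x0; rewrite iterSr.
  pose f Z := V x (iter k (minus_adP x) Z).
  have fl : is_rlinear f by move=> r X1 Z1; rewrite /f iter_minus_adP_lin Vl.
  have -> : minus_adP x Z = \sum_(rho < d) (- x 0 rho) *: so_br (soP R rho) Z.
    by rewrite /minus_adP -sumrN; apply: eq_bigr => rho _; rewrite scaleNr.
  rewrite -/(f _) rlinear_sum // -sumrN; apply: eq_bigr => rho _.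
  by rewrite rmorphN scaleNr.
rewrite /sseries_tau; have := has_value_sum (index_enum 'I_3)
   (fun k => has_valueZ (k`!%:R^-1 : R[i]) (step k X)).
apply: has_valueE => x x0; rewrite /tau rlinear_sum; last exact: Vl.
by apply: eq_bigr => k _; rewrite rmorphV ?unitfE ?pnatr_eq0 -?lt0n ?fact_gt0 // rmorph_nat.
Qed.

Lemma scales_tau (G : so R d -> sseries d H) X la :
  (forall Z la, scales la (G Z la)) -> scales la (sseries_tau G X la).
Proof.
move=> Gh; pose T (G' : so R d -> sseries d H) Z :=
  - \sum_rho sseries_mulX rho (G' (so_br (soP R rho) Z)).
have sumE (I : Type) (s : seq I) (F : I -> sseries d H) :
    (\sum_(i <- s) F i) la = \sum_(i <- s) F i la.
  by elim/big_rec2: _ => // i y z _ <-.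
have step k Z la' : scales la' (iter k T G Z la').
  elim: k Z la' => [|k IHk] Z la'; first exact: Gh.
  rewrite iterS {1}/T opprfctE; apply: scalesN.
  have -> : (\sum_rho sseries_mulX rho (iter k T G (so_br (soP R rho) Z))) la' =
     \sum_rho sseries_mulX rho (iter k T G (so_br (soP R rho) Z)) la'.
    by elim/big_rec2: _ => // i y z _ <-.
  by apply: scales_sum => rho _; apply: scales_mulX.
rewrite /sseries_tau sumE; apply: scales_sum => k _; rewrite scalrfctE.
by apply: scalesZ; exact: step.
Qed.
End TauSeries.

Section Covariance.
Variables (R : realType) (d : nat) (H : lmodType R[i]).
Variable act : so R d -> H -> H.
Variable YY : forall n, 'M[R]_(n, d) -> ('I_n -> H) -> (R -> H).
Variables (vac : H) (Y : H -> H -> sseries d H).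
Hypothesis CC : CC_system act YY vac.
Hypothesis av : associated_vertex_operator act YY Y.
Variable i0 : 'I_d.
Let cm := CC_compact CC.
Implicit Types (a b : H) (x : 'rV[R]_d) (De : R) (u : {linear H -> R[i]^o}).

Lemma sseries_value_ext (F G : sseries d H) :
  (forall la, scales la (F la)) -> (forall la, scales la (G la)) ->
  (forall De u, in_dual_wt act De u -> exists2 v, has_value u F v & has_value u G v) ->
  F = G.
Proof.
move=> Fh Gh FG; apply: (sseries_ext cm i0 Fh Gh) => De u ud.
have [v [A [dF vF]] [B [dG vG]]] := FG De u ud.
split=> [||x x0]; [by exists A|by exists B|].
exact: etrans (vF x x0) (esym (vG x x0)).
Qed.

(** On matrix elements this is the translation axiom at the first of two points. *)
Lemma vertex_covariant_P mu a b : Y (act (soP R mu) a) b = sseries_deriv mu (Y a b).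
Proof.
apply: sseries_value_ext => [la|la|De u ud].
- exact: (Y_scales av).
- by apply: scales_deriv; have [] := vertex_laurent (assoc_vertex_map av) a b.
have uv := dual_wt_Hvee ud.
exists (fun x => pairing u (YY2 YY x (act (soP R mu) a) b)); first exact: (Y_has_value CC av).
apply: (has_value_deriv (Y_has_value CC av a b uv)) => x x0.
have := CC_translation CC (fcat (fun _ : 'I_1 => a) (fun _ : 'I_1 => b))
  (lshift 1 ord0) mu (Conf_pair x0) uv.
have -> : ([eta fcat (fun _ : 'I_1 => a) (fun _ : 'I_1 => b) with lshift 1 ord0 |->
      act (soP R mu) (fcat (fun _ : 'I_1 => a) (fun _ : 'I_1 => b) (lshift 1 ord0))]
      : 'I_(1 + 1) -> H) =
   fcat (fun _ : 'I_1 => act (soP R mu) a) (fun _ : 'I_1 => b).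
  by apply/funext; apply: ord2P; rewrite /= !fcat11E.
have E (t : R) : col_mx x 0 + t *: delta_mx (lshift 1 ord0) mu =
    col_mx (x + t *: delta_mx 0 mu) 0 :> 'M[R]_(1 + 1, d).
  apply/matrixP => i j; rewrite !mxE; case: (splitP i) => k ik; rewrite !mxE.
    by rewrite -val_eqE /= ik.
  by rewrite -val_eqE /= ik add0r mulr0.
by under eq_fun do rewrite E.
Qed.

(** At the second point, the origin, [tau] is the identity. *)
Lemma YY2_covariant A x a b : x != 0 ->
  act_Hbar act A (YY2 YY x a b) =
  YY2 YY x (act (tau x A) a) b + YY2 YY x a (act A b).
Proof.
move=> x0; rewrite {1}/YY2 (CC_covariant CC) //; last exact: Conf_pair.
rewrite big_split_ord !big_ord1 rowKu rowKd !row_id tau0.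
have -> : ([eta fcat (fun _ : 'I_1 => a) (fun _ : 'I_1 => b) with lshift 1 ord0 |->
      act (tau x A) (fcat (fun _ : 'I_1 => a) (fun _ : 'I_1 => b) (lshift 1 ord0))]
      : 'I_(1 + 1) -> H) = fcat (fun _ : 'I_1 => act (tau x A) a) (fun _ : 'I_1 => b).
  by apply/funext; apply: ord2P; rewrite /= !fcat11E.
have -> : ([eta fcat (fun _ : 'I_1 => a) (fun _ : 'I_1 => b) with rshift 1 ord0 |->
      act A (fcat (fun _ : 'I_1 => a) (fun _ : 'I_1 => b) (rshift 1 ord0))]
      : 'I_(1 + 1) -> H) = fcat (fun _ : 'I_1 => a) (fun _ : 'I_1 => act A b).
  by apply/funext; apply: ord2P; rewrite /= !fcat11E.
by [].
Qed.

(** On matrix elements this is [YY2_covariant], the action on the left being moved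
    to the functional by [pairing_act]. *)
Lemma vertex_covariant_so A a b : sseries_map (act A) (Y a b) =
  Y a (act A b) + sseries_tau (fun X => Y (act X a) b) A.
Proof.
have Al := act_clinear cm A.
apply: sseries_value_ext => [la|la|De u ud].
- by apply: scales_map => //; exact: (Y_scales av).
- apply: scalesD; first exact: (Y_scales av).
  by apply: scales_tau => Z la'; exact: (Y_scales av).
have uv := dual_wt_Hvee ud; have ul := linear_clinear u.
have uAv := Hvee_act cm A ul uv.
pose uA := functional_of (comp_clinear Al ul).
exists (fun x => pairing u (act_Hbar act A (YY2 YY x a b))).
  apply: (has_value_map (uf := uA)) => //.
  have := Y_has_value CC av (u := uA) a b uAv; apply: has_valueE => x x0.
  by rewrite (pairing_act cm) //; exact: (YY2_Hbar CC).
have V (Z : so R d) := Y_has_value CC av (act Z a) b uv.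
have VA := Y_has_value CC av a (act A b) uv.
have Vl x : x != 0 -> is_rlinear (fun Z => pairing u (YY2 YY x (act Z a) b) : R[i]^o).
  move=> x0 r X Z; rewrite (so_module_linl cm) (YY2_linl CC) //.
  by rewrite (pairing_clinear cm _ ul uv) //; exact: (YY2_Hbar CC).
have := has_valueD VA (has_value_tau A V Vl).
apply: has_valueE => x x0; rewrite YY2_covariant //.
have := pairing_clinear cm 1 ul uv (YY2_Hbar CC (act (tau x A) a) b x0)
  (YY2_Hbar CC a (act A b) x0).
by rewrite scale1r mul1r => ->; rewrite addrC.
Qed.
End Covariance.
(** * Power series along a ray *)

Section AnalyticRay.
Variable R : realType.

Lemma normc_sum_le (I : Type) (s : seq I) (P : pred I) (f : I -> R[i]) :
  normc (\sum_(i <- s | P i) f i) <= \sum_(i <- s | P i) normc (f i).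
Proof.
elim/big_rec2: _ => [|i x y _ le]; first by rewrite (@normc0 R).
exact: le_trans (le_normcD _ _) (lerD _ le).
Qed.

Lemma normc_real (t : R) : normc t%:C = `|t|.
Proof. by rewrite /= expr0n /= addr0 sqrtr_sqr. Qed.

Lemma cvg_normc_lt (f : nat -> R[i]^o) (l : R[i]^o) : f @ \oo --> l ->
  forall e : R, 0 < e -> \forall N \near \oo, normc (l - f N) < e.
Proof.
move=> /cvgr_dist_lt fl e e0; have := fl e%:C; rewrite ltcR => /(_ e0).
by apply: filterS => N; rewrite -ltcR.
Qed.

Lemma esum_ge_finType (I : choiceType) (J : finType) (h : J -> I) (a : I -> R) :
  injective h -> (forall i, 0 <= a i) ->
  ((\sum_j a (h j))%:E <= \esum_(i in [set: I]) (a i)%:E)%E.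
Proof.
move=> hi a0; apply: esum_ge; exists (h @` [set: J]).
  by split=> //; apply: finite_image; exact: finite_finset.
rewrite fsbig_image; last by move=> x y _ _ /hi.
have -> : [set: J] = [set` index_enum J].
  by apply/seteqP; split=> // j _ /=; rewrite mem_index_enum.
by rewrite -fsbig_seq ?index_enum_uniq // sumEFin.
Qed.

(** On a segment issuing from the centre of a power series the increment is at
    most linear: each monomial of positive degree shrinks at least linearly. *)
Lemma analytic_ray n d (Om : set 'M[R]_(n, d)) (f : 'M[R]_(n, d) -> R[i]) p v :
  real_analytic_on Om f -> Om p ->
  exists C t0 : R, 0 < t0 /\
    forall t, 0 < t -> t <= t0 -> normc (f (p + t *: v) - f p) <= C * t.
Proof.
move=> fa /fa[c [e [e0 ce]]].
(* For [t <= t0] the segment stays in the polydisc of convergence. *)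
pose V := \sum_i \sum_j `|v i j|.
have vV i j : `|v i j| <= V.
  rewrite /V (bigD1 i) //= (bigD1 j) //= -addrA lerDl addr_ge0 //.
    by apply: sumr_ge0.
  by apply: sumr_ge0 => k _; exact: sumr_ge0.
have V0 : 0 <= V by apply: sumr_ge0 => k _; exact: sumr_ge0.
pose t0 := e / (1 + V); have t00 : 0 < t0 by rewrite divr_gt0 // ltr_pwDl.
pose T t (al : {ffun 'I_n * 'I_d -> nat}) :=
  c al * (\prod_k (t * v k.1 k.2) ^+ al k)%:C.
have inside t : 0 <= t <= t0 ->
  (\esum_(al in setT) (normc (T t al))%:E < +oo)%E /\
    (fun N : nat => \sum_(al : {ffun 'I_n * 'I_d -> 'I_N})
       T t [ffun k => al k : nat] : R[i]^o) @ \oo --> (f (p + t *: v) : R[i]^o).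
  move=> /andP[t1 t2]; have [i j|] := ce (p + t *: v).
    rewrite !mxE addrAC subrr add0r normrM ger0_norm //.
    apply: (@le_lt_trans _ _ (t0 * V)); first exact: ler_pM.
    have -> : t0 * V = e - t0 by rewrite /t0; field; rewrite gt_eqF ?ltr_pwDl.
    by rewrite ltrBlDr ltrDl.
  have TE al : T t al = c al * (\prod_k ((p + t *: v) k.1 k.2 - p k.1 k.2) ^+ al k)%:C.
    by congr (_ * _%:C); apply: eq_bigr => k _; rewrite !mxE addrAC subrr add0r.
  by rewrite (funext TE).
have [fin0 _] := inside t0 (introT andP (conj (ltW t00) (lexx _))).
pose S := fine (\esum_(al in setT) (normc (T t0 al))%:E).
exists (S / t0), t0; split=> // t tpos tt0.
have SE : \esum_(al in setT) (normc (T t0 al))%:E = S%:E.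
  rewrite fineK // ge0_fin_numE //; apply: esum_ge0 => al _.
  by rewrite lee_fin; case: (T t0 al) => ? ?; exact: sqrtr_ge0.
have tin : 0 <= t <= t0 by rewrite ltW.
have cv0 := (inside 0 (introT andP (conj (lexx _) (ltW t00)))).2.
rewrite scale0r addr0 in cv0.
have cvt := (inside t tin).2.
have term_le al : normc (T t al - T 0 al) <= t / t0 * normc (T t0 al).
  pose m := (\sum_k al k)%N; have tt0' : 0 <= t / t0 by rewrite divr_ge0 ?ltW.
  have TtE : T t al = ((t / t0) ^+ m)%:C * T t0 al.
    rewrite /T mulrCA -rmorphM; congr (_ * _%:C).
    rewrite /m -prodrXr -big_split /=; apply: eq_bigr => k _.
    by rewrite -exprMn mulrA divfK ?gt_eqF.
  have [m0|m0] := eqVneq m 0%N.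
    have al0 k : al k = 0%N.
      by apply/eqP; move/eqP: m0; rewrite sum_nat_eq0 => /forallP/(_ k).
    have -> : T t al = T 0 al.
      by congr (_ * _%:C); apply: eq_bigr => k _; rewrite al0.
    by rewrite subrr (@normc0 R) mulr_ge0 //; case: (T t0 al) => ? ?; exact: sqrtr_ge0.
  have T00 : T 0 al = 0.
    have [k alk] : exists k, al k != 0%N.
      apply/existsP; rewrite -negb_forall; apply: contra m0 => /forallP m0.
      by rewrite sum_nat_eq0; apply/forallP => k; rewrite m0.
    rewrite /T (bigD1 k) //= mul0r expr0n (negPf alk) mul0r.
    by rewrite (mulr0 (c al)).
  rewrite T00 subr0 TtE normcM normc_real ger0_norm ?exprn_ge0 //.
  apply: ler_wpM2r; first by case: (T t0 al) => ? ?; exact: sqrtr_ge0.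
  rewrite -[leRHS]expr1 ler_wiXn2l // ?lt0n // ler_pdivrMr // mul1r //.
apply/ler_addgt0Pr => eps eps0.
have e2 : 0 < eps / 2 by rewrite divr_gt0.
near \oo => N.
have c1 : normc (f (p + t *: v) - \sum_(al : {ffun 'I_n * 'I_d -> 'I_N})
       T t [ffun k => al k : nat]) < eps / 2 by near: N; exact: (cvg_normc_lt cvt e2).
have c2 : normc (f p - \sum_(al : {ffun 'I_n * 'I_d -> 'I_N})
       T 0 [ffun k => al k : nat]) < eps / 2 by near: N; exact: (cvg_normc_lt cv0 e2).
pose h (al : {ffun 'I_n * 'I_d -> 'I_N}) : {ffun 'I_n * 'I_d -> nat} := [ffun k => al k : nat].
have hi : injective h.
  by move=> x y /ffunP xy; apply/ffunP => k; apply: val_inj; have := xy k; rewrite !ffunE.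
have bound : \sum_al normc (T t0 (h al)) <= S.
  rewrite -lee_fin -SE; apply: (esum_ge_finType hi) => al.
  by case: (T t0 al) => ? ?; exact: sqrtr_ge0.
pose A := \sum_al T t (h al); pose B := \sum_al T 0 (h al).
have AB : normc (A - B) <= t / t0 * S.
  rewrite /A /B -sumrB (le_trans (normc_sum_le _ _ _)) //.
  apply: (@le_trans _ _ (\sum_al t / t0 * normc (T t0 (h al)))); first exact: ler_sum.
  by rewrite -mulr_sumr ler_wpM2l // divr_ge0 ?ltW.
have -> : f (p + t *: v) - f p = (f (p + t *: v) - A) - (f p - B) + (A - B) by ring.
have -> : S / t0 * t + eps = eps / 2 + eps / 2 + t / t0 * S by field; rewrite gt_eqF.
apply: le_trans (le_normcD _ _) (lerD _ AB).
apply: le_trans (le_normcD _ _) (lerD (ltW c1) _).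
by rewrite normcN ltW.
Unshelve. all: by end_near. Qed.
End AnalyticRay.
(** * The exponential of the translations *)

Section PowerCoefficients.
Variables (R : realType) (d : nat) (H : lmodType R[i]).
Variable act : so R d -> H -> H.
Hypothesis cm : compact_module act.
Implicit Types (a : H) (al : mindex d) (x : 'rV[R]_d).

Definition monomial x al : R := \prod_mu x 0 mu ^+ al mu.

(** The coefficients of the homogeneous polynomial [(x . P)^k a / k!] *)
Fixpoint exp_coef k a al : H :=
  if k is k'.+1 then
    k'.+1%:R^-1 *: \sum_(mu | (0 < al mu)%N) exp_coef k' (act (soP R mu) a) (mdecr mu al)
  else a.

Lemma exp_coefD k a b al : exp_coef k (a + b) al = exp_coef k a al + exp_coef k b al.
Proof.
elim: k a b al => [//|k IHk] a b al /=; rewrite -scalerDr -big_split.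
congr (_ *: _); apply: eq_bigr => mu _.
by rewrite (clinearD (act_clinear cm _)) IHk.
Qed.

Lemma act_P_wt De mu a : wt act De a -> wt act (De + 1) (act (soP R mu) a).
Proof. by move=> wa; exact: (act_basis_wt cm (inl (inl (inr mu))) wa). Qed.

Lemma exp_coef_wt De k a al : wt act De a -> wt act (De + k%:R) (exp_coef k a al).
Proof.
elim: k De a al => [|k IHk] De a al wa /=; first by rewrite addr0.
apply: (wtZ cm); elim/big_ind: _ => [|b c|mu _].
- exact: wt0.
- exact: wtD.
by rewrite -natr1 addrA addrAC -addrA; have := IHk _ _ (mdecr mu al) (act_P_wt mu wa);
  rewrite -addrA [1 + _]addrC addrA -addrA.
Qed.

Definition mdeg_set k : set (mindex d) := [set al | mdeg al = k].

Lemma mdeg_set_fin k : finite_set (mdeg_set k).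
Proof.
pose h (be : {ffun 'I_d -> 'I_k.+1}) : mindex d := [ffun i => be i : nat].
apply: (sub_finite_set (B := h @` [set: {ffun 'I_d -> 'I_k.+1}])); last first.
  by apply: finite_image; exact: finite_finset.
move=> al /= alk; exists [ffun i => inord (al i)] => //.
apply/ffunP => i; rewrite !ffunE inordK // ltnS -alk /mdeg (bigD1 i) //=.
exact: leq_addr.
Qed.

Lemma mdeg_mone : mdeg (mone d) = 0%N.
Proof. by rewrite /mdeg big1 // => i _; rewrite ffunE. Qed.

Lemma mdeg_set0 : mdeg_set 0 = [set mone d].
Proof.
apply/seteqP; split=> [al /eqP|al ->]; last exact: mdeg_mone.
rewrite sum_nat_eq0 => /forallP al0; apply/ffunP => i; rewrite ffunE.
by apply/eqP; exact: al0.
Qed.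

Lemma monomial_mincr x mu al : monomial x (mincr mu al) = x 0 mu * monomial x al.
Proof.
rewrite /monomial (bigD1 mu) //= [in RHS](bigD1 mu) //= ffunE eqxx addn1 exprS -mulrA.
by congr (_ * (_ * _)); apply: eq_bigr => nu /negPf nm; rewrite ffunE nm addn0.
Qed.

Lemma monomial_mone x : monomial x (mone d) = 1.
Proof. by rewrite /monomial big1 // => mu _; rewrite ffunE. Qed.

Definition exp_poly k a x : H :=
  \sum_(al \in mdeg_set k) (monomial x al)%:C *: exp_coef k a al.

Lemma exp_poly0 a x : exp_poly 0 a x = a.
Proof. by rewrite /exp_poly mdeg_set0 fsbig_set1 monomial_mone /= scale1r. Qed.

(** Expand one factor [x . P] of the power; the multi-indices of degree [k + 1] in
    which [mu] occurs are the [mincr mu] of those of degree [k]. *)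
Lemma exp_polyS k a x : exp_poly k.+1 a x =
  k.+1%:R^-1 *: \sum_mu (x 0 mu)%:C *: exp_poly k (act (soP R mu) a) x.
Proof.
have mu_part mu : (x 0 mu)%:C *: exp_poly k (act (soP R mu) a) x =
   \sum_(al <- fset_set (mdeg_set k.+1))
     if (0 < al mu)%N then (monomial x al)%:C *: exp_coef k (act (soP R mu) a) (mdecr mu al) else 0.
  rewrite /exp_poly -(@fsbig_finite _ _ _ _ _ _ (mdeg_set_fin k.+1)).
  pose Q : set (mindex d) := mdeg_set k.+1 `&` [set al | (0 < al mu)%N].
  transitivity (\sum_(al \in Q)
     (monomial x al)%:C *: exp_coef k (act (soP R mu) a) (mdecr mu al)); last first.
    rewrite fsbig_mkcondr; apply: eq_fsbigr => al _; congr (if _ then _ else _).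
    by apply/idP/idP; rewrite inE.
  rewrite [RHS](@reindex_fsbig _ _ _ _ _ (mincr mu) (mdeg_set k)); last first.
    split=> [al alk|al be _ _ E|al [alk al0]].
    - split; first by rewrite /mdeg_set /= mdeg_mincr; congr _.+1; exact: alk.
      by rewrite /= ffunE eqxx addn1.
    - by rewrite -(mdecr_mincr mu al) E mdecr_mincr.
    - exists (mdecr mu al); last exact: (mincr_mdecr al0).
      apply/succn_inj; rewrite -(mdeg_mincr mu) (mincr_mdecr al0); exact: alk.
  rewrite !(fsbig_finite _ _ (mdeg_set_fin k)) scaler_sumr; apply: eq_bigr => al _.
  by rewrite monomial_mincr mdecr_mincr scalerA rmorphM.
under eq_bigr do rewrite mu_part.
rewrite exchange_big scaler_sumr /exp_poly fsbig_finite; last exact: mdeg_set_fin.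
apply: eq_bigr => al _ /=; rewrite scalerA mulrC -scalerA; congr (_ *: _).
by rewrite scaler_sumr -big_mkcond.
Qed.
End PowerCoefficients.
(** * The vacuum *)

Lemma le_linear_eq0 (R : realFieldType) (r C t1 : R) : 0 <= r -> 0 < t1 ->
  (forall t, 0 < t -> t <= t1 -> r <= C * t) -> r = 0.
Proof.
move=> r0 t10 le; apply/eqP; rewrite eq_le r0 andbT leNgt; apply/negP => rpos.
have C0 : 0 < C by have := lt_le_trans rpos (le t1 t10 (lexx _)); rewrite pmulr_lgt0.
pose t := Num.min t1 (r / (C + C)).
have tpos : 0 < t by rewrite lt_min t10 divr_gt0 // addr_gt0.
have := le t tpos; rewrite ge_min lexx => /(_ isT); apply/negP; rewrite -ltNge.
apply: (@le_lt_trans _ _ (C * (r / (C + C)))).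
  by rewrite ler_pM2l // ge_min lexx orbT.
rewrite (_ : C * _ = r / 2); last by field; lra.
by rewrite ltr_pdivrMr // mulr_natr mulr2n ltrDl.
Qed.

Section Vacuum.
Variables (R : realType) (d : nat) (H : lmodType R[i]).
Variable act : so R d -> H -> H.
Variable YY : forall n, 'M[R]_(n, d) -> ('I_n -> H) -> (R -> H).
Variables (vac : H) (Y : H -> H -> sseries d H).
Hypothesis CC : CC_system act YY vac.
Hypothesis av : associated_vertex_operator act YY Y.
Variable i0 : 'I_d.
Let cm := CC_compact CC.
Implicit Types (a b : H) (x : 'rV[R]_d) (De : R) (u : {linear H -> R[i]^o}).

Lemma YY_reindex n (x y : 'M[R]_(n, d)) (a b : 'I_n -> H) (s : 'S_n) :
  (0 < n)%N -> Conf x -> (forall i, row i y = row (s i) x) -> (forall i, b i = a (s i)) ->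
  YY x a = YY y b.
Proof.
move=> n0 Cx xy ab; rewrite (CC_perm CC a s n0 Cx); congr (YY _ _).
  apply/row_matrixP => i; rewrite xy; apply/rowP => j; by rewrite !mxE.
by apply/funext => i; rewrite ab.
Qed.

Definition YY1 x a : R -> H := @YY 1%N x (fun=> a).

Lemma Conf1 x : Conf x.
Proof. by move=> i j; rewrite !ord1 eqxx. Qed.

Lemma YY1_Hbar x a : in_Hbar act (YY1 x a).
Proof. by apply: (CC_Hbar CC) => //; exact: Conf1. Qed.

Lemma YY1_lin x c a b : YY1 x (c *: a + b) = c *: YY1 x a + YY1 x b.
Proof.
have := CC_multilinear CC (fun=> a) ord0 c a b (@Conf1 x).
have E z : ([eta (fun _ : 'I_1 => a) with ord0 |-> z] : 'I_1 -> H) = fun=> z.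
  by apply/funext => i; rewrite /= ord1.
by rewrite !E.
Qed.

Lemma YY1_origin a : YY1 0 a = decomp act a.
Proof. exact: (CC_unit CC). Qed.

Lemma YY2_vac_right x a : x != 0 -> YY2 YY x a vac = YY1 x a.
Proof.
move=> x0; rewrite /YY2 (CC_vacuum CC) ?col_mxKu //; exact: Conf_pair.
Qed.

(** Permutation invariance lists the vacuum last, where it can be dropped together
    with its point [x]; the remaining point is the origin. *)
Lemma YY2_vac_left x b : x != 0 -> YY2 YY x vac b = decomp act b.
Proof.
move=> x0; pose s : 'S_(1 + 1) := tperm (lshift 1 ord0) (rshift 1 ord0).
have C := Conf_pair x0.
rewrite /YY2 (@YY_reindex _ _ (col_mx 0 x) _
  (fcat (fun _ : 'I_1 => b) (fun _ : 'I_1 => vac)) s) //.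
- rewrite (CC_vacuum CC) ?col_mxKu ?(CC_unit CC) //.
  by apply: Conf_pair; rewrite eq_sym.
- by apply: ord2P; rewrite /s ?tpermL ?tpermR ?rowKu ?rowKd.
- by apply: ord2P; rewrite /s ?tpermL ?tpermR !fcat11E.
Qed.

Lemma vertex_vac_left b : Y vac b = sseries_const d b.
Proof.
apply: (sseries_value_ext CC i0) => [la|la|De u ud].
- exact: (Y_scales av).
- rewrite /sseries_const; case: eqP => [->|_]; last exact: scales0.
  by apply: scales_smono; rewrite mdeg_mone addr0.
have uv := dual_wt_Hvee ud; have ul := linear_clinear u.
exists (fun=> u b).
  apply: has_valueE (Y_has_value CC av vac b uv) => x x0.
  by rewrite YY2_vac_left // (pairing_decomp cm).
have deg : degrees_in u (sseries_const d b : sseries d H) [set 0].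
  split=> [|la x la0 x0]; first exact: finite_set1.
  by rewrite /sseries_const; case: eqP => // _; rewrite spoly_eval0 // (clinear0 ul).
exists [set 0]; split=> // x x0.
rewrite (value_degrees ul deg) // fset_set1 big_seq_fset1 /sseries_const eqxx.
by rewrite spoly_eval_smono // powRr0 mulr1 -/(monomial x _) monomial_mone scale1r.
Qed.

Section MatrixElement.
Variables (De0 : R) (u : {linear H -> R[i]^o}).
Hypothesis ud : in_dual_wt act De0 u.
Let uv := dual_wt_Hvee ud.
Let ul := linear_clinear u.

(** A matrix element of the one-point operator. Up to [one_point_exp] the aim is to
    compute it as that of [exp(x . P)]. *)
Definition one_point a x : R[i] := pairing u (YY1 x a).

Lemma one_point_lin c a b x : one_point (c *: a + b) x = c * one_point a x + one_point b x.
Proof. by rewrite /one_point YY1_lin (pairing_clinear cm) //; exact: YY1_Hbar. Qed.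

Lemma one_point_origin a : one_point a 0 = u a.
Proof. by rewrite /one_point YY1_origin (pairing_decomp cm). Qed.

Lemma one_point_value De1 a x : wt act De1 a -> x != 0 ->
  one_point a x = u (spoly_eval (Y a vac (De0 - De1)) x).
Proof.
move=> wa x0; have [deg _] := represents_wt CC av (De := De0) wa (CC_vac_wt CC) ud.
rewrite subr0 in deg.
rewrite /one_point -YY2_vac_right // -(Y_value CC av) // (value_degrees ul deg) //.
by rewrite fset_set1 big_seq_fset1.
Qed.

(** Away from the origin the one-point function is a matrix element of [Y a vac],
    hence homogeneous. *)
Lemma one_point_scales De1 a x t : wt act De1 a -> x != 0 -> 0 < t ->
  one_point a (t *: x) = (t `^ (De0 - De1))%:C * one_point a x.
Proof.
move=> wa x0 t0; rewrite !(one_point_value wa) ?scale_neq0 //.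
by rewrite (Y_scales av a vac (De0 - De1) t0 x0) linearZ.
Qed.

(** The one-point function is analytic at the origin, with value [u a], and
    homogeneous of degree [De0 - De1]. In degree 0 it is therefore constant; in
    negative degree it has no singularity only if it vanishes, and then [u a]
    vanishes too since the weights differ. *)
Lemma one_point_degree_le0 De1 a x : wt act De1 a -> De0 <= De1 -> x != 0 ->
  one_point a x = u a.
Proof.
move=> wa DD x0; have := CC_analytic CC (fun=> a) (ltn0Sn 0) uv.
move=> /(@analytic_ray _ _ _ _ _ 0 x) [//|]; first exact: Conf1.
move=> C [t0 [t00 Ct]]; pose t1 := Num.min t0 1.
have t10 : 0 < t1 by rewrite lt_min t00 ltr01.
suff le t : 0 < t -> t <= t1 -> normc (one_point a x - u a) <= C * t.
  apply/eqP; rewrite -subr_eq0; apply/eqP/(@eq0_normc R).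
  by apply: le_linear_eq0 t10 le; case: (_ - _) => ? ?; exact: sqrtr_ge0.
move=> tpos tt1; have [tt0 tt] : t <= t0 /\ t <= 1 by move: tt1; rewrite le_min => /andP[].
have := Ct t tpos tt0; rewrite add0r -/(YY1 _ _) -/(YY1 0 a) -/(one_point a _) -/(one_point a 0).
rewrite one_point_origin (one_point_scales wa) //.
move: DD; rewrite le_eqVlt => /predU1P[<-|DD]; first by rewrite subrr powRr0 mul1r.
rewrite (ud (De' := De1) _ wa) ?gt_eqF // !subr0 normcM normc_real.
apply: le_trans; rewrite ler_peMl //; first by case: (one_point a x) => ? ?; exact: sqrtr_ge0.
rewrite ger0_norm ?powR_ge0 // -[De0 - De1]opprB powRN invf_ge1 ?powR_gt0 //.
have <- : 1 `^ (De1 - De0) = 1 :> R by rewrite powR1.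
by rewrite ge0_ler_powR ?nnegrE ?(ltW tpos) ?ler01 // subr_ge0 ltW.
Qed.

Lemma minus_adP_soD x : minus_adP x (soD R d) = \sum_rho x 0 rho *: soP R rho.
Proof.
rewrite /minus_adP -sumrN; apply: eq_bigr => rho _.
rewrite so_br_basisE (bigD1 (inl (inl (inl tt)))) //= big1 => [|h /negPf hg].
  by rewrite addr0 ffunE eqxx scale1r scalerN opprK.
by rewrite ffunE hg scale0r.
Qed.

Lemma minus_adP_soP x mu : minus_adP x (soP R mu) = 0.
Proof.
rewrite /minus_adP big1 ?oppr0 // => rho _.
rewrite so_br_basisE big1 ?scaler0 // => h _; rewrite ffunE.
by have [->|_] := eqVneq h (inl (inl (inr mu))); rewrite ?scale0r //= scaler0.
Qed.

Lemma tau_soD x : tau x (soD R d) = soD R d + \sum_rho x 0 rho *: soP R rho.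
Proof.
rewrite /tau !big_ord_recl big_ord0 /= addr0 minus_adP_soD !invr1 !scale1r.
have -> : minus_adP x (\sum_rho x 0 rho *: soP R rho) = 0.
  have m0 : minus_adP x 0 = 0.
    apply: (addrI (minus_adP x 0)); have := minus_adP_lin x 1 0 0.
    by rewrite !scale1r !addr0 => <-.
  elim: (index_enum _) => [|rho s IHs]; first by rewrite big_nil.
  by rewrite big_cons minus_adP_lin minus_adP_soP scaler0 add0r.
by rewrite scaler0 addr0.
Qed.

(** This Euler identity is covariance under [D], since [tau x D = D + x . P]. *)
Lemma one_point_euler De1 a x : wt act De1 a ->
  (De0 - De1)%:C * one_point a x = \sum_mu (x 0 mu)%:C * one_point (act (soP R mu) a) x.
Proof.
move=> wa; have := CC_covariant CC (fun=> a) (soD R d) (ltn0Sn 0) (@Conf1 x).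
rewrite big_ord1 row_id.
have -> : ([eta (fun _ : 'I_1 => a) with ord0 |-> act (tau x (soD R d)) a] : 'I_1 -> H)
   = fun=> act (tau x (soD R d)) a by apply/funext => i; rewrite /= ord1.
rewrite -/(YY1 _ _) -/(YY1 x a) => /(congr1 (pairing u)).
rewrite (pairing_act cm) //; last exact: YY1_Hbar.
have -> : pairing (u \o act (soD R d)) (YY1 x a) = De0%:C * one_point a x.
  have Dl := comp_clinear (act_clinear cm (soD R d)) ul.
  have Dd : in_dual_wt act De0 (u \o act (soD R d)).
    by move=> De' b De'De wb; rewrite /= wb functionalZ (ud De'De wb) mulr0.
  rewrite (pairing_dual Dl Dd (YY1_Hbar x a)) /one_point (pairing_dual ul ud (YY1_Hbar x a)).
  by rewrite /= (YY1_Hbar x a De0) functionalZ.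
rewrite -/(one_point _ x) tau_soD (actD cm) wa one_point_lin (act_sum cm) => E.
apply/eqP; rewrite rmorphB mulrBl subr_eq E addrC; apply/eqP; congr (_ + _).
under eq_bigr do rewrite (actZ cm).
elim/big_rec2: _ => [|mu v w _ IH].
  apply: (addrI (one_point 0 x)); have := one_point_lin 1 0 0 x.
  by rewrite scale1r mul1r !addr0 => <-.
by rewrite one_point_lin IH.
Qed.

(** The Euler identity lowers the degree by one, and without integrality the
    descent ends in negative degree. *)
Lemma one_point_zero n De1 a x : wt act De1 a -> De0 - De1 < n%:R ->
  (forall k : nat, De0 - De1 != k%:R) -> x != 0 -> one_point a x = 0.
Proof.
elim: n De1 a => [|n IHn] De1 a wa lt notnat x0.
  rewrite (one_point_degree_le0 wa) //; last by move: lt; lra.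
  apply: (ud (De' := De1) _ wa); apply/eqP => E; have := notnat 0%N.
  by rewrite E subrr eqxx.
have ne0 : De0 - De1 != 0 := notnat 0%N.
have := one_point_euler x wa; rewrite big1 => [/eqP|mu _].
  by rewrite mulf_eq0 fmorph_eq0 (negPf ne0) => /eqP.
rewrite (IHn (De1 + 1)) ?mulr0 //.
- exact: act_P_wt.
- by move: lt; rewrite -natr1; lra.
- move=> k; have := notnat k.+1; apply: contra_neq => E.
  by rewrite -natr1 -E; ring.
Qed.

(** The Euler identity is the recursion [exp_polyS], started in degree 0. *)
Lemma one_point_exp k De1 a x : wt act De1 a -> De0 = De1 + k%:R -> x != 0 ->
  one_point a x = u (exp_poly act k a x).
Proof.
elim: k De1 a => [|k IHk] De1 a wa DD x0.
  by rewrite exp_poly0 (one_point_degree_le0 wa) // DD addr0.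
have k0 : k.+1%:R != 0 :> R[i] by rewrite pnatr_eq0.
apply: (mulfI k0); have := one_point_euler x wa.
rewrite DD addrAC subrr add0r rmorph_nat => ->.
rewrite exp_polyS functionalZ mulrA divff // mul1r linear_sum.
apply: eq_bigr => mu _; rewrite functionalZ; congr (_ * _).
apply: (IHk (De1 + 1)) => //; first exact: act_P_wt.
by rewrite DD -natr1; ring.
Qed.
End MatrixElement.

(** The power series [exp(x . P) a] *)
Definition exp_series a : sseries d H :=
  sseries_of_power (fun al => exp_coef act (mdeg al) a al).

Lemma degree_set_fin (la : R) : finite_set [set al : mindex d | (mdeg al)%:R = la].
Proof.
have [[k <-]|nk] := pselect (exists k : nat, k%:R = la).
  apply: (sub_finite_set _ (mdeg_set_fin d k)) => al /= /eqP.
  by rewrite eqr_nat => /eqP.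
by apply: (sub_finite_set (B := set0)) => // al /= E; apply: nk; exists (mdeg al).
Qed.

Lemma exp_seriesE a la : exp_series a la =
  \sum_(al <- fset_set [set al | (mdeg al)%:R = la]) smono al 0 (exp_coef act (mdeg al) a al).
Proof. by rewrite /exp_series /sseries_of_power fsbig_finite //; exact: degree_set_fin. Qed.

Lemma exp_seriesD a b : exp_series (a + b) = exp_series a + exp_series b.
Proof.
apply/funext => la; rewrite fctE !exp_seriesE -big_split; apply: eq_bigr => al _.
by rewrite (exp_coefD cm) smonoD.
Qed.

Lemma exp_series0 : exp_series 0 = 0.
Proof. by apply: (addrI (exp_series 0)); rewrite -exp_seriesD !addr0. Qed.

Lemma scales_exp_series a la : scales la (exp_series a la).
Proof.
rewrite exp_seriesE big_seq; apply: scales_sum => al.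
rewrite in_fset_set; last exact: degree_set_fin.
by rewrite inE /= => alla; apply: scales_smono; rewrite addr0.
Qed.

(** Only the part of degree [De0 - De1] of the exponential series is seen by a
    functional of weight [De0]. *)
Lemma vertex_vac_right_wt De1 a : wt act De1 a -> Y a vac = exp_series a.
Proof.
move=> wa; apply: (sseries_value_ext CC i0) => [la|la|De0 u ud].
- exact: (Y_scales av).
- exact: scales_exp_series.
have uv := dual_wt_Hvee ud; have ul := linear_clinear u.
exists (one_point u a).
  apply: has_valueE (Y_has_value CC av a vac uv) => x x0.
  by rewrite YY2_vac_right.
have evalE la x : x != 0 -> u (spoly_eval (exp_series a la) x) =
    \sum_(al <- fset_set [set al | (mdeg al)%:R = la])
       (monomial x al)%:C * u (exp_coef act (mdeg al) a al).
  move=> x0; rewrite exp_seriesE spoly_eval_sum // linear_sum; apply: eq_bigr => al _.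
  by rewrite spoly_eval_smono // powRr0 mulr1 functionalZ.
have deg : degrees_in u (exp_series a) [set De0 - De1].
  split=> [|la x laD x0]; first exact: finite_set1.
  rewrite evalE // big_seq big1 // => al; rewrite in_fset_set; last exact: degree_set_fin.
  rewrite inE /= => alla; rewrite (ud (De1 + (mdeg al)%:R)) ?mulr0 //.
    by apply/eqP => E; apply: laD; rewrite -alla -E; ring.
  exact: exp_coef_wt.
exists [set De0 - De1]; split=> // x x0.
rewrite (value_degrees ul deg) // fset_set1 big_seq_fset1 evalE //.
have [[k kE]|nk] := pselect (exists k : nat, k%:R = De0 - De1).
  rewrite (one_point_exp ud (k := k) wa) //; last by rewrite kE; ring.
  rewrite /exp_poly fsbig_finite; last exact: mdeg_set_fin.
  have -> : [set al : mindex d | (mdeg al)%:R = De0 - De1] = mdeg_set k.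
    apply/seteqP; split=> al /= alk.
      by apply/eqP; rewrite -(eqr_nat R) alk kE.
    by rewrite -kE; congr _%:R.
  rewrite linear_sum big_seq [RHS]big_seq; apply: eq_bigr => al.
  rewrite in_fset_set; last exact: mdeg_set_fin.
  by rewrite inE => alk; rewrite functionalZ alk.
rewrite big_seq big1 => [|al]; last first.
  rewrite in_fset_set; last exact: degree_set_fin.
  by rewrite inE /= => E; case: nk; exists (mdeg al).
have notnat (k : nat) : De0 - De1 != k%:R by apply/eqP => E; apply: nk; exists k.
by rewrite (one_point_zero ud (n := (Num.truncn (De0 - De1)).+1) wa) // truncnS_gt.
Qed.

Lemma vertex_vac_right a : Y a vac = exp_series a.
Proof.
elim/(wt_ind cm): a => [|De a wa|a b IHa IHb].
- by rewrite (Y0l av) exp_series0.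
- exact: vertex_vac_right_wt wa.
- by rewrite (YDl av) exp_seriesD IHa IHb.
Qed.
End Vacuum.
(** * Restriction of an analytic function to a coordinate subspace *)

Section AnalyticSlice.
Variables (R : realType) (m d : nat).
Implicit Types (x : 'M[R]_(m, d)).

Definition ext_index (T : Type) (t0 : T) (be : {ffun 'I_m * 'I_d -> T}) :
    {ffun 'I_(m + 1) * 'I_d -> T} :=
  [ffun k => if fintype.split k.1 is inl i then be (i, k.2) else t0].

Definition res_index (T : Type) (al : {ffun 'I_(m + 1) * 'I_d -> T}) :
    {ffun 'I_m * 'I_d -> T} := [ffun k => al (lshift 1 k.1, k.2)].

Lemma split_lshiftE n1 n2 (i : 'I_n1) : fintype.split (lshift n2 i) = inl i.
Proof. by rewrite -[lshift _ _]/(unsplit (inl _)) unsplitK. Qed.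

Lemma split_rshiftE n1 n2 (i : 'I_n2) : fintype.split (rshift n1 i) = inr i.
Proof. by rewrite -[rshift _ _]/(unsplit (inr _)) unsplitK. Qed.

Lemma ext_indexK (T : Type) (t0 : T) : cancel (@ext_index T t0) (@res_index T).
Proof. by move=> be; apply/ffunP => -[i j]; rewrite !ffunE split_lshiftE. Qed.

Lemma prod_rows (al : {ffun 'I_(m + 1) * 'I_d -> nat}) (y : 'M[R]_(m + 1, d)) :
  \prod_k y k.1 k.2 ^+ al k =
  (\prod_(k : 'I_m * 'I_d) y (lshift 1 k.1) k.2 ^+ al (lshift 1 k.1, k.2)) *
  \prod_j y (rshift m ord0) j ^+ al (rshift m ord0, j).
Proof.
rewrite (eq_bigr (fun k => y k.1 k.2 ^+ al (k.1, k.2))); last by case.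
rewrite -(pair_bigA _ (fun i j => y i j ^+ al (i, j))) /= big_split_ord big_ord1 /=.
by rewrite -(pair_bigA _ (fun i j => y (lshift 1 i) j ^+ al (lshift 1 i, j))).
Qed.

(** The restriction of a power series to a coordinate subspace is the power
    series of the multi-indices supported there. *)
Lemma analytic_slice (Om : set 'M[R]_(m + 1, d)) (f : 'M[R]_(m + 1, d) -> R[i]) :
  real_analytic_on Om f ->
  real_analytic_on [set x | Om (col_mx x 0)] (fun x => f (col_mx x 0)).
Proof.
move=> fa p /= /fa[c [e [e0 ce]]].
exists (fun be => c (ext_index 0%N be)), e; split=> // x xp.
pose y : 'M[R]_(m + 1, d) := col_mx x 0 - col_mx p 0.
have yl i j : y (lshift 1 i) j = x i j - p i j by rewrite /y !mxE !split_lshiftE.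
have yr j : y (rshift m ord0) j = 0 by rewrite /y !mxE !split_rshiftE !mxE subr0.
have [i j|sm cv] := ce (col_mx x 0).
  rewrite !mxE; case: (fintype.split i) => k; rewrite ?xp // !mxE subrr normr0 //.
pose F al := c al * (\prod_k y k.1 k.2 ^+ al k)%:C.
have FE al : c al * (\prod_k ((col_mx x 0 : 'M[R]_(m + 1, d)) k.1 k.2 -
    (col_mx p 0 : 'M[R]_(m + 1, d)) k.1 k.2) ^+ al k)%:C = F al.
  by congr (_ * _%:C); apply: eq_bigr => k _; rewrite /y !mxE.
have GE be : c (ext_index 0%N be) * (\prod_k (x k.1 k.2 - p k.1 k.2) ^+ be k)%:C
    = F (ext_index 0%N be).
  rewrite /F prod_rows [X in _ * (_ * X)%:C]big1 => [|j _].
    rewrite mulr1; congr (_ * _%:C); apply: eq_bigr => -[i j] _ /=.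
    by rewrite yl !ffunE /= split_lshiftE.
  by rewrite !ffunE /= split_rshiftE expr0.
have {}sm : (\esum_(al in setT) (normc (F al))%:E < +oo)%E.
  by move: sm; rewrite (eq_esum (b := fun al => (normc (F al))%:E)) // => al _; rewrite /= FE.
split.
  rewrite (eq_esum (b := fun be => (normc (F (ext_index 0%N be)))%:E)) => [|be _]; last first.
    by rewrite GE.
  apply: le_lt_trans sm; apply: ge_ereal_sup => _ [X [Xf _] <-].
  rewrite -(@fsbig_image _ _ _ _ _ X (ext_index 0%N) (fun al => (normc (F al))%:E)); last first.
    by move=> b1 b2 _ _ /(can_inj (ext_indexK 0%N)).
  apply: ereal_sup_ubound; exists (ext_index 0%N @` X) => //.
  by split=> //; exact: finite_image.
apply: cvg_trans cv; apply: near_eq_cvg; near=> N.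
have N0 : (0 < N)%N by near: N; exact: nbhs_infty_gt.
have [n ->] : exists n, N = n.+1 by exists N.-1; rewrite prednK.
rewrite (bigID (fun al : {ffun 'I_(m + 1) * 'I_d -> 'I_n.+1} =>
   [forall j, al (rshift m ord0, j) == ord0])) /= [X in _ + X]big1 ?addr0; last first.
  move=> al; rewrite negb_forall => /existsP[j alj]; rewrite FE /F prod_rows (bigD1 j) //=.
  rewrite yr ffunE expr0n -val_eqE /= in alj *.
  by rewrite (negPf alj) mul0r mulr0 (mulr0 (c _)).
rewrite (reindex_onto (ext_index ord0) (@res_index _)) /=; last first.
  move=> al /forallP al0; apply/ffunP => -[i j]; rewrite !ffunE /=.
  rewrite -[in RHS](splitK i); case: (fintype.split i) => k /=; first by rewrite ffunE.
  by rewrite (ord1 k) (eqP (al0 j)).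
apply: eq_big => [be|be _].
  rewrite ext_indexK eqxx andbT; apply/forallP => j.
  by rewrite ffunE /= split_rshiftE.
rewrite GE FE; congr F; apply/ffunP => -[i j]; rewrite !ffunE /=.
by case: (fintype.split i) => k //=; rewrite ffunE.
Unshelve. all: by end_near. Qed.
End AnalyticSlice.
(** * Topology of spaces of configurations *)

Section MatrixTopology.
Variables (R : realType).

Lemma ball_mx m n (z y : 'M[R]_(m, n)) (e : R) : 0 < e ->
  (forall i j, `|z i j - y i j| < e) -> ball z e y.
Proof. by move=> e0 zy; split=> // i j; exact: zy. Qed.

Lemma continuous_mx (T : topologicalType) m n (F : T -> 'M[R]_(m, n)) :
  (forall i j, continuous (fun x => F x i j : R)) -> continuous F.
Proof.
move=> Fc z; apply/cvg_ballP => e e0.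
have : \forall x \near z, forall k : 'I_m * 'I_n, `|F z k.1 k.2 - F x k.1 k.2| < e.
  apply: filter_forall => k; have := Fc k.1 k.2 z.
  by move=> /cvgr_dist_lt; exact.
by apply: filterS => x Fx; apply: ball_mx => // i j; exact: (Fx (i, j)).
Qed.

(** Closed boxes are compact; the statement for row vectors is transported by the
    reshaping of row vectors into matrices. *)
Lemma mx_compact_nbhs m n (Om : set 'M[R]_(m, n))
    (z : 'M[R]_(m, n)) : nbhs z Om ->
  exists N, [/\ nbhs z N, compact N & N `<=` Om].
Proof.
move=> /nbhs_ballP[e /= e0 zOm].
pose A (k : 'I_(m * n)) : set R := `[mxvec z 0 k - e / 2, mxvec z 0 k + e / 2]%classic.
pose B : set 'rV[R]_(m * n) := [set v | forall k, A k (v 0 k)].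
have Bc : compact B by apply: rV_compact => k; exact: segment_compact.
have e2 : 0 < e / 2 by rewrite divr_gt0.
have vc : continuous (vec_mx : 'rV[R]_(m * n) -> 'M[R]_(m, n)).
  apply: continuous_mx => i j v.
  have -> : (fun x : 'rV[R]_(m * n) => vec_mx x i j) = (fun x => x 0 (mxvec_index i j)).
    by apply/funext => x; rewrite mxE.
  exact: coord_continuous.
exists (vec_mx @` B); split.
- apply/nbhs_ballP; exists (e / 2) => //= y [_ zy].
  exists (mxvec y); last exact: mxvecK.
  move=> k; case/mxvec_indexP: k => i j; rewrite /A /= !mxvecE in_itv /=.
  have : `|z i j - y i j| < e / 2 by exact: zy.
  by rewrite ltr_norml => /andP[? ?]; apply/andP; split; lra.
- by apply: continuous_compact => //; exact: continuous_subspaceT.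
- move=> _ [v Bv <-]; apply: zOm; apply: ball_mx => // i j.
  have := Bv (mxvec_index i j); rewrite /A /= in_itv /= mxvecE mxE => /andP[? ?].
  by rewrite ltr_norml; apply/andP; split; lra.
Qed.

Variable d : nat.

Lemma row_coord_continuous n (i : 'I_n) mu : continuous (fun x : 'M[R]_(n, d) => row i x 0 mu : R).
Proof.
move=> z; have -> : (fun x : 'M[R]_(n, d) => row i x 0 mu : R) = (fun x => x i mu).
  by apply/funext => x; rewrite mxE.
exact: coord_continuous.
Qed.

Lemma enorm_continuous (T : topologicalType) (f : T -> 'rV[R]_d) :
  (forall mu, continuous (fun x => f x 0 mu : R)) -> continuous (fun x => enorm (f x)).
Proof.
move=> fc.
have sum_cont (s : seq 'I_d) : continuous (fun x => \sum_(mu <- s) f x 0 mu ^+ 2 : R).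
  elim: s => [|mu s IHs] z.
    have -> : (fun x => \sum_(mu <- [::]) f x 0 mu ^+ 2 : R) = cst 0.
      by apply/funext => x; rewrite big_nil.
    exact: cst_continuous.
  have -> : (fun x => \sum_(nu <- mu :: s) f x 0 nu ^+ 2 : R) =
      (fun x => f x 0 mu ^+ 2) \+ (fun x => \sum_(nu <- s) f x 0 nu ^+ 2).
    by apply/funext => x; rewrite big_cons.
  apply: continuousD; last exact: IHs.
  by apply: (@continuous_comp _ _ _ (fun x => f x 0 mu : R) (fun t : R => t ^+ 2));
    [exact: fc|exact: exprn_continuous].
move=> z; apply: (@continuous_comp _ _ _ (fun x => \sum_mu f x 0 mu ^+ 2) (@Num.sqrt R)).
  exact: sum_cont.
exact: sqrt_continuous.
Qed.

Lemma near_lt (T : topologicalType) (f g : T -> R) z : {for z, continuous f} ->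
  {for z, continuous g} -> f z < g z -> \forall x \near z, f x < g x.
Proof.
move=> fc gc fg; have h : {for z, continuous (fun x => g x - f x)} by exact: continuousB.
have : \forall x \near z, 0 < g x - f x.
  by apply: (cvgr_gt (g z - f z)); [exact: h|rewrite subr_gt0].
by apply: filterS => x; rewrite subr_gt0.
Qed.
End MatrixTopology.

(** * Convergence of products and iterates *)

Section Convergence.
Variables (R : realType) (d : nat) (H : lmodType R[i]).
Variable act : so R d -> H -> H.
Variable YY : forall n, 'M[R]_(n, d) -> ('I_n -> H) -> (R -> H).
Variables (vac : H) (Y : H -> H -> sseries d H).
Hypothesis CC : CC_system act YY vac.
Hypothesis av : associated_vertex_operator act YY Y.
Let cm := CC_compact CC.
Implicit Types (a b : H) (x y : 'rV[R]_d) (De : R) (u : {linear H -> R[i]^o}).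

Definition pt3 y0 y1 y2 : 'M[R]_(1 + (1 + 1), d) := col_mx y0 (col_mx y1 y2).

Definition vec3 b0 b1 b2 : 'I_(1 + (1 + 1)) -> H :=
  fcat (fun _ : 'I_1 => b0) (fcat (fun _ : 'I_1 => b1) (fun _ : 'I_1 => b2)).

Definition YY3 y0 y1 y2 b0 b1 b2 := @YY (1 + (1 + 1))%N (pt3 y0 y1 y2) (vec3 b0 b1 b2).

Definition i30 : 'I_(1 + (1 + 1)) := lshift (1 + 1) ord0.
Definition i31 : 'I_(1 + (1 + 1)) := rshift 1 (lshift 1 ord0).
Definition i32 : 'I_(1 + (1 + 1)) := rshift 1 (rshift 1 ord0).

Lemma ord3P (P : 'I_(1 + (1 + 1)) -> Prop) : P i30 -> P i31 -> P i32 -> forall i, P i.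
Proof.
move=> P0 P1 P2 i; rewrite -(splitK i); case: (fintype.split i) => j /=.
  by rewrite (ord1 j).
by move: j; apply: ord2P.
Qed.

Lemma row_pt3 y0 y1 y2 :
  [/\ row i30 (pt3 y0 y1 y2) = y0, row i31 (pt3 y0 y1 y2) = y1
     & row i32 (pt3 y0 y1 y2) = y2].
Proof. by split; rewrite /pt3 ?rowKd ?rowKu ?row_id. Qed.

Lemma vec3E b0 b1 b2 :
  [/\ vec3 b0 b1 b2 i30 = b0, vec3 b0 b1 b2 i31 = b1 & vec3 b0 b1 b2 i32 = b2].
Proof.
split; rewrite /vec3 /fcat;
  by rewrite ?split_lshiftE ?split_rshiftE ?split_lshiftE ?split_rshiftE.
Qed.

Lemma Conf_pt3 y0 y1 y2 : y0 != y1 -> y0 != y2 -> y1 != y2 -> Conf (pt3 y0 y1 y2).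
Proof.
move=> y01 y02 y12; have [r0 r1 r2] := row_pt3 y0 y1 y2.
by apply: ord3P; apply: ord3P; rewrite ?eqxx // => _; rewrite ?r0 ?r1 ?r2 // eq_sym.
Qed.

Lemma YY3_swap01 y0 y1 y2 b0 b1 b2 : y0 != y1 -> y0 != y2 -> y1 != y2 ->
  YY3 y0 y1 y2 b0 b1 b2 = YY3 y1 y0 y2 b1 b0 b2.
Proof.
move=> y01 y02 y12.
have [r0 r1 r2] := row_pt3 y0 y1 y2; have [q0 q1 q2] := row_pt3 y1 y0 y2.
have [v0 v1 v2] := vec3E b0 b1 b2; have [w0 w1 w2] := vec3E b1 b0 b2.
apply: (YY_reindex CC (s := tperm i30 i31)) => //; first exact: Conf_pt3.
- by apply: ord3P; rewrite ?tpermL ?tpermR ?tpermD ?r0 ?r1 ?r2 ?q0 ?q1 ?q2.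
- by apply: ord3P; rewrite ?tpermL ?tpermR ?tpermD ?v0 ?v1 ?v2 ?w0 ?w1 ?w2.
Qed.

Lemma YY3_swap12 y0 y1 y2 b0 b1 b2 : y0 != y1 -> y0 != y2 -> y1 != y2 ->
  YY3 y0 y1 y2 b0 b1 b2 = YY3 y0 y2 y1 b0 b2 b1.
Proof.
move=> y01 y02 y12.
have [r0 r1 r2] := row_pt3 y0 y1 y2; have [q0 q1 q2] := row_pt3 y0 y2 y1.
have [v0 v1 v2] := vec3E b0 b1 b2; have [w0 w1 w2] := vec3E b0 b2 b1.
apply: (YY_reindex CC (s := tperm i31 i32)) => //; first exact: Conf_pt3.
- by apply: ord3P; rewrite ?tpermL ?tpermR ?tpermD ?r0 ?r1 ?r2 ?q0 ?q1 ?q2.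
- by apply: ord3P; rewrite ?tpermL ?tpermR ?tpermD ?v0 ?v1 ?v2 ?w0 ?w1 ?w2.
Qed.

Definition pt2 x y : 'M[R]_(1 + 1, d) := col_mx x y.

Definition vec2 a b : 'I_(1 + 1) -> H := fcat (fun _ : 'I_1 => a) (fun _ : 'I_1 => b).

Lemma YY2_swap x a b : x != 0 -> YY2 YY x a b = @YY (1 + 1)%N (pt2 0 x) (vec2 b a).
Proof.
move=> x0; apply: (YY_reindex CC (s := tperm (lshift 1 ord0) (rshift 1 ord0))) => //.
- exact: Conf_pair.
- by apply: ord2P; rewrite ?tpermL ?tpermR ?rowKu ?rowKd.
- by apply: ord2P; rewrite ?tpermL ?tpermR /vec2 !fcat11E.
Qed.

Lemma CC_dom_pt2 x w y z : x != w -> y != z -> enorm y < enorm (x - w) ->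
  enorm z < enorm (x - w) -> CC_dom ((pt2 x w, pt2 y z) : 'M[R]_(1 + 1, d) * 'M[R]_(1 + 1, d)).
Proof.
move=> xw yz yx zx; split; [exact: Conf_pair|exact: Conf_pair|move=> k].
rewrite (ord1 k) /= col_mxKu col_mxKd row_id.
by apply: ord2P; rewrite ?rowKu ?rowKd !row_id.
Qed.

Lemma CC_merge_pt2 x w y z :
  CC_merge ((pt2 x w, pt2 y z) : 'M[R]_(1 + 1, d) * 'M[R]_(1 + 1, d)) = pt3 x (w + y) (w + z).
Proof.
rewrite /CC_merge /pt3 /= col_mxKu col_mxKd; congr col_mx.
apply/row_matrixP; apply: ord2P; apply/rowP => j.
  by rewrite !mxE !split_lshiftE !mxE.
by rewrite !mxE !split_rshiftE !mxE.
Qed.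

(** A term of the product is a term of the cluster expansion in which the points
    [x2] and 0 are fused at 0. *)
Lemma product_termE u a1 a2 a3 De x1 x2 : in_Hvee act u -> x1 != 0 -> x2 != 0 ->
  product_term act Y u a1 a2 a3 De x1 x2 =
  CC_cluster_term YY u (fun _ : 'I_1 => a1) (vec2 a2 a3) De (pt2 x1 0, pt2 x2 0).
Proof.
move=> uv x10 x20; rewrite /product_term (Y_pr_value CC av) //.
by rewrite (Y_value CC av).
Qed.

(** A term of the iterate is a term of the cluster expansion in which the points
    [x0] and 0 are fused at [x2]. *)
Lemma iterate_termE u a1 a2 a3 De x0 x2 : in_Hvee act u -> x0 != 0 -> x2 != 0 ->
  iterate_term act Y u a1 a2 a3 De x0 x2 =
  CC_cluster_term YY u (fun _ : 'I_1 => a3) (vec2 a1 a2) De (pt2 0 x2, pt2 x0 0).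
Proof.
move=> uv x00 x20; rewrite /iterate_term (Y_pr_value CC av) //.
by rewrite (Y_value CC av) // YY2_swap.
Qed.

Lemma enorm0 : enorm (0 : 'rV[R]_d) = 0.
Proof. by rewrite /enorm big1 ?sqrtr0 // => mu _; rewrite mxE expr0n. Qed.

Lemma enormN x : enorm (- x) = enorm x.
Proof. by congr Num.sqrt; apply: eq_bigr => mu _; rewrite mxE sqrrN. Qed.

Lemma enorm_pos_neq0 x : 0 < enorm x -> x != 0.
Proof. by apply: contraTneq => ->; rewrite enorm0 ltxx. Qed.

Definition coord_cont (T : topologicalType) (f : T -> 'rV[R]_d) :=
  forall mu, continuous (fun z => f z 0 mu : R).

Lemma continuous_pt2 (T : topologicalType) (f g : T -> 'rV[R]_d) :
  coord_cont f -> coord_cont g -> continuous (fun z => pt2 (f z) (g z)).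
Proof.
move=> fc gc; apply: continuous_mx; apply: ord2P => j.
  have -> : (fun z => pt2 (f z) (g z) (lshift 1 ord0) j) = (fun z => f z 0 j).
    by apply/funext => z; rewrite /pt2 col_mxEu.
  exact: fc.
have -> : (fun z => pt2 (f z) (g z) (rshift 1 ord0) j) = (fun z => g z 0 j).
  by apply/funext => z; rewrite /pt2 col_mxEd.
exact: gc.
Qed.

Lemma coord_cont0 (T : topologicalType) : coord_cont (fun _ : T => 0).
Proof. by move=> mu; exact: cst_continuous. Qed.

Lemma coord_cont_fst : coord_cont (@fst_pt R d).
Proof. by move=> mu; exact: row_coord_continuous. Qed.

Lemma coord_cont_snd : coord_cont (@snd_pt R d).
Proof. by move=> mu; exact: row_coord_continuous. Qed.

Lemma coord_contB (T : topologicalType) (f g : T -> 'rV[R]_d) :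
  coord_cont f -> coord_cont g -> coord_cont (fun z => f z - g z).
Proof.
move=> fc gc mu z; have -> : (fun z => (f z - g z) 0 mu : R) =
    (fun z => f z 0 mu) \- (fun z => g z 0 mu).
  by apply/funext => y; rewrite !mxE.
by apply: continuousB; [exact: fc|exact: gc].
Qed.

Lemma annulus_nbhs (f g : 'M[R]_(2, d) -> 'rV[R]_d) z : coord_cont f -> coord_cont g ->
  0 < enorm (f z) < enorm (g z) -> nbhs z [set x | 0 < enorm (f x) < enorm (g x)].
Proof.
move=> fc gc /andP[f0 fg].
have A := near_lt (@cst_continuous _ _ 0 z) (enorm_continuous fc (x := z)) f0.
have B := near_lt (enorm_continuous fc (x := z)) (enorm_continuous gc (x := z)) fg.
by apply: filterS2 A B => x; rewrite /cst => f0x fgx; apply/andP.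
Qed.

(** Cluster decomposition is uniform on compact sets of pairs of configurations;
    it is pulled back to a compact neighbourhood. *)
Lemma cluster_locally_unif u a b1 b2 (Om : set 'M[R]_(2, d))
    (al be ga de : 'M[R]_(2, d) -> 'rV[R]_d) (f : R -> 'M[R]_(2, d) -> R[i])
    (g : 'M[R]_(2, d) -> R[i]) : in_Hvee act u ->
  coord_cont al -> coord_cont be -> coord_cont ga -> coord_cont de ->
  (forall z, Om z -> nbhs z Om) ->
  (forall z, Om z -> CC_dom ((pt2 (al z) (be z), pt2 (ga z) (de z))
     : 'M[R]_(1 + 1, d) * 'M[R]_(1 + 1, d))) ->
  (forall De z, Om z -> f De z = CC_cluster_term YY u (fun _ : 'I_1 => a) (vec2 b1 b2) De
     (pt2 (al z) (be z), pt2 (ga z) (de z))) ->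
  (forall z, Om z -> g z = pairing u (YY3 (al z) (be z + ga z) (be z + de z) a b1 b2)) ->
  sum_locally_unif_on Om f g.
Proof.
move=> uv alc bec gac dec Omo dom fE gE z Oz.
pose h z : 'M[R]_(1 + 1, d) * 'M[R]_(1 + 1, d) := (pt2 (al z) (be z), pt2 (ga z) (de z)).
have hc : continuous h.
  move=> y; exact: (@cvg_pair _ _ _ _ (nbhs (pt2 (al y) (be y)))
    (nbhs (pt2 (ga y) (de y))) _ _ _ _ _ (continuous_pt2 alc bec (x := y))
    (continuous_pt2 gac dec (x := y))).
have [N [Nz Nc NOm]] := mx_compact_nbhs (Omo z Oz); exists N => // e e0.
have Kc : compact (h @` N).
  by apply: continuous_compact => //; exact: continuous_subspaceT.
have KD : h @` N `<=` @CC_dom R d 1 (1 + 1) by move=> _ [y /NOm Oy <-]; exact: dom.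
have := CC_cluster CC (fun _ : 'I_1 => a) (vec2 b1 b2) (ltn0Sn 1) uv Kc KD e0.
apply: filterS => M KM y [Oy Ny]; have := KM (h y) (ex_intro2 _ _ y Ny erefl).
rewrite CC_merge_pt2 gE //.
by have -> : f^~ y = (fun De => CC_cluster_term YY u (fun _ : 'I_1 => a) (vec2 b1 b2) De (h y))
  by apply/funext => De; exact: fE.
Qed.

Lemma col_mx_pt3 (x : 'M[R]_(2, d)) :
  (col_mx x 0 : 'M[R]_(2 + 1, d)) = pt3 (fst_pt x) (snd_pt x) 0.
Proof.
have [r0 r1 r2] := row_pt3 (fst_pt x) (snd_pt x) 0.
apply/row_matrixP; apply: ord3P; rewrite ?r0 ?r1 ?r2.
- have -> : i30 = lshift 1 (0 : 'I_2) by exact: val_inj.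
  exact: rowKu.
- have -> : i31 = lshift 1 (1 : 'I_2) by exact: val_inj.
  exact: rowKu.
- have -> : i32 = rshift 2 (0 : 'I_1) by exact: val_inj.
  by rewrite rowKd row_id.
Qed.

(** The products in both orders and the iterate are cluster expansions of one
    function, the three-point function with third point at the origin, up to a
    permutation of the points. *)
Lemma vertex_converges : vertex_convergence act Y.
Proof.
move=> u a1 a2 a3 uv; split=> [x1 x2 /andP[x20 x21]|x0 x2 /andP[x00 x02]|].
- have x2n := enorm_pos_neq0 x20; have x1n := enorm_pos_neq0 (lt_trans x20 x21).
  have -> : (fun De => product_term act Y u a1 a2 a3 De x1 x2) =
      (fun De => CC_cluster_term YY u (fun _ : 'I_1 => a1) (vec2 a2 a3) De (pt2 x1 0, pt2 x2 0)).
    by apply/funext => De; exact: product_termE.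
  apply: (CC_cluster_summable CC) => //; apply: CC_dom_pt2; rewrite ?subr0 ?enorm0 //.
  exact: lt_trans x20 x21.
- have x0n := enorm_pos_neq0 x00; have x2n := enorm_pos_neq0 (lt_trans x00 x02).
  have -> : (fun De => iterate_term act Y u a1 a2 a3 De x0 x2) =
      (fun De => CC_cluster_term YY u (fun _ : 'I_1 => a3) (vec2 a1 a2) De (pt2 0 x2, pt2 x0 0)).
    by apply/funext => De; exact: iterate_termE.
  apply: (CC_cluster_summable CC) => //; apply: CC_dom_pt2; rewrite ?sub0r ?enormN ?enorm0 //.
    by rewrite eq_sym.
  exact: lt_trans x00 x02.
(* The third point is the last row, as in [analytic_slice]. *)
pose phi (x : 'M[R]_(2, d)) := pairing u (@YY (2 + 1)%N (col_mx x 0) (vec3 a1 a2 a3)).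
have phiE (x : 'M[R]_(2, d)) : phi x = pairing u (YY3 (fst_pt x) (snd_pt x) 0 a1 a2 a3).
  by rewrite /phi col_mx_pt3.
exists phi; split.
- have an : real_analytic_on (@Conf R (2 + 1) d)
      (fun p : 'M[R]_(2 + 1, d) => pairing u (@YY (2 + 1)%N p (vec3 a1 a2 a3))).
    exact: (CC_analytic CC (vec3 a1 a2 a3) (ltn0Sn 2) uv).
  move=> p [p1 p2 p12]; apply: (analytic_slice an) => /=.
  by rewrite col_mx_pt3; exact: Conf_pt3.
- apply: (cluster_locally_unif (a := a1) (b1 := a2) (b2 := a3) (al := @fst_pt R d)
    (be := fun=> 0) (ga := @snd_pt R d) (de := fun=> 0)).
  + exact: uv.
  + exact: coord_cont_fst.
  + exact: coord_cont0.
  + exact: coord_cont_snd.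
  + exact: coord_cont0.
  + by move=> z; apply: annulus_nbhs; [exact: coord_cont_snd|exact: coord_cont_fst].
  + move=> z /= /andP[z0 z1]; apply: CC_dom_pt2; rewrite ?subr0 ?enorm0 //;
      rewrite ?enorm_pos_neq0 //; exact: lt_trans z0 z1.
  + move=> De z /= /andP[z0 z1]; apply: product_termE => //; apply: enorm_pos_neq0 => //.
    exact: lt_trans z0 z1.
  + by move=> z _; rewrite phiE !add0r.
- apply: (cluster_locally_unif (a := a2) (b1 := a1) (b2 := a3) (al := @snd_pt R d)
    (be := fun=> 0) (ga := @fst_pt R d) (de := fun=> 0)).
  + exact: uv.
  + exact: coord_cont_snd.
  + exact: coord_cont0.
  + exact: coord_cont_fst.
  + exact: coord_cont0.
  + by move=> z; apply: annulus_nbhs; [exact: coord_cont_fst|exact: coord_cont_snd].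
  + move=> z /= /andP[z0 z1]; apply: CC_dom_pt2; rewrite ?subr0 ?enorm0 //;
      rewrite ?enorm_pos_neq0 //; exact: lt_trans z0 z1.
  + move=> De z /= /andP[z0 z1]; apply: product_termE => //; apply: enorm_pos_neq0 => //.
    exact: lt_trans z0 z1.
  + move=> z /= /andP[z0 z1]; rewrite phiE !add0r YY3_swap01 //.
    * by apply: contraTneq z1 => ->; rewrite ltxx.
    * exact: enorm_pos_neq0.
    * by apply: enorm_pos_neq0; exact: lt_trans z0 z1.
- apply: (cluster_locally_unif (a := a3) (b1 := a1) (b2 := a2) (al := fun=> 0)
    (be := @snd_pt R d) (ga := fun z => fst_pt z - snd_pt z) (de := fun=> 0)).
  + exact: uv.
  + exact: coord_cont0.
  + exact: coord_cont_snd.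
  + by apply: coord_contB; [exact: coord_cont_fst|exact: coord_cont_snd].
  + exact: coord_cont0.
  + move=> z; apply: annulus_nbhs; last exact: coord_cont_snd.
    by apply: coord_contB; [exact: coord_cont_fst|exact: coord_cont_snd].
  + move=> z /= /andP[z0 z1]; apply: CC_dom_pt2; rewrite ?sub0r ?enormN ?enorm0 //.
    * by rewrite eq_sym enorm_pos_neq0 //; exact: lt_trans z0 z1.
    * exact: enorm_pos_neq0.
    * exact: lt_trans z0 z1.
  + move=> De z /= /andP[z0 z1]; apply: iterate_termE => //; apply: enorm_pos_neq0 => //.
    exact: lt_trans z0 z1.
  + move=> z /= /andP[z0 z1]; rewrite phiE addrC subrK addr0.
    have z2n : snd_pt z != 0 by apply: enorm_pos_neq0; exact: lt_trans z0 z1.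
    have z1n : fst_pt z != 0.
      by apply: contraTneq z1 => ->; rewrite sub0r enormN ltxx.
    have z12 : fst_pt z != snd_pt z.
      by rewrite -subr_eq0; exact: enorm_pos_neq0.
    by rewrite YY3_swap12 // YY3_swap01 // eq_sym.
Qed.
End Convergence.
Theorem theorem2p13 (R : realType) (d : nat) (d_ge2 : (2 <= d)%N)
    (H : lmodType R[i]) (act : so R d -> H -> H)
    (YY : forall n : nat, 'M[R]_(n, d) -> ('I_n -> H) -> (R -> H)) (vac : H)
    (Y : H -> H -> sseries d H) :
  CC_system act YY vac ->
  associated_vertex_operator act YY Y ->
  conformal_vertex_algebra act Y vac.
Proof.
move=> CC av; have i0 : 'I_d := Ordinal (ltnW d_ge2).
split.
- exact: CC_compact CC.
- exact: assoc_vertex_map av.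
- split=> [mu a b|A a b]; first exact: (vertex_covariant_P CC av i0).
  exact: (vertex_covariant_so CC av i0).
- exact: CC_vac_wt CC.
- exact: CC_vac_inv CC.
- exact: (vertex_vac_left CC av i0).
- move=> a; exists (fun al => exp_coef act (mdeg al) a al); last by rewrite mdeg_mone.
  exact: (vertex_vac_right CC av i0).
- exact: (vertex_converges CC av).
Qed.
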